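(* Let $\hat N$ be a compensated Poisson measure on $(Z,\mathcal Z)$ with $\sigma$-finite and non-atomic control measure $\nu$. Then, for every $p,q\ge1$, $f\in\mathcal E_{s,0}(\nu^p)$ and $g\in\mathcal E_{s,0}(\nu^q)$, $$I^{\hat N}_p(f)\,I^{\hat N}_q(g)=\sum_{r=0}^{p\wedge q}r!\binom pr\binom qr\sum_{l=0}^r\binom rl\,I^{\hat N}_{p+q-r-l}\left(\widetilde{f\star^l_rg}\right).$$ This formula continues to hold for functions $f\in L^2_s(\nu^p)$ and $g\in L^2_s(\nu^q)$ such that $f\star^l_rg\in L^2(\nu^{p+q-r-l})$ for all $r=0,\dots,p\wedge q$ and all $l=0,\dots,r$.
   Context: $(Z,\mathcal Z)$ is a Polish space with its Borel $\sigma$-field, $\mathcal Z_\nu=\{B\in\mathcal Z:\nu(B)<\infty\}$. A compensated Poisson measure with control $\nu$ is a family $\hat N=\{\hat N(B):B\in\mathcal Z_\nu\}$ of random variables such that: $\hat N(B)$ has the law of $N(B)-\nu(B)$ with $N(B)$ Poisson of parameter $\nu(B)$; $\hat N(B_1),\dots,\hat N(B_m)$ are independent for disjoint $B_1,\dots,B_m\in\mathcal Z_\nu$; and $\mathbb E[\hat N(B)\hat N(C)]=\nu(B\cap C)$. $L^2_s(\nu^m)$ is the space of symmetric real functions in $L^2(Z^m,\nu^m)$; $\mathcal E_{s,0}(\nu^m)\subset L^2_s(\nu^m)$ is the set of finite real linear combinations of indicators of sets $\widetilde C=\bigcup_{w\in\mathfrak S_m}C_{w(1)}\times\cdots\times C_{w(m)}$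 with $C_1,\dots,C_m\in\mathcal Z_\nu$ pairwise disjoint ($\mathfrak S_m$ the permutations of $\{1,\dots,m\}$). The multiple Wiener-Itô integral $I^{\hat N}_m:L^2_s(\nu^m)\to L^2(\mathbb P)$ is the unique continuous linear operator such that $I^{\hat N}_m(\mathbf 1_{\widetilde C})=m!\,\hat N(C_1)\cdots\hat N(C_m)$ for all such $\widetilde C$; $I^{\hat N}_0(c)=c$ for constants $c$. Contractions: for $r=0,\dots,p\wedge q$ and $l=0,\dots,r$, $f\star^l_rg$ is the function of $p+q-r-l$ variables $$f\star_r^lg(\gamma_1,\dots,\gamma_{r-l},t_1,\dots,t_{p-r},s_1,\dots,s_{q-r})=\int_{Z^l}f(z_1,\dots,z_l,\gamma_1,\dots,\gamma_{r-l},t_1,\dots,t_{p-r})\,g(z_1,\dots,z_l,\gamma_1,\dots,\gamma_{r-l},s_1,\dots,s_{q-r})\,\nu^l(dz_1\cdots dz_l),$$ with no integration when $l=0$. Symmetrization: $\widetilde h(x_1,\dots,x_m)=\frac1{m!}\sum_{w\in\mathfrak S_m}h(x_{w(1)},\dots,x_{w(m)})$. $p\wedge q=\min(p,q)$. Equality is almost sure. *)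

(* Defs.v *)
From HB Require Import structures.
From mathcomp Require Import all_boot all_order all_algebra perm.
From mathcomp Require Import all_classical all_reals all_analysis.

Set Implicit Arguments.
Unset Strict Implicit.
Unset Printing Implicit Defensive.

Import Order.TTheory GRing.Theory Num.Theory.
Import numFieldNormedType.Exports.

Local Open Scope classical_set_scope.
Local Open Scope ring_scope.

(* Only the topology is intrinsic: the complete separable metric is merely
   required to exist. *)
Definition polish (R : realType) (T : topologicalType) : Prop :=
  (exists2 D : set T, countable D & dense D) /\
  exists dist : T -> T -> R,
    [/\ (forall x y, 0 <= dist x y) /\ (forall x y, dist x y = 0 <-> x = y),
        forall x y, dist x y = dist y x,
        forall x y z, dist x z <= dist x y + dist y z,
        forall (x : T) (A : set T),
          nbhs x A <-> exists2 e : R, 0 < e & [set y | dist x y < e] `<=` A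
      & forall u : nat -> T,
          (forall e : R, 0 < e -> exists N : nat, forall i j : nat,
             (N <= i)%N -> (N <= j)%N -> dist (u i) (u j) < e) ->
          exists x : T, u @ \oo --> x].

Definition borel (T : ptopologicalType) := g_sigma_algebraType (@open T).

Definition is_atom (d : measure_display) (T : measurableType d) (R : realType)
    (nu : {measure set T -> \bar R}) (A : set T) : Prop :=
  [/\ measurable A, (0 < nu A)%E
    & forall B, measurable B -> B `<=` A -> nu B = 0%E \/ nu (A `\` B) = 0%E].

Definition nonatomic (d : measure_display) (T : measurableType d)
    (R : realType) (nu : {measure set T -> \bar R}) : Prop :=
  forall A, ~ is_atom nu A.

Definition finite_sets (d : measure_display) (T : measurableType d)
    (R : realType) (nu : {measure set T -> \bar R}) : set (set T) :=
  [set B | measurable B /\ (nu B < +oo)%E].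

Section power_measure.
Context (d : measure_display) (T : measurableType d) (R : realType).

Definition tcons (m : nat) (x : T * m.-tuple T) : m.+1.-tuple T :=
  [tuple of x.1 :: x.2].

Definition tuncons (m : nat) (t : m.+1.-tuple T) : T * m.-tuple T :=
  (thead t, [tuple of behead t]).

Lemma tunconsK m : cancel (@tcons m) (@tuncons m).
Proof.
by move=> [x t]; rewrite /tuncons /tcons /=; congr pair; exact: val_inj.
Qed.

Lemma measurable_tcons m : measurable_fun [set: T * m.-tuple T] (@tcons m).
Proof. exact: measurable_cons. Qed.

Lemma measurable_tuncons m : measurable_fun [set: m.+1.-tuple T] (@tuncons m).
Proof.
apply: measurable_fun_pair; last exact: measurable_behead.
exact: measurable_tnth.
Qed.

HB.instance Definition _ m :=
  isMeasurableFun.Build _ _ _ _ (@tcons m) (@measurable_tcons m).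

Variable nu : {sigma_finite_measure set T -> \bar R}.

Section power_step.
Variables (m : nat) (mu : {sigma_finite_measure set (m.-tuple T) -> \bar R}).

Definition power_step : set (m.+1.-tuple T) -> \bar R :=
  pushforward (nu \x mu)%E (@tcons m).

Let power_step0 : power_step set0 = 0%E.
Proof. exact: measure0. Qed.

Let power_step_ge0 A : (0 <= power_step A)%E.
Proof. exact: measure_ge0. Qed.

Let power_step_sigma_additive : semi_sigma_additive power_step.
Proof. exact: measure_semi_sigma_additive. Qed.

HB.instance Definition _ := isMeasure.Build _ _ _ power_step
  power_step0 power_step_ge0 power_step_sigma_additive.

Let power_step_sigma_finite : sigma_finite setT power_step.
Proof.
have /sigma_finiteP[F [FT ndF Foo]] := sigma_finiteT nu.
have /sigma_finiteP[G [GT ndG Goo]] := sigma_finiteT mu.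
exists (fun k => @tuncons m @^-1` (F k `*` G k)).
  rewrite -preimage_bigcup (_ : \bigcup_k _ = setT) ?preimage_setT//.
  rewrite -setXTT FT GT predeqE => -[x y]; split.
    by move=> [n _ []/= ? ?]; split; exists n.
  move=> [/= [n _ Fnx] [k _ Gky]]; exists (maxn n k) => //; split.
  - by move: x Fnx; exact/subsetPset/ndF/leq_maxl.
  - by move: y Gky; exact/subsetPset/ndG/leq_maxr.
move=> k; have [mF Fk] := Foo k; have [mG Gk] := Goo k; split.
  rewrite -[X in measurable X]setTI.
  by apply: measurable_tuncons => //; exact: measurableX.
rewrite /power_step /pushforward -comp_preimage.
rewrite (_ : _ \o _ = id); last by rewrite funeqE => x; exact: tunconsK.
by rewrite preimage_id product_measure1E// lte_mul_pinfty// ge0_fin_numE.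
Qed.

HB.instance Definition _ := Measure_isSigmaFinite.Build _ _ _
  power_step power_step_sigma_finite.

End power_step.

(* The product measure nu^m on T^m; nu^0 is the unit mass on the empty tuple. *)
Fixpoint power_measure (m : nat) :
    {sigma_finite_measure set (m.-tuple T) -> \bar R} :=
  match m with
  | 0 => \d_([tuple] : 0.-tuple T)
  | m'.+1 => power_step (power_measure m')
  end.

End power_measure.

Section functions_of_several_variables.
Context (d : measure_display) (T : measurableType d) (R : realType).
Variable nu : {sigma_finite_measure set T -> \bar R}.

Definition permute (m : nat) (w : 'S_m) (x : m.-tuple T) : m.-tuple T :=
  [tuple tnth x (w i) | i < m].

Definition symmetrize (m : nat) (h : m.-tuple T -> R) : m.-tuple T -> R :=
  fun x => (m`!%:R)^-1 * \sum_(w : 'S_m) h (permute w x).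

(* Functions stand for their classes, so symmetry is required only almost
   everywhere. *)
Definition L2s (m : nat) : set (m.-tuple T -> R) :=
  [set f | f \in Lfun (power_measure nu m) 2%:E /\
           forall w : 'S_m, f \o permute w = f %[ae power_measure nu m]].

Definition disjoint_family (m : nat) (C : 'I_m -> set T) : Prop :=
  (forall i, finite_sets nu (C i)) /\ trivIset setT C.

Definition sym_rect (m : nat) (C : 'I_m -> set T) : set (m.-tuple T) :=
  \bigcup_(w in [set: 'S_m]) [set x | forall i, C (w i) (tnth x i)].

Definition Es0 (m : nat) : set (m.-tuple T -> R) :=
  [set f | exists (n : nat) (a : 'I_n -> R) (C : 'I_n -> 'I_m -> set T),
     (forall k, disjoint_family (C k)) /\
     f = fun x => \sum_(k < n) a k * \1_(sym_rect (C k)) x].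

(* f applied to a list of arguments; the value 0 for a list whose length is not
   m is never used. *)
Definition eval_seq (m : nat) (f : m.-tuple T -> R) (s : seq T) : R :=
  if insub s is Some t then f t else 0.

(* For l <= r <= minn p q, the p + q - r - l arguments are read as
   gamma (r - l of them), t (p - r), s (q - r); note (r - l) + (p - r) = p - l.
   For l = 0 the integral is evaluation at the empty tuple. *)
Definition star_contraction (p q : nat) (f : p.-tuple T -> R) (g : q.-tuple T -> R)
    (r l : nat) : (p + q - r - l).-tuple T -> R :=
  fun x =>
    let gamma := take (r - l) x in
    let t := take (p - r) (drop (r - l) x) in
    let s := drop (p - l) x in
    \int[power_measure nu l]_z
      (eval_seq f (z ++ gamma ++ t) * eval_seq g (z ++ gamma ++ s)).

End functions_of_several_variables.

Arguments star_contraction {d T R} nu {p q} f g r l x.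

Section poisson_chaos.
Context (d : measure_display) (T : measurableType d) (R : realType).
Context (d' : measure_display) (Omega : measurableType d').
Variable nu : {sigma_finite_measure set T -> \bar R}.
Variable P : probability Omega R.

Definition independent_RVs (m : nat) (X : 'I_m -> {RV P >-> R}) : Prop :=
  forall A : 'I_m -> set R, (forall i, measurable (A i)) ->
    P (\bigcap_(i in [set: 'I_m]) (X i @^-1` A i)) =
    (\prod_(i < m) P (X i @^-1` A i))%E.

(* The second argument of poisson_prob is a dummy; poisson_prob 0 is the unit
   mass at 0. The values of N outside finite_sets nu are irrelevant. *)
Definition compensated_poisson (N : set T -> {RV P >-> R}) : Prop :=
  [/\ forall B, finite_sets nu B ->
        forall A : set R, measurable A ->
          distribution P (N B) A =
          poisson_prob (fine (nu B)) 0
            [set k : nat | A (k%:R - fine (nu B))],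
      forall (m : nat) (B : 'I_m -> set T), disjoint_family nu B ->
        independent_RVs (fun i => N (B i))
    & forall B C, finite_sets nu B -> finite_sets nu C ->
        ('E_P[fun o => (N B o * N C o)%R] = nu (B `&` C))%E].

(* J : L2s(nu^m) -> L2(P) is linear, continuous and has the prescribed values
   on indicators; J acts on representatives and its values are meant up to
   P-almost sure equality. *)
Definition multiple_integral (N : set T -> {RV P >-> R}) (m : nat)
    (J : (m.-tuple T -> R) -> Omega -> R) : Prop :=
  [/\ forall f, L2s nu f -> J f \in Lfun P 2%:E,
      forall (a : R) f g, L2s nu f -> L2s nu g ->
        J (fun x => a * f x + g x) = (fun o => a * J f o + J g o) %[ae P],
      forall f, L2s nu f -> forall e : R, 0 < e ->
        exists2 delta : R, 0 < delta &
          forall g, L2s nu g ->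
            ('N[power_measure nu m]_2%:E[EFin \o (g \- f)%R] < delta%:E)%E
            -> ('N[P]_2%:E[EFin \o (J g \- J f)%R] < e%:E)%E
    & forall C : 'I_m -> set T, disjoint_family nu C ->
        J (\1_(sym_rect C)) =
        (fun o => m`!%:R * \prod_(i < m) N (C i) o) %[ae P]].

Definition wiener_ito (N : set T -> {RV P >-> R})
    (I : forall m : nat, (m.-tuple T -> R) -> Omega -> R) : Prop :=
  (forall c : R, I 0 (fun=> c) = (fun=> c) %[ae P]) /\
  (forall m : nat, (0 < m)%N -> multiple_integral N (I m)).

Definition product_formula
    (I : forall m : nat, (m.-tuple T -> R) -> Omega -> R)
    (p q : nat) (f : p.-tuple T -> R) (g : q.-tuple T -> R) : Prop :=
  (fun o => I p f o * I q g o) =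
  (fun o => \sum_(r < (minn p q).+1)
     r`!%:R * 'C(p, r)%:R * 'C(q, r)%:R *
     \sum_(l < r.+1)
       'C(r, l)%:R *
       I (p + q - r - l)%N (symmetrize (star_contraction nu f g r l)) o)
  %[ae P].

End poisson_chaos.

(* Main.v *)
(** Fix countably many sets of finite measure which generate the Borel
    sigma-field and separate points.  The first n of them cut the space into
    finitely many cells, whose measures become uniformly negligible as n grows
    because nu has no atoms.  For a set S of cells let V_S be the indicator that
    no point falls in S.  For f and g constant on the cells of a finer level,
    I_p(f) I_q(g) is a polynomial in independent centred Poisson variables, and
    expanding E[I_p(f) I_q(g) V_S] cell by cell gives
      E[V_S] * sum_r r! C(p,r) C(q,r) sum_l C(r,l) J_(r,l)(f,g),
    where J_(r,l) is the integral over Z^(p+q-r) of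
    f(x_1..x_p) g(x_1..x_r, x_(p+1)..) prod_(i > l) (- 1_S(x_i)).
    By density in L2 this holds for all symmetric f and g.  The case q = 0 reads
    E[I_m(h) V_S] = E[V_S] * int h (- 1_S)^(tensor m), and by Fubini J_(r,l) is
    that integral for h = f star_r^l g.  Hence the difference Y of the two sides
    of the product formula satisfies E[Y V_S] = 0 for every S.

    These identities force Y = 0: linear combinations of the V_S give all
    functions of the emptiness indicators of small cells, and up to an event of
    probability at most the sum of the squared measures of these cells, such
    indicators determine the values of N on the larger ones, of which Y is an
    L1 limit of functions.  So E[Y clip(Y)] = 0, with clip the truncation to
    [-1, 1].

    For f and g in Es0 the contractions are bounded with support of finite
    measure, so the first claim is an instance of the second. *)

Require Import Defs.
From HB Require Import structures.
From mathcomp Require Import all_boot all_order all_algebra perm ring lra zify.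
From mathcomp Require Import all_classical all_reals all_analysis.
From mathcomp Require Import measurable_realfun.

Set Implicit Arguments.
Unset Strict Implicit.
Unset Printing Implicit Defensive.

Import Order.TTheory GRing.Theory Num.Theory.
Import numFieldNormedType.Exports.

Local Open Scope classical_set_scope.
Local Open Scope ring_scope.

(** * Sums over words *)

(** The second claim is not a limit of the first: for l < r, L2 convergence of f and g does not give
    convergence of f star_r^l g. Paired with (- 1_S)^(tensor m) it does: the integrand of J_(r,l) is
    a product of two factors, each square integrable with norm controlled by that of f or of g,
    because S has finite measure. So the limit is taken in the tested identity only; the square
    integrability of the contractions gives meaning to the right-hand side and identifies its tested
    form with J_(r,l).

    Why V_S: V_S / E[V_S] is the density that changes the intensity nu into (1 - 1_S) nu. Under it
    N(D), for a cell D, has mean nu(D) phi and variance nu(D) (1 + phi), where phi is -1 on the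
    cells of S and 0 on the others. Expanding 1 + phi for each of r matched variables produces the
    sum over l: l of them are integrated out, r - l keep the weight phi.

    A priori I_p(f) I_q(g) is only in L1, so Y can be tested against bounded functions only; hence
    E[Y clip(Y)] = 0 in place of an orthogonality argument in L2. *)

Section weighted_sums.
Context {R : comPzRingType} {X : finType}.
Implicit Types (w : X -> R) (F G H : seq X -> R) (s t : seq X).

(** Common discrete form of two objects: with [w] the measures of the cells it is an integral over
    the m-th power of nu, with [w] the values of N on the cells it is a multiple integral of order
    m. *)
Fixpoint wsum w (m : nat) H : R :=
  if m is m'.+1 then \sum_x w x * wsum w m' (fun t => H (x :: t)) else H [::].

Definition perm_inv H := forall s t, perm_eq s t -> H s = H t.

Lemma eq_wsum w m H H' : (forall s, size s = m -> H s = H' s) ->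
  wsum w m H = wsum w m H'.
Proof.
elim: m H H' => [|m IH] H H' HH' /=; first exact: HH'.
by apply: eq_bigr => x _; congr (_ * _); apply: IH => s sm; rewrite HH'//= sm.
Qed.

Lemma wsumD w m H H' : wsum w m (fun s => H s + H' s) = wsum w m H + wsum w m H'.
Proof.
elim: m H H' => //= m IH H H'; rewrite -big_split/=.
by apply: eq_bigr => x _; rewrite IH mulrDr.
Qed.

Lemma wsumZ w m c H : wsum w m (fun s => c * H s) = c * wsum w m H.
Proof.
elim: m H => //= m IH H; rewrite mulr_sumr.
by apply: eq_bigr => x _; rewrite IH mulrCA.
Qed.

Lemma wsumZr w m c H : wsum w m (fun s => H s * c) = wsum w m H * c.
Proof.
by rewrite mulrC -wsumZ; apply: eq_wsum => s _; rewrite mulrC.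
Qed.

Lemma wsum_sum w m (I : finType) (H : I -> seq X -> R) :
  wsum w m (fun s => \sum_i H i s) = \sum_i wsum w m (H i).
Proof.
elim: m H => //= m IH H; rewrite exchange_big/=.
by apply: eq_bigr => x _; rewrite IH mulr_sumr.
Qed.

Lemma wsum_cat w a b H :
  wsum w (a + b) H = wsum w a (fun s => wsum w b (fun t => H (s ++ t))).
Proof.
elim: a H => //= a IH H.
by apply: eq_bigr => x _; rewrite IH.
Qed.

Lemma wsum_tuple w m H :
  wsum w m H = \sum_(a : m.-tuple X) (\prod_(x <- a) w x) * H a.
Proof.
elim: m H => [|m IH] H /=.
  rewrite (big_pred1 [tuple]) ?big_nil ?mul1r// => a.
  by rewrite [RHS]/= [a]tuple0; exact/esym/eqP.
under eq_bigr do rewrite IH mulr_sumr.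
rewrite pair_bigA/=.
rewrite (reindex (fun p : X * m.-tuple X => [tuple of p.1 :: p.2]))/=.
  by apply: eq_bigr => -[x a] _ /=; rewrite big_cons mulrA.
exists (fun a : m.+1.-tuple X => (thead a, [tuple of behead a])) => -[].
  by move=> x a _; rewrite /thead tnth0; congr pair; apply: val_inj.
by move=> s i _; rewrite [RHS]tuple_eta.
Qed.

Lemma wsum1 w m H :
  wsum w m H = wsum (fun=> 1) m (fun s => (\prod_(x <- s) w x) * H s).
Proof.
rewrite !wsum_tuple; apply: eq_bigr => a _.
by rewrite [X in _ = X * _]big1_eq mul1r.
Qed.

(** Each letter carries one of the two weights; as [H] ignores the order, the letters of weight [al]
    can be brought to the front, and C(r, l) counts their possible positions. *)
Lemma wsum_binomial (al be : X -> R) r H : perm_inv H ->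
  wsum (fun x => al x + be x) r H =
  \sum_(l < r.+1) 'C(r, l)%:R *
     wsum al l (fun z => wsum be (r - l) (fun y => H (z ++ y))).
Proof.
elim: r H => [|r IH] H pH; first by rewrite big_ord1/= bin0 mul1r.
pose A l := wsum al l (fun z => wsum be (r.+1 - l) (fun y => H (z ++ y))).
(* The first letter lengthens the [al] block or, moved past it, the [be] block; Pascal's rule
   recombines the two sums. *)
transitivity (\sum_(l < r.+1) ('C(r, l)%:R * A l.+1 + 'C(r, l)%:R * A l)).
  rewrite /=.
  under eq_bigr => x _.
    rewrite IH; last by move=> s t st; apply: pH; rewrite perm_cons.
    rewrite mulrDl !mulr_sumr -big_split/=.
    over.
  rewrite exchange_big/=; apply: eq_bigr => l _.
  rewrite big_split/=; congr (_ + _).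
    by rewrite /A/= mulr_sumr; apply: eq_bigr => x _; rewrite mulrCA.
  under eq_bigr do rewrite mulrCA -wsumZ.
  rewrite -mulr_sumr -wsum_sum; congr (_ * _); rewrite /A.
  apply: eq_wsum => z _; rewrite subSn/=; last by rewrite -ltnS.
  apply: eq_bigr => x _; congr (_ * _); apply: eq_wsum => y _; apply: pH.
  by rewrite -[x :: y]cat1s -[x :: _]cat1s perm_catCA.
rewrite big_split/= [RHS]big_ord_recl/= bin0 mul1r.
rewrite [in LHS]big_ord_recr/= binn mul1r.
rewrite [X in _ + X = _]big_ord_recl/= bin0 mul1r addrCA; congr (_ + _).
rewrite [in RHS]big_ord_recr/= binn mul1r subnn.
rewrite addrAC; congr (_ + _); last by rewrite /A subnn.
rewrite -big_split/=; apply: eq_bigr => l _.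
by rewrite /A /bump/= add1n binS natrD mulrDl addrC.
Qed.

(** As [G] kills words with repetitions, [x] has exactly one position among the [q], and symmetry
    moves it to the front. *)
Lemma wsum_rem x q G H : perm_inv G -> perm_inv H ->
  (forall s, ~~ uniq s -> G s = 0) ->
  wsum (fun=> 1) q (fun b => G b * ((x \in b)%:R * H (rem x b))) =
  q%:R * wsum (fun=> 1) q.-1 (fun b => G (x :: b) * H b).
Proof.
elim: q G H => [|q IH] G H pG pH uG /=; first by rewrite mul0r mulr0 mul0r.
transitivity (wsum (fun=> 1) q (fun b => G (x :: b) * H b) +
   \sum_(y | y != x) wsum (fun=> 1) q (fun b => G (y :: b) * ((x \in b)%:R * H (y :: rem x b)))).
  rewrite (bigD1 x)//= mul1r; congr (_ + _).
    by apply: eq_wsum => b _; rewrite in_cons eqxx/= mul1r.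
  apply: eq_bigr => y yx; rewrite mul1r; apply: eq_wsum => b _.
  by rewrite in_cons [x == y]eq_sym/= (negbTE yx).
rewrite -natr1 mulrDl mul1r addrC; congr (_ + _).
under eq_bigr => y _.
  rewrite (IH (fun b => G (y :: b)) (fun b => H (y :: b))); last 3 first.
  - by move=> s t st; apply: pG; rewrite perm_cons.
  - by move=> s t st; apply: pH; rewrite perm_cons.
  - by move=> s us; apply: uG; rewrite cons_uniq (negbTE us) andbF.
  over.
case: q IH => [|q _] /=; first by rewrite mul0r big1// => y _; rewrite mul0r.
rewrite -mulr_sumr; congr (_ * _); rewrite [RHS](bigD1 x)//=.
(* The letter excluded from the sum can be restored: [G] vanishes on a word containing [x] twice. *)
rewrite [X in X + _](_ : _ = 0) ?add0r; last first.
  rewrite mul1r -(mul0r (wsum (fun=> 1) q (fun=> 1))) -wsumZ.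
  by apply: eq_wsum => s _; rewrite uG ?mul0r//= in_cons eqxx.
apply: eq_bigr => y _; rewrite mul1r; apply: eq_wsum => s _; congr (_ * _).
by apply: pG; apply/seq.permP => a /=; rewrite addnCA.
Qed.

End weighted_sums.

Lemma wsumM {R : comPzRingType} {X : finType} (w w' : X -> R) m H :
  wsum (fun x => w x * w' x) m H =
  wsum w m (fun s => (\prod_(x <- s) w' x) * H s).
Proof.
rewrite !wsum_tuple; apply: eq_bigr => a _.
by rewrite big_split/= mulrA.
Qed.

Section moments.
Context {R : comPzRingType} {X : finType}.
Variables (m v : X -> R).

(** Moments of a variable with mean [m x] and variance [v x]. Counts above two do not occur: the
    words that matter concatenate two words without repetition. *)
Definition moment (x : X) (k : nat) : R :=
  match k with 0 => 1 | 1 => m x | _ => m x ^+ 2 + v x end.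

Definition word_moment (s : seq X) : R := \prod_x moment x (count_mem x s).

Lemma perm_word_moment s t : perm_eq s t -> word_moment s = word_moment t.
Proof. by move=> /seq.permP st; apply: eq_bigr => x _; rewrite st. Qed.

(** If [x] already occurs once, its second moment m^2 + v is m times the first moment plus a pairing
    term v, in which both occurrences disappear. *)
Lemma word_moment_cons x s : (count_mem x s <= 1)%N ->
  word_moment (x :: s) =
  m x * word_moment s + (x \in s)%:R * v x * word_moment (rem x s).
Proof.
move=> c1; rewrite /word_moment !(bigD1 x (P := predT))//= eqxx/=.
have E1 : \prod_(i | i != x) moment i ((x == i) + count_mem i s) =
          \prod_(i | i != x) moment i (count_mem i s).
  by apply: eq_bigr => i ix; rewrite eq_sym (negbTE ix).
have E2 : \prod_(i | i != x) moment i (count_mem i (rem x s)) =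
          \prod_(i | i != x) moment i (count_mem i s).
  apply: eq_bigr => i ix; have xi : (x == i) = false by rewrite eq_sym (negbTE ix).
  by rewrite count_rem/= xi andbF subn0.
rewrite E1 E2 count_rem/= eqxx andbT.
move: c1; rewrite -has_pred1 has_count.
by case: (count_mem x s) => [|[|n]]//= _; ring.
Qed.

End moments.

Section discrete_product_formula.
Context {R : comPzRingType} {X : finType}.
Variables (nu phi : X -> R).
Implicit Types (F G : seq X -> R).

Let m x := nu x * phi x.
Let v x := nu x + m x.

(** Contribution of a matching of r letters: matched letters are shared and weigh [v], each other
    letter weighs [m]. *)
Let T r p q F G := wsum v r (fun y =>
  wsum m (p - r) (fun t => F (y ++ t)) * wsum m (q - r) (fun u => G (y ++ u))).

Let B p q F G := wsum (fun=> 1) p (fun a => F a *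
  wsum (fun=> 1) q (fun b => G b * word_moment m v (a ++ b))).

(** The coefficient r! C(p, r) C(q, r) counts the matchings of size r between p and q positions. The
    induction looks at the first letter of [a]: it stays alone, or it is matched with one of the q
    letters of [b]. *)
Let BE p q F G : perm_inv F -> perm_inv G ->
  (forall s, ~~ uniq s -> F s = 0) -> (forall s, ~~ uniq s -> G s = 0) ->
  B p q F G = \sum_(r < p.+1) (r`! * 'C(p, r) * 'C(q, r))%:R * T r p q F G.
Proof.
elim: p q F G => [|p IH] q F G pF pG uF uG.
  rewrite big_ord1 /B/T/= !bin0 mul1r subn0; congr (_ * _).
  rewrite [RHS]wsum1; apply: eq_wsum => s _.
  have [us|/uG->] := boolP (uniq s); last by rewrite mul0r mulr0.
  rewrite mulrC; congr (_ * _); rewrite /word_moment.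
  rewrite (big_uniq _ us)/= (bigID (mem s))/= [X in _ * X]big1 ?mulr1; last first.
    by move=> x xs; rewrite count_uniq_mem// (negbTE xs).
  by apply: eq_bigr => x xs; rewrite count_uniq_mem// xs.
have pFx x : perm_inv (fun s => F (x :: s)).
  by move=> s t st; apply: pF; rewrite perm_cons.
have pGx x : perm_inv (fun s => G (x :: s)).
  by move=> s t st; apply: pG; rewrite perm_cons.
have uFx x s : ~~ uniq s -> F (x :: s) = 0.
  by move=> us; apply: uF; rewrite cons_uniq (negbTE us) andbF.
have uGx x s : ~~ uniq s -> G (x :: s) = 0.
  by move=> us; apply: uG; rewrite cons_uniq (negbTE us) andbF.
transitivity (\sum_x (m x * B p q (fun s => F (x :: s)) G +
    v x * (q%:R * B p q.-1 (fun s => F (x :: s)) (fun s => G (x :: s))))).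
  rewrite /B/=; apply: eq_bigr => x _; rewrite mul1r -!wsumZ -wsumD.
  apply: eq_wsum => a _.
  have [uxa|/uF->] := boolP (uniq (x :: a)); last by rewrite !(mul0r, mulr0) addr0.
  have xa : x \notin a by case/andP: uxa.
  have -> : v x * (q%:R * (F (x :: a) *
      wsum (fun=> 1) q.-1 (fun b => G (x :: b) * word_moment m v (a ++ b)))) =
    F (x :: a) * (v x * (q%:R * wsum (fun=> 1) q.-1
      (fun b => G (x :: b) * word_moment m v (a ++ b)))) by ring.
  rewrite -(wsum_rem _ _ pG); last 2 first.
  - move=> s t st; apply: perm_word_moment; exact: perm_cat.
  - exact: uG.
  rewrite mulrCA -mulrDr; congr (_ * _); rewrite -!wsumZ -wsumD.
  apply: eq_wsum => b _ /=.
  have [ub|/uG->] := boolP (uniq b); last by rewrite !(mul0r, mulr0) addr0.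
  rewrite word_moment_cons; last first.
    by rewrite count_cat (count_memPn xa) add0n count_uniq_mem// leq_b1.
  rewrite mem_cat (negbTE xa)/= remE index_cat (negbTE xa).
  have -> : take (size a + index x b) (a ++ b) ++ drop (size a + index x b).+1 (a ++ b)
          = a ++ rem x b.
    rewrite remE take_cat drop_cat ltnNge leq_addr/= addKn.
    rewrite ltnNge leqW ?leq_addr//= -addnS addKn catA //.
  by ring.
rewrite big_split/=.
have T1 r : (r <= p)%N ->
    \sum_x m x * T r p q (fun s => F (x :: s)) G = T r p.+1 q F G.
  move=> rp; rewrite /T; under eq_bigr do rewrite -wsumZ.
  rewrite -wsum_sum; apply: eq_wsum => y _.
  rewrite subSn//= mulr_suml; apply: eq_bigr => x _.
  rewrite mulrA; congr (_ * _ * _); apply: eq_wsum => t _; apply: pF.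
  by rewrite -[x :: t]cat1s -[x :: _]cat1s perm_catCA.
have T2 r : \sum_x v x * T r p q.-1 (fun s => F (x :: s)) (fun s => G (x :: s))
     = T r.+1 p.+1 q F G.
  by rewrite /T/= subSS; apply: eq_bigr => x _; rewrite -subn1 -subnDA add1n.
transitivity (\sum_(r < p.+1) (r`! * 'C(p, r) * 'C(q, r))%:R * T r p.+1 q F G +
   \sum_(r < p.+1) (q * (r`! * 'C(p, r) * 'C(q.-1, r)))%:R * T r.+1 p.+1 q F G).
  congr (_ + _).
    under eq_bigr => x _.
      rewrite IH; [|exact: pFx|exact: pG|exact: uFx|exact: uG].
      rewrite mulr_sumr; over.
    rewrite exchange_big/=; apply: eq_bigr => r _.
    rewrite -T1; last (by rewrite -ltnS); rewrite mulr_sumr; apply: eq_bigr => x _; exact: mulrCA.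
  under eq_bigr => x _.
    rewrite IH; [|exact: pFx|exact: pGx|exact: uFx|exact: uGx].
    rewrite mulrA mulr_sumr; over.
  rewrite exchange_big/=; apply: eq_bigr => r _.
  rewrite -T2 mulr_sumr; apply: eq_bigr => x _; rewrite natrM; ring.
rewrite [RHS]big_ord_recl [X in X + _ = _]big_ord_recl/= !bin0.
rewrite -addrA; congr (_ + _).
(* The term added to complete the range is zero because C(p, p + 1) = 0. *)
rewrite [X in X + _](_ : _ = \sum_(i < p.+1) ((bump 0 i)`! * 'C(p, bump 0 i) * 'C(q, bump 0 i))%:R *
                           T (bump 0 i) p.+1 q F G); last first.
  rewrite [RHS]big_ord_recr/= [X in _ = _ + X * _](_ : _ = 0) ?mul0r ?addr0//.
  by rewrite bin_small ?muln0 ?mul0n// /bump/= add1n.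
rewrite -big_split/=; apply: eq_bigr => r _.
rewrite /bump/= add1n -mulrDl -natrD; congr (_%:R * _).
(* What remains is C(p + 1, r + 1) = C(p, r + 1) + C(p, r) together with q C(q - 1, r) = (r + 1)
   C(q, r + 1). *)
rewrite binS.
have := mul_bin_diag q r.
case: q {IH T1 T2 pG} => [|q] E /=; first by rewrite !bin0n !muln0.
rewrite factS.
have -> : (q.+1 * (r`! * 'C(p, r) * 'C(q, r)) =
  r`! * 'C(p, r) * (q.+1 * 'C(q, r)))%N by ring.
by rewrite E; ring.
Qed.

Lemma perm_inv_wsum (w : X -> R) k F : perm_inv F ->
  perm_inv (fun y => wsum w k (fun t => F (y ++ t))).
Proof.
move=> pF s t st; apply: eq_wsum => u _; apply: pF.
by rewrite perm_cat2r.
Qed.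

(** A matched letter weighs nu + nu phi, which [wsum_binomial] splits: the [l] letters of weight nu
    are the variables integrated out by the contraction, the [r - l] letters of weight nu phi are
    the shared variables it keeps. *)
Lemma discrete_product_formula p q F G : perm_inv F -> perm_inv G ->
  (forall s, ~~ uniq s -> F s = 0) -> (forall s, ~~ uniq s -> G s = 0) ->
  wsum (fun=> 1) p (fun a => F a * wsum (fun=> 1) q (fun b => G b *
    word_moment (fun x => nu x * phi x) (fun x => nu x + nu x * phi x) (a ++ b))) =
  \sum_(r < (minn p q).+1) r`!%:R * 'C(p, r)%:R * 'C(q, r)%:R *
    \sum_(l < r.+1) 'C(r, l)%:R * wsum nu (p + q - r) (fun c =>
       F (take p c) * G (take r c ++ drop p c) * \prod_(x <- drop l c) phi x).
Proof.
move=> pF pG uF uG; rewrite -[LHS]/(B p q F G) BE//.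
transitivity (\sum_(r < (minn p q).+1) (r`! * 'C(p, r) * 'C(q, r))%:R * T r p q F G).
  rewrite -!(big_mkord xpredT (fun r => (r`! * 'C(p, r) * 'C(q, r))%:R * T r p q F G)).
  rewrite (@big_cat_nat _ _ _ (minn p q).+1)//=; last by rewrite ltnS geq_minl.
  rewrite [X in _ + X]big_nat_cond [X in _ + X]big1 ?addr0// => r.
  rewrite andbT => /andP[]; rewrite gtn_min => /orP[|] h _.
    by rewrite (bin_small h) muln0 mul0r.
  by rewrite (bin_small h) muln0 mul0r.
apply: eq_bigr => r _; rewrite !natrM; congr (_ * _).
have /[!ltnS] := ltn_ord r; rewrite leq_min => /andP[rp rq].
rewrite /T wsum_binomial; last first.
  by move=> s t st; congr (_ * _); apply: perm_inv_wsum.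
apply: eq_bigr => l _; congr (_ * _).
have lr : (l <= r)%N by rewrite -ltnS.
(* Blocks of the word: [l] integrated letters, [r - l] shared ones, [p - r] seen by [F] only,
   [q - r] seen by [G] only. *)
rewrite (_ : (p + q - r = l + ((r - l) + ((p - r) + (q - r))))%N); last lia.
rewrite wsum_cat; apply: eq_wsum => z zl; rewrite wsum_cat wsumM.
apply: eq_wsum => y yl; rewrite wsum_cat mulrCA -wsumZr wsumM.
apply: eq_wsum => t tl; rewrite mulrA -wsumZ wsumM -wsumZ.
apply: eq_wsum => u ul.
have -> : take p (z ++ y ++ t ++ u) = (z ++ y) ++ t.
  by rewrite 2!catA take_size_cat// !size_cat zl yl tl; lia.
have -> : take r (z ++ y ++ t ++ u) = z ++ y.
  by rewrite catA take_size_cat// !size_cat zl yl; lia.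
have -> : drop p (z ++ y ++ t ++ u) = u.
  by rewrite 2!catA drop_size_cat// !size_cat zl yl tl; lia.
rewrite drop_size_cat// !big_cat/=; ring.
Qed.

End discrete_product_formula.

(** * Product measures *)

Section rectangles.
Context (d : measure_display) (T : measurableType d).

Definition rect (m : nat) (B : 'I_m -> set T) : set (m.-tuple T) :=
  [set x | forall i, B i (tnth x i)].

Lemma measurable_rect m (B : 'I_m -> set T) :
  (forall i, measurable (B i)) -> measurable (rect B).
Proof.
move=> mB; rewrite (_ : rect B =
    \bigcap_(i in [set: 'I_m]) ((@tnth m T ^~ i) @^-1` B i)); last first.
  by apply/seteqP; split => x h i; [move=> _; exact: h|exact: (h i I)].
apply: fin_bigcap_measurable => //.
by move=> i _; rewrite -[X in measurable X]setTI; exact: measurable_tnth.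
Qed.

Definition rects (m : nat) : set (set (m.-tuple T)) :=
  [set A | exists2 B : 'I_m -> set T, forall i, measurable (B i) & A = rect B].

Lemma setI_closed_rects m : setI_closed (@rects m).
Proof.
move=> _ _ [B mB ->] [C mC ->]; exists (fun i => B i `&` C i).
  by move=> i; exact: measurableI.
apply/seteqP; split => x; first by move=> [hB hC] i; split.
by move=> h; split => i; have [] := h i.
Qed.

Lemma measurable_rects m : measurable = <<s @rects m >>.
Proof.
apply/seteqP; split.
  apply: smallest_sub; first exact: smallest_sigma_algebra.
  rewrite -bigcup_seq => A /= [i _ [Y mY <-]]; apply: sub_sigma_algebra.
  exists (fun j => if j == i then Y else setT).
    by move=> j; case: ifP.
  apply/seteqP; split => x /=.
    by move=> [_ Yx] j /=; case: eqP => [->|].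
  by move=> /(_ i); rewrite eqxx.
apply: smallest_sub; first exact: sigma_algebra_measurable.
by move=> _ [B mB ->]; exact: measurable_rect.
Qed.

Lemma measurable_permute m (w : 'S_m) :
  measurable_fun [set: m.-tuple T] (permute w).
Proof.
apply/measurable_fun_tnthP => i; rewrite (_ : _ \o _ = (@tnth m T ^~ (w i))).
  exact: measurable_tnth.
by apply/funext => x /=; rewrite tnth_mktuple.
Qed.

HB.instance Definition _ m (w : 'S_m) :=
  isMeasurableFun.Build _ _ _ _ (permute w) (measurable_permute w).

Definition tcat (a b : nat) (x : a.-tuple T * b.-tuple T) : (a + b).-tuple T :=
  cat_tuple x.1 x.2.

Lemma measurable_tcat a b : measurable_fun setT (@tcat a b).
Proof.
apply/measurable_fun_tnthP => i; case: (splitP i) => j ij.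
  rewrite (_ : _ \o _ = (@tnth a T ^~ j) \o fst).
    by apply: measurableT_comp => //; exact: measurable_tnth.
  apply/funext => x /=; rewrite (_ : i = lshift b j) ?tnth_lshift//.
  exact/val_inj.
rewrite (_ : _ \o _ = (@tnth b T ^~ j) \o snd).
  by apply: measurableT_comp => //; exact: measurable_tnth.
apply/funext => x /=; rewrite (_ : i = rshift a j) ?tnth_rshift//.
exact/val_inj.
Qed.

HB.instance Definition _ a b :=
  isMeasurableFun.Build _ _ _ _ (@tcat a b) (@measurable_tcat a b).

End rectangles.

Section power_measure_theory.
Context (d : measure_display) (T : measurableType d) (R : realType).
Variable nu : {sigma_finite_measure set T -> \bar R}.
Local Notation pm := (power_measure nu).
Local Open Scope ereal_scope.

Lemma power_measure_rect m (B : 'I_m -> set T) : (forall i, measurable (B i)) ->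
  pm m (rect B) = \prod_(i < m) nu (B i).
Proof.
elim: m B => [|m IH] B mB.
  rewrite big_ord0 /= diracE mem_set// => -[]//.
rewrite big_ord_recl/= /power_step /pushforward.
rewrite -(IH (fun i => B (lift ord0 i)))//.
rewrite -product_measure1E//; last exact: measurable_rect.
congr (_ _); apply/seteqP; split => -[x y] /=.
  move=> h; split; first by have := h ord0; rewrite /= (tnth_nth x).
  by move=> i; have := h (lift ord0 i); rewrite tnthS.
move=> [h1 h2] i; case: (unliftP ord0 i) => [j|] ->.
  by rewrite tnthS; exact: h2.
by rewrite (tnth_nth x).
Qed.

(** Sigma-finiteness in the form that [measure_unique] takes: the exhausting sets belong to the
    generating class of rectangles. *)
Lemma rects_exhaustion m : exists g : nat -> set (m.-tuple T),
  [/\ forall k, rects (g k), \bigcup_k g k = setT & forall k, pm m (g k) < +oo].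
Proof.
have /sigma_finiteP[F [FT ndF Foo]] := sigma_finiteT nu.
exists (fun k => rect (fun _ : 'I_m => F k)); split.
- by move=> k; exists (fun=> F k) => // i; case: (Foo k).
- apply/seteqP; split => // x _.
  have /choice[k hk] : forall i, exists k, F k (tnth x i).
    by move=> i; have : setT (tnth x i) by []; rewrite FT => -[k _ ?]; exists k.
  exists (\max_(i < m) k i)%N => // i.
  by have := hk i; apply/subsetPset/ndF; exact: leq_bigmax.
- move=> k; rewrite power_measure_rect; last by move=> i; case: (Foo k).
  rewrite -ge0_fin_numE ?prode_ge0// prode_fin_num// => i _.
  by rewrite ge0_fin_numE//; case: (Foo k).
Qed.

(** On rectangles a permutation only reorders a finite product; uniqueness of measures does the
    rest. *)
Lemma power_measure_permute m (w : 'S_m) A : measurable A ->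
  pm m (permute w @^-1` A) = pm m A.
Proof.
move=> mA; have [g [gr gT goo]] := rects_exhaustion m.
apply/esym.
apply: (@measure_unique _ _ _ (@rects _ T m) g _ _ gr gT (pm m)
  (pushforward (pm m) (permute w))) => //.
- exact: measurable_rects.
- exact: setI_closed_rects.
move=> _ [B mB ->]; rewrite /= /pushforward.
rewrite (_ : _ @^-1` _ = rect (fun i => B ((w^-1)%g i))).
  rewrite !power_measure_rect//.
  by rewrite [RHS](reindex_inj (@perm_inj _ w))/=; apply: eq_bigr => i _; rewrite permK.
apply/seteqP; split => x /= h i.
  by have := h ((w^-1)%g i); rewrite tnth_mktuple permKV.
by rewrite tnth_mktuple; have := h (w i); rewrite permK.
Qed.

Lemma ge0_integral_permute m (w : 'S_m) (f : m.-tuple T -> \bar R) :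
  measurable_fun [set: m.-tuple T] f -> (forall x, 0 <= f x) ->
  \int[pm m]_x f (permute w x) = \int[pm m]_x f x.
Proof.
move=> mf f0.
have := @ge0_integral_pushforward _ _ _ _ R _ (measurable_permute w) (pm m)
  setT f measurableT mf (fun x _ => f0 x).
rewrite preimage_setT => <-; apply: eq_measure_integral => A mA _.
exact: power_measure_permute.
Qed.

Lemma integral_permute m (w : 'S_m) (f : m.-tuple T -> \bar R) :
  measurable_fun [set: m.-tuple T] f ->
  \int[pm m]_x f (permute w x) = \int[pm m]_x f x.
Proof.
move=> mf; transitivity (\int[pm m]_x (f \o permute w) x) => //.
rewrite [LHS]integralE [RHS]integralE funepos_comp funeneg_comp.
congr (_ - _).
  exact: (ge0_integral_permute w (measurable_funepos mf) (fun=> funepos_ge0 _ _)).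
exact: (ge0_integral_permute w (measurable_funeneg mf) (fun=> funeneg_ge0 _ _)).
Qed.

Lemma power_measure_cat a b A : measurable A ->
  (pm a \x pm b) (@tcat _ T a b @^-1` A) = pm (a + b) A.
Proof.
move=> mA; have [g [gr gT goo]] := rects_exhaustion (a + b).
apply/esym.
apply: (@measure_unique _ _ _ (@rects _ T (a + b)) g _ _ gr gT (pm (a + b))
  (pushforward (pm a \x pm b) (@tcat _ T a b))) => //.
- exact: measurable_rects.
- exact: setI_closed_rects.
move=> _ [B mB ->]; rewrite /= /pushforward.
rewrite (_ : _ @^-1` _ = rect (fun i => B (lshift b i)) `*` rect (fun i => B (rshift a i))).
  rewrite product_measure1E; [|exact: measurable_rect|exact: measurable_rect].
  by rewrite power_measure_rect// big_split_ord/= -!power_measure_rect.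
apply/seteqP; split => -[x y] /=.
  move=> h; split=> i; [have := h (lshift b i)|have := h (rshift a i)].
    by rewrite tnth_lshift.
  by rewrite tnth_rshift.
move=> [h1 h2] i; case: (splitP i) => j ij.
  by rewrite (_ : i = lshift b j) ?tnth_lshift//; exact/val_inj.
by rewrite (_ : i = rshift a j) ?tnth_rshift//; exact/val_inj.
Qed.

Lemma ge0_integral_tcat a b (f : (a + b).-tuple T -> \bar R) :
  measurable_fun [set: (a + b).-tuple T] f -> (forall x, 0 <= f x) ->
  \int[pm (a + b)]_x f x = \int[pm a \x pm b]_z f (tcat z).
Proof.
move=> mf f0.
have := @ge0_integral_pushforward _ _ _ _ R _ (@measurable_tcat _ T a b) (pm a \x pm b)
  setT f measurableT mf (fun x _ => f0 x).
rewrite preimage_setT => <-; apply: eq_measure_integral => A mA _.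
exact/esym/power_measure_cat.
Qed.

Lemma integral_tcat a b (f : (a + b).-tuple T -> \bar R) :
  measurable_fun [set: (a + b).-tuple T] f ->
  \int[pm (a + b)]_x f x = \int[pm a \x pm b]_z f (tcat z).
Proof.
move=> mf; transitivity (\int[pm a \x pm b]_z (f \o (@tcat _ T a b)) z) => //.
rewrite [LHS]integralE [RHS]integralE.
rewrite [in RHS]funepos_comp [in RHS]funeneg_comp; congr (_ - _).
  exact: (ge0_integral_tcat (measurable_funepos mf) (fun=> funepos_ge0 _ _)).
exact: (ge0_integral_tcat (measurable_funeneg mf) (fun=> funeneg_ge0 _ _)).
Qed.

End power_measure_theory.

(** * Square-integrable functions *)

Section square_integrable.
Context d (T : measurableType d) (R : realType) (mu : {measure set T -> \bar R}).
Implicit Types f g h : T -> R.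

Definition L2 f := f \in Lfun mu 2%:E.
Definition norm2 f : R := fine ('N[mu]_2%:E[EFin \o f])%E.
Definition sqint f : \bar R := (\int[mu]_x (f x ^+ 2)%:E)%E.

Lemma Lnorm2E f : ('N[mu]_2%:E[EFin \o f] `^ 2 = sqint f)%E.
Proof.
rewrite poweR_Lnorm//; apply: eq_integral => x _ /=.
by rewrite powR_mulrn// real_normK ?num_real.
Qed.

Lemma L2_measurable f : L2 f -> measurable_fun setT f.
Proof. by rewrite /L2 inE => /andP[]; rewrite inE. Qed.

Lemma L2_fin f : L2 f -> ('N[mu]_2%:E[EFin \o f])%E = (norm2 f)%:E.
Proof.
rewrite /L2 inE => /andP[_]; rewrite inE /finite_norm /= => h.
by rewrite fineK// ge0_fin_numE// Lnorm_ge0.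
Qed.

Lemma L2_sqint f : L2 f -> sqint f = (norm2 f ^+ 2)%:E.
Proof.
move=> fL; rewrite -Lnorm2E (L2_fin fL) poweR_EFin powR_mulrn//.
by rewrite -lee_fin -(L2_fin fL) Lnorm_ge0.
Qed.

Lemma L2P f : L2 f <-> measurable_fun setT f /\ (sqint f < +oo)%E.
Proof.
split=> [fL|[mf foo]].
  by split; [exact: L2_measurable|rewrite L2_sqint// ltry].
rewrite /L2 inE; apply/andP; split; rewrite inE//= /finite_norm.
by rewrite (@lty_poweRy _ _ 2)// Lnorm2E.
Qed.

Lemma norm2_ge0 f : 0 <= norm2 f.
Proof. by rewrite fine_ge0// Lnorm_ge0. Qed.

Lemma norm2_lt f e : 0 < e -> L2 f -> (sqint f < (e ^+ 2)%:E)%E -> norm2 f < e.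
Proof.
move=> e0 fL; rewrite L2_sqint// lte_fin ltr_pXn2r// nnegrE ?norm2_ge0//.
exact: ltW.
Qed.

Lemma norm2_le f M : 0 <= M -> L2 f -> (sqint f <= (M ^+ 2)%:E)%E -> norm2 f <= M.
Proof.
by move=> M0 fL; rewrite L2_sqint// lee_fin ler_pXn2r// nnegrE norm2_ge0.
Qed.

Lemma L2D f g : L2 f -> L2 g -> L2 (fun x => f x + g x).
Proof.
move=> fL gL; have p1 : (1 <= 2%:E :> \bar R)%E by rewrite lee1n.
have [_ h] := Lfun_addr_closed mu p1; exact: h.
Qed.

Lemma L2Z a f : L2 f -> L2 (fun x => a * f x).
Proof.
move=> fL; have := @Lfun_scale _ _ _ mu f a 2 _ fL.
rewrite (_ : a \o* f = (fun x => a * f x)); last first.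
  by apply/funext => x /=; rewrite mulrC.
by apply; rewrite ler1n.
Qed.

Lemma L2B f g : L2 f -> L2 g -> L2 (fun x => f x - g x).
Proof.
move=> fL gL; rewrite (_ : (fun _ => _) = (fun x => f x + (-1) * g x)).
  by apply: L2D => //; exact: L2Z.
by apply/funext => x; rewrite mulN1r.
Qed.

Lemma L2_0 : L2 (fun=> 0).
Proof.
apply/L2P; split; first exact: measurable_cst.
by rewrite /sqint; under eq_integral do rewrite expr0n/=; rewrite integral0 ltry.
Qed.

Lemma L2_sum (I : Type) (s : seq I) (F : I -> T -> R) : (forall i, L2 (F i)) ->
  L2 (fun x => \sum_(i <- s) F i x).
Proof.
move=> FL; elim: s => [|i s IH].
  by under eq_fun do rewrite big_nil; exact: L2_0.
by under eq_fun do rewrite big_cons; exact: L2D.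
Qed.

Lemma norm2D f g : L2 f -> L2 g -> norm2 (fun x => f x + g x) <= norm2 f + norm2 g.
Proof.
move=> fL gL; rewrite -lee_fin EFinD -!L2_fin//; last exact: L2D.
apply: (@minkowski_EFin _ _ _ mu f g 2) => //; try exact: L2_measurable.
by rewrite ler1n.
Qed.

Lemma norm2Z a f : L2 f -> norm2 (fun x => a * f x) = `|a| * norm2 f.
Proof.
move=> fL; apply/eqP; rewrite -(@eqrXn2 _ 2)// ?norm2_ge0 ?mulr_ge0 ?norm2_ge0//.
rewrite -eqe -L2_sqint; last exact: L2Z.
rewrite exprMn EFinM -L2_sqint// real_normK ?num_real//.
rewrite /sqint; under eq_integral do rewrite exprMn EFinM.
rewrite ge0_integralZl_EFin ?sqr_ge0//; first by move=> x _; rewrite lee_fin sqr_ge0.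
by apply/measurable_EFinP/measurable_funX; exact: L2_measurable.
Qed.

Lemma norm2BC f g : norm2 (fun x => f x - g x) = norm2 (fun x => g x - f x).
Proof.
rewrite /norm2 -oppe_Lnorm; congr (fine _); apply: eq_Lnorm => x /=.
by rewrite opprB.
Qed.

Lemma norm2_triangle f g h : L2 f -> L2 g -> L2 h ->
  norm2 (fun x => f x - h x) <= norm2 (fun x => f x - g x) + norm2 (fun x => g x - h x).
Proof.
move=> fL gL hL; rewrite (_ : (fun x => f x - h x) = (fun x => (f x - g x) + (g x - h x))).
  by apply: norm2D; exact: L2B.
by apply/funext => x; rewrite subrKA.
Qed.

Lemma ae_eq_norm2 f g : measurable_fun setT g -> f = g %[ae mu] -> L2 f ->
  L2 g /\ norm2 g = norm2 f.
Proof.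
move=> mg fg fL; have mf := L2_measurable fL.
have E : sqint g = sqint f.
  apply: ge0_ae_eq_integral => //.
  - by apply/measurable_EFinP/measurable_funX.
  - by apply/measurable_EFinP/measurable_funX.
  - by move=> x _; rewrite lee_fin sqr_ge0.
  - by move=> x _; rewrite lee_fin sqr_ge0.
  by apply: filterS fg => x /= /[apply] ->.
have gL : L2 g by apply/L2P; rewrite E; split=> //; exact: ((L2P f).1 fL).2.
split=> //; apply/eqP; rewrite -(@eqrXn2 _ 2)// ?norm2_ge0//.
by rewrite -eqe -!L2_sqint// E.
Qed.

Lemma L2_mul_integrable f g : L2 f -> L2 g ->
  mu.-integrable setT (fun x => (f x * g x)%:E).
Proof. by move=> fL gL; apply/Lfun1_integrable; exact: Lfun2_mul_Lfun1. Qed.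

Lemma L2_mul_le f g : L2 f -> L2 g ->
  (\int[mu]_x `|f x * g x|%:E <= (norm2 f * norm2 g)%:E)%E.
Proof.
move=> fL gL; rewrite EFinM -!L2_fin//.
have := @hoelder _ _ _ mu f g 2 2; rewrite Lnorm1; apply => //.
- exact: L2_measurable.
- exact: L2_measurable.
- by rewrite [RHS]splitr !div1r.
Qed.

Lemma Rintegral_mul_le f g : L2 f -> L2 g ->
  `|\int[mu]_x (f x * g x)| <= norm2 f * norm2 g.
Proof.
move=> fL gL; apply: le_trans (le_normr_Rintegral _ (L2_mul_integrable fL gL)) _ => //.
rewrite -lee_fin; apply: le_trans (L2_mul_le fL gL).
rewrite /Rintegral fineK//; apply: integrable_fin_num => //.
exact/integrable_norm/L2_mul_integrable.
Qed.

(** Cauchy-Schwarz on each term of uv - fg = (u - f)(v - g) + (u - f) g + f (v - g). *)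
Lemma cvg_Rintegral_mul (u v : nat -> T -> R) f g :
  (forall n, L2 (u n)) -> (forall n, L2 (v n)) -> L2 f -> L2 g ->
  norm2 (fun x => u n x - f x) @[n --> \oo] --> 0 ->
  norm2 (fun x => v n x - g x) @[n --> \oo] --> 0 ->
  (\int[mu]_x (u n x * v n x)) @[n --> \oo] --> \int[mu]_x (f x * g x).
Proof.
move=> uL vL fL gL uf vg.
pose a n := norm2 (fun x => u n x - f x); pose b n := norm2 (fun x => v n x - g x).
have key n : `|\int[mu]_x (u n x * v n x) - \int[mu]_x (f x * g x)| <=
    a n * b n + a n * norm2 g + norm2 f * b n.
  have I1 := L2_mul_integrable (uL n) (vL n); have I2 := L2_mul_integrable fL gL.
  have ufL := L2B (uL n) fL; have vgL := L2B (vL n) gL.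
  have J1 := L2_mul_integrable ufL vgL; have J2 := L2_mul_integrable ufL gL.
  have J3 := L2_mul_integrable fL vgL.
  rewrite -RintegralB// (_ : (fun x => _) = (fun x =>
     (u n x - f x) * (v n x - g x) + (u n x - f x) * g x + f x * (v n x - g x))).
    rewrite RintegralD//; last by rewrite /comp; under eq_fun do rewrite EFinD; exact: integrableD.
    rewrite RintegralD//.
    apply: le_trans (ler_normD _ _) _; apply: lerD; last exact: Rintegral_mul_le.
    by apply: le_trans (ler_normD _ _) _; apply: lerD; exact: Rintegral_mul_le.
  by apply/funext => x; ring.
apply/cvgrPdist_le => e e0.
have : a n * b n + a n * norm2 g + norm2 f * b n @[n --> \oo] -->
    0 * 0 + 0 * norm2 g + norm2 f * 0.
  by apply: cvgD; [apply: cvgD; apply: cvgM => //; exact: cvg_cst|apply: cvgM => //; exact: cvg_cst].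
rewrite !(mul0r, mulr0) !addr0 => /cvgr0_norm_le/(_ e e0); apply: filterS => n le_e.
by rewrite distrC (le_trans (key n))// (le_trans (ler_norm _)).
Qed.

Lemma dominated_norm2 (u : nat -> T -> R) f g :
  (forall n, measurable_fun setT (u n)) -> measurable_fun setT f -> L2 g ->
  {ae mu, forall x, u n x @[n --> \oo] --> f x} ->
  (forall n x, `|u n x| <= g x) ->
  [/\ L2 f, forall n, L2 (u n) & norm2 (fun x => u n x - f x) @[n --> \oo] --> 0].
Proof.
move=> mu_ mf gL uf ug.
have mg := L2_measurable gL.
have Lg h : measurable_fun setT h -> {ae mu, forall x, `|h x| <= g x} -> L2 h.
  move=> mh hg; apply/L2P; split => //; case: (L2P g).1 => // _; apply: le_lt_trans.
  apply: ae_ge0_le_integral => //.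
  - by move=> x _; rewrite lee_fin sqr_ge0.
  - by apply/measurable_EFinP/measurable_funX.
  - by move=> x _; rewrite lee_fin sqr_ge0.
  - by apply/measurable_EFinP/measurable_funX.
  apply: filterS hg => x hg _; rewrite lee_fin -[leLHS]real_normK ?num_real//.
  by rewrite ler_pXn2r// nnegrE// (le_trans _ hg).
have fg : {ae mu, forall x, `|f x| <= g x}.
  apply: filterS uf => x ufx; apply: (cvgr_to_le (cvg_norm ufx)).
  by apply: nearW => n; exact: ug.
have fL : L2 f by exact: Lg.
have uL n : L2 (u n) by apply: Lg => //; apply: aeW.
split=> //.
pose F n x := ((u n x - f x) ^+ 2)%:E.
have mF n : measurable_fun setT (F n).
  by apply/measurable_EFinP/measurable_funX/measurable_funB.
(* The limit inherits the bound [g], so that |u_n - f|^2 is dominated by (2 g)^2. *)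
have [] := @dominated_convergence _ _ _ mu setT measurableT F (cst 0%E)
    (fun x => (4%:R * g x ^+ 2)%:E) mF.
- exact: measurable_cst.
- apply: filterS uf => x ufx _; apply/cvg_EFin; first exact: nearW.
  rewrite (_ : fine \o _ = (fun n => (u n x - f x) ^+ 2))//=.
  rewrite -[X in _ --> X](expr0n R 2) -(subrr (f x)).
  apply: (@cvg_comp _ _ _ (fun n => u n x - f x) (fun y => y ^+ 2)); last exact: exprn_continuous.
  by apply: cvgB => //; exact: cvg_cst.
- rewrite (_ : (fun x => _) = (fun x => 4%:R%:E * (g x ^+ 2)%:E)%E).
    by apply: integrableZl => //; exact: Lfun2_integrable_sqr.
  by apply/funext => x; rewrite EFinM.
- apply: filterS fg => x fgx n _; rewrite /F gee0_abs ?lee_fin ?sqr_ge0//.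
  rewrite -[leLHS]real_normK ?num_real// (_ : 4%:R * _ = (g x + g x) ^+ 2); last by ring.
  have g0 : 0 <= g x := le_trans (normr_ge0 _) fgx.
  rewrite ler_pXn2r ?nnegrE ?addr_ge0//.
  by apply: le_trans (ler_normB _ _) _; exact: lerD.
move=> _ _; rewrite /= integral0 => /fine_cvg.
rewrite (_ : fine \o _ = (fun n => norm2 (fun x => u n x - f x) ^+ 2)); last first.
  by apply/funext => n /=; rewrite -/(sqint _) L2_sqint//; exact: L2B.
move=> h; apply/cvgrPdist_le => e e0.
move/cvgr0_norm_le : h => /(_ (e ^+ 2)); rewrite exprn_gt0// => /(_ isT).
apply: filterS => n; rewrite sub0r normrN ger0_norm ?sqr_ge0//.
by rewrite ger0_norm ?norm2_ge0// ler_pXn2r// nnegrE ?norm2_ge0// ltW.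
Qed.

End square_integrable.

(** * Compensated Poisson variables *)

Section Rintegral_extra.
Context d (T : measurableType d) (R : realType) (mu : {measure set T -> \bar R}).

Lemma Rintegral_sum (I : Type) (s : seq I) (F : I -> T -> R) :
  (forall i, mu.-integrable setT (EFin \o F i)) ->
  mu.-integrable setT (EFin \o (fun x => \sum_(i <- s) F i x)) /\
  \int[mu]_x (\sum_(i <- s) F i x) = \sum_(i <- s) \int[mu]_x F i x.
Proof.
move=> iF; elim: s => [|i s [IH1 IH2]].
  rewrite (_ : (fun x => _) = cst 0).
    by split; [exact: integrable0|rewrite big_nil /Rintegral integral0].
  by apply/funext => x; rewrite big_nil.
rewrite (_ : (fun x => _) = (fun x => F i x + \sum_(i <- s) F i x)); last first.
  by apply/funext => x; rewrite big_cons.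
split; first exact: (integrableD measurableT (iF i) IH1).
by rewrite RintegralD// IH2 big_cons.
Qed.

End Rintegral_extra.

Section poisson_law.
Context {R : realType}.

Definition pois (lam : R) (k : nat) : R := lam ^+ k / k`!%:R * expR (- lam).

Lemma poisson_prob1 (lam : R) k : 0 <= lam ->
  poisson_prob lam 0 [set k] = (pois lam k)%:E.
Proof.
rewrite le_eqVlt => /predU1P[<-|lam0].
  rewrite /poisson_prob ltxx diracE /pois oppr0 expR0 mulr1.
  case: k => [|k]; first by rewrite mem_set//= expr0 divr1.
  by rewrite memNset//= expr0n mul0r.
by rewrite /poisson_prob lam0 esum_set1 ?lee_fin ?poisson_pmf_ge0// /poisson_pmf lam0.
Qed.

(** Telescoping: k pois(k) = lam pois(k - 1). *)
Lemma sum_centered_pois (lam : R) n :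
  \sum_(k < n.+1) (k%:R - lam) * pois lam k = - lam * pois lam n.
Proof.
elim: n => [|n IH]; first by rewrite big_ord1 sub0r.
rewrite big_ord_recr/= IH /pois exprS factS natrM.
have : n.+1%:R != 0 :> R by rewrite pnatr_eq0.
have : (n`!)%:R != 0 :> R by rewrite pnatr_eq0 -lt0n fact_gt0.
move=> h1 h2; field.
by rewrite h1 addrC natr1 h2.
Qed.

Lemma pois_cvg0 (lam : R) : pois lam n @[n --> \oo] --> 0.
Proof.
rewrite -[X in _ --> X](mul0r (expR (- lam))); apply: cvgM; last exact: cvg_cst.
exact: cvg_exp_coeff.
Qed.

(** The left side is the probability of at least two points, 1 - (1 + lam) exp(- lam), and exp(-
    lam) >= 1 - lam. *)
Lemma pois_ge2 (lam : R) : 0 <= lam -> 1 - pois lam 0 - pois lam 1 <= lam ^+ 2.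
Proof.
move=> lam0; rewrite /pois expr0 expr1 !divr1 mul1r.
have := expR_ge1Dx (- lam); have := expR_gt0 (- lam); nra.
Qed.

End poisson_law.

Section poisson_variables.
Context (d : measure_display) (T : measurableType d) (R : realType).
Context (d' : measure_display) (Omega : measurableType d').
Variable nu : {sigma_finite_measure set T -> \bar R}.
Variable P : probability Omega R.
Variable N : set T -> {RV P >-> R}.
Hypothesis HN : compensated_poisson nu N.

Let n_ (B : set T) : R := fine (nu B).

Lemma fine_nuE B : finite_sets nu B -> nu B = (n_ B)%:E.
Proof. by move=> [mB Boo]; rewrite fineK// ge0_fin_numE. Qed.

Lemma n_ge0 B : 0 <= n_ B.
Proof. exact: fine_ge0. Qed.

(** The event that exactly [k] points fall in [B], since [N B] is their number minus its mean. *)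
Definition level_set B (k : nat) : set Omega := N B @^-1` [set k%:R - n_ B].

Lemma measurable_level_set B k : measurable (level_set B k).
Proof. by rewrite -[X in measurable X]setTI; exact: (measurable_funPT (N B)). Qed.

Lemma level_setE B k : finite_sets nu B -> P (level_set B k) = (pois (n_ B) k)%:E.
Proof.
move=> fB; case: HN => /(_ B fB _ (measurable_set1 (k%:R - n_ B))) + _ _.
rewrite /distribution /pushforward => ->.
rewrite (_ : [set _ | _] = [set k]); first by rewrite poisson_prob1// n_ge0.
by apply/seteqP; split => j /= [h]; [apply/eqP; rewrite -(eqr_nat R); apply/eqP; move: h => /addIr|rewrite h].
Qed.

Lemma trivIset_level_set B : trivIset setT (level_set B).
Proof.
apply/trivIsetP => i j _ _ ij; apply/seteqP; split=> // x []; rewrite /level_set/= => -> /addIr /eqP.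
by rewrite eqr_nat (negbTE ij).
Qed.

Lemma bigcup_level_set B : finite_sets nu B -> P (~` \bigcup_k level_set B k) = 0%E.
Proof.
move=> fB; pose A := [set x : R | exists k : nat, x = k%:R - n_ B].
have mA : measurable A.
  rewrite (_ : A = \bigcup_k [set k%:R - n_ B]).
    by apply: bigcupT_measurable => k; exact: measurable_set1.
  by apply/seteqP; split => x; [case=> k ->; exists k|case=> k _ ->; exists k].
rewrite (_ : ~` _ = N B @^-1` (~` A)); last first.
  by apply/seteqP; split => x /= h [k]; [move=> hk; apply: h; exists k|move=> _ hk; apply: h; exists k].
case: HN => /(_ B fB _ (measurableC mA)) + _ _.
rewrite /distribution /pushforward => ->.
rewrite (_ : [set _ | _] = set0) ?measure0//.
by apply/seteqP; split=> // k /=; apply; exists k.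
Qed.

Lemma integral_level_sets B f : finite_sets nu B -> P.-integrable setT f ->
  (\int[P]_x f x = \sum_(0 <= k <oo) \int[P]_(x in level_set B k) f x)%E.
Proof.
move=> fB fi; have mV := measurable_level_set B.
have mU : measurable (\bigcup_k level_set B k) by exact: bigcupT_measurable.
rewrite -integral_bigcup//; last 2 first.
- exact: trivIset_level_set.
- by apply: integrableS fi.
rewrite (negligible_integral (D := setT) (measurableC mU))//; last exact: bigcup_level_set.
by rewrite setTD setCK.
Qed.

Lemma ge0_integral_level_sets B f : finite_sets nu B -> measurable_fun setT f ->
  (forall x, 0 <= f x)%E ->
  (\int[P]_x f x = \sum_(0 <= k <oo) \int[P]_(x in level_set B k) f x)%E.
Proof.
move=> fB mf f0; have mV := measurable_level_set B.
have mU : measurable (\bigcup_k level_set B k) by exact: bigcupT_measurable.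
rewrite -ge0_integral_bigcup//; last 2 first.
- exact: measurable_funTS.
- exact: trivIset_level_set.
rewrite (ge0_negligible_integral (D := setT) (measurableC mU))//; last exact: bigcup_level_set.
by rewrite setTD setCK.
Qed.

Lemma integral_cst_level B k (r : R) : finite_sets nu B ->
  (\int[P]_(x in level_set B k) (cst r%:E x) = (r * pois (n_ B) k)%:E)%E.
Proof.
move=> fB; rewrite integral_cst; last exact: measurable_level_set.
by rewrite EFinM -level_setE.
Qed.

Lemma N_L2 B : finite_sets nu B -> L2 P (N B).
Proof.
move=> fB; apply/L2P; split; first exact: measurable_funPT.
case: HN => _ _ /(_ B B fB fB); rewrite unlock setIid fine_nuE// => h.
by rewrite /sqint (_ : (fun x => _) = (fun x => (N B x * N B x)%:E)) ?h ?ltry.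
Qed.

Lemma N_mul B C : finite_sets nu B -> finite_sets nu C ->
  \int[P]_o (N B o * N C o) = fine (nu (B `&` C)).
Proof. by move=> fB fC; case: HN => _ _ /(_ B C fB fC); rewrite unlock /Rintegral => ->. Qed.

Lemma L2_integrable f : L2 P f -> P.-integrable setT (EFin \o f).
Proof.
move=> fL; apply/Lfun1_integrable; apply: Lfun_subset12 => //.
exact: fin_num_measure.
Qed.

(** The covariance identity is silent on means, so the law is used: integrability allows summation
    over the level sets, and the partial sums are - nu(B) pois(n), which tend to 0. *)
Lemma N_mean B : finite_sets nu B -> \int[P]_o N B o = 0.
Proof.
move=> fB; have iN := L2_integrable (N_L2 fB).
rewrite /Rintegral (integral_level_sets fB iN).
have mV := measurable_level_set B.
have E k : (\int[P]_(x in level_set B k) (N B x)%:E =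
    ((k%:R - n_ B) * pois (n_ B) k)%:E)%E.
  transitivity (\int[P]_(x in level_set B k) (cst (k%:R - n_ B)%:E x))%E.
    by apply: eq_integral => x; rewrite inE /level_set/= => ->.
  exact: integral_cst_level.
rewrite (_ : (fun n => _) = (fun n => (\sum_(0 <= k < n) (k%:R - n_ B) * pois (n_ B) k)%:E)); last first.
  by apply/funext => n; rewrite -sumEFin; apply: eq_bigr => k _; rewrite E.
have h : \sum_(0 <= k < n) (k%:R - n_ B) * pois (n_ B) k @[n --> \oo] --> 0.
  rewrite -cvg_shiftS /=.
  have -> : (fun n => \sum_(0 <= k < n.+1) (k%:R - n_ B) * pois (n_ B) k) =
      (fun n => - n_ B * pois (n_ B) n).
    by apply/funext => n; rewrite big_mkord sum_centered_pois.
  have h : - n_ B * pois (n_ B) n @[n --> \oo] --> - n_ B * 0.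
    by apply: cvgM; [exact: cvg_cst|exact: pois_cvg0].
  by rewrite mulr0 in h.
by rewrite [X in fine X](EFin_lim (cvgP _ h))/= (cvg_lim _ h).
Qed.

(** [g (N B)] is constant on every level set of [N B], so the integrals of [W] over these sets
    determine that of the product. The assumption on |W| yields integrability of the product. *)
Lemma indep_step B (W : Omega -> R) (g : R -> R) (a b : R) : finite_sets nu B -> 0 <= b ->
  measurable_fun setT g -> P.-integrable setT (EFin \o W) ->
  P.-integrable setT (EFin \o (g \o N B)) ->
  (forall k, \int[P]_(x in level_set B k) W x = a * pois (n_ B) k) ->
  (forall k, \int[P]_(x in level_set B k) `|W x| = b * pois (n_ B) k) ->
  P.-integrable setT (fun x => (W x * g (N B x))%:E) /\
  \int[P]_x (W x * g (N B x)) = a * \int[P]_x g (N B x).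
Proof.
move=> fB b0 mg iW ig Wa Wb.
have mV := measurable_level_set B.
have mW : measurable_fun setT W by apply/measurable_EFinP; exact: measurable_int iW.
have mgN : measurable_fun setT (g \o N B).
  by apply: measurableT_comp => //; exact: measurable_funPT.
have iWV k : P.-integrable (level_set B k) (EFin \o W) by exact: integrableS iW.
have iWVn k : P.-integrable (level_set B k) (fun x => `|W x|%:E).
  by apply: integrableS (integrable_norm iW).
have Wa' k : (\int[P]_(x in level_set B k) (W x)%:E = (a * pois (n_ B) k)%:E)%E.
  by rewrite -Wa /Rintegral fineK//; exact: integrable_fin_num.
have Wb' k : (\int[P]_(x in level_set B k) `|W x|%:E = (b * pois (n_ B) k)%:E)%E.
  by rewrite -Wb /Rintegral fineK//; exact: integrable_fin_num.
have const k (c : R) : (\int[P]_(x in level_set B k) (c * g (N B x))%:E =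
    (c * g (k%:R - n_ B) * pois (n_ B) k)%:E)%E.
  transitivity (\int[P]_(x in level_set B k) (cst (c * g (k%:R - n_ B))%:E x))%E.
    by apply: eq_integral => x; rewrite inE /level_set/= => ->.
  exact: integral_cst_level.
have intW : P.-integrable setT (fun x => (W x * g (N B x))%:E).
  apply/integrableP; split; first exact/measurable_EFinP/measurable_funM.
  have -> : (\int[P]_x `|(W x * g (N B x))%:E| = \int[P]_x (b * `|g (N B x)|)%:E)%E.
    rewrite (ge0_integral_level_sets fB)//; last first.
      by do 2 apply: measurableT_comp => //; exact: measurable_funM.
    rewrite (ge0_integral_level_sets fB)//; last 2 first.
    - by apply/measurable_EFinP; apply: measurable_funM => //; exact: measurableT_comp.
    - by move=> x; rewrite lee_fin mulr_ge0.
    apply: eq_eseriesr => k _.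
    transitivity (\int[P]_(x in level_set B k) (`|g (k%:R - n_ B)|%:E * `|W x|%:E))%E.
      apply: eq_integral => x; rewrite inE /level_set/= => ->.
      by rewrite normrM mulrC EFinM.
    rewrite integralZl// Wb' -EFinM.
    transitivity (\int[P]_(x in level_set B k) (cst (b * `|g (k%:R - n_ B)|)%:E x))%E.
      by rewrite integral_cst_level//; congr (_%:E); ring.
    by apply: eq_integral => x; rewrite inE /level_set/= => ->.
  under eq_integral do rewrite EFinM.
  rewrite integralZl//; last exact: (integrable_norm ig).
  by rewrite lte_mul_pinfty// ?lee_fin// integrable_lty//; exact: (integrable_norm ig).
split=> //.
rewrite -RintegralZl// /Rintegral; congr fine.
rewrite (integral_level_sets fB)// (integral_level_sets fB)//; last first.
  by under eq_fun do rewrite EFinM; exact: (integrableZl measurableT a ig).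
apply: eq_eseriesr => k _; rewrite const.
transitivity (\int[P]_(x in level_set B k) ((g (k%:R - n_ B))%:E * (W x)%:E))%E.
  by apply: eq_integral => x; rewrite inE /level_set/= => ->; rewrite mulrC EFinM.
by rewrite integralZl// Wa' -EFinM; congr (_%:E); ring.
Qed.

(* Only one coordinate at a time is turned from an indicator into a general
   function: the indicators are exactly what the independence hypothesis sees. *)
Lemma indep_prod n (B : 'I_n -> set T) (g : 'I_n -> R -> R) :
  disjoint_family nu B -> (forall i, measurable_fun setT (g i)) ->
  (forall i, P.-integrable setT (EFin \o (g i \o N (B i)))) ->
  P.-integrable setT (EFin \o (fun o => \prod_(i < n) g i (N (B i) o))) /\
  \int[P]_o (\prod_(i < n) g i (N (B i) o)) =
    \prod_(i < n) \int[P]_o g i (N (B i) o).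
Proof.
move=> dB mg ig; have fB i : finite_sets nu (B i) by case: dB.
have indN (A : 'I_n -> set R) : (forall i, measurable (A i)) ->
    P (\bigcap_(i in [set: 'I_n]) (N (B i) @^-1` A i)) =
    (\prod_(i < n) P (N (B i) @^-1` A i))%E.
  by case: HN => _ h _; exact: h.
suff H (s : seq 'I_n) : (forall i, i \notin s ->
      exists2 A, measurable A & g i = \1_A) ->
  P.-integrable setT (EFin \o (fun o => \prod_(i < n) g i (N (B i) o))) /\
  \int[P]_o (\prod_(i < n) g i (N (B i) o)) =
    \prod_(i < n) \int[P]_o g i (N (B i) o).
  by apply: (H (index_enum 'I_n)) => i; rewrite mem_index_enum.
elim: s g mg ig => [|i s IH] g mg ig gA.
  have /choice[A hA] : forall i, exists A, measurable A /\ g i = \1_A.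
    by move=> i; have [//|A] := gA i; exists A.
  have mA i : measurable (A i) by case: (hA i).
  have mNA i : measurable (N (B i) @^-1` A i).
    by rewrite -[X in measurable X]setTI; exact: (measurable_funPT (N (B i))).
  have mC : measurable (\bigcap_(i in [set: 'I_n]) (N (B i) @^-1` A i)).
    by apply: fin_bigcap_measurable.
  have E : (fun o => \prod_(i < n) g i (N (B i) o)) =
      \1_(\bigcap_(i in [set: 'I_n]) (N (B i) @^-1` A i)).
    apply/funext => o; rewrite indicE; case: (boolP (o \in _)) => [|].
      rewrite inE => ho; rewrite big1// => i _; case: (hA i) => _ ->.
      by rewrite indicE mem_set//; exact: ho.
    rewrite notin_setE => ho; apply/eqP/prodf_eq0.
    apply: contrapT => h; apply: ho => i _ /=; apply: contrapT => hi; apply: h.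
    by exists i => //; case: (hA i) => _ ->; rewrite indicE memNset.
  rewrite E; split; first exact: integrable_indic.
  rewrite /Rintegral integral_indic// setIT.
  transitivity (fine (P (\bigcap_(i in [set: 'I_n]) (N (B i) @^-1` A i)))) => //.
  rewrite (indN _ mA) (eq_bigr (fun i => (\int[P]_o g i (N (B i) o))%:E)).
    by rewrite prodEFin.
  move=> i _; case: (hA i) => _ ->; rewrite /Rintegral.
  have -> : (\int[P]_x (\1_(A i) (N (B i) x))%:E = \int[P]_x (\1_(N (B i) @^-1` A i) x)%:E)%E by [].
  rewrite integral_indic// setIT -[in RHS]/(P _) fineK//; exact: fin_num_measure.
pose h (u : R -> R) j := if j == i then u else g j.
have split_i u o : \prod_(j < n) h u j (N (B j) o) =
    (\prod_(j < n | j != i) g j (N (B j) o)) * u (N (B i) o).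
  rewrite (bigD1 i)//= /h eqxx mulrC; congr (_ * _).
  by apply: eq_bigr => j /negbTE ->.
have hg : h (g i) = g by apply/funext => j; rewrite /h; case: eqP => [->|].
pose W o := \prod_(j < n | j != i) g j (N (B j) o).
have levelE (V : Omega -> R) k : \int[P]_(x in level_set (B i) k) V x =
   \int[P]_x (V x * \1_[set k%:R - n_ (B i)] (N (B i) x)).
  rewrite Rintegral_mkcond; apply: eq_Rintegral => x _.
  rewrite patchE indicE /level_set; case: ifPn => hx.
    by rewrite mem_set ?mulr1//; move: hx; rewrite inE.
  by rewrite memNset ?mulr0//; move: hx; rewrite notin_setE.
have intV A : measurable A -> P.-integrable setT (EFin \o (\1_A \o N (B i))).
  move=> mA; have mNA : measurable (N (B i) @^-1` A).
    by rewrite -[X in measurable X]setTI; exact: (measurable_funPT (N (B i))).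
  exact: (integrable_indic P mNA).
have lvl k : \int[P]_x \1_[set k%:R - n_ (B i)] (N (B i) x) = pois (n_ (B i)) k.
  transitivity (\int[P]_(x in level_set (B i) k) 1).
    by rewrite levelE; apply: eq_Rintegral => x _; rewrite mul1r.
  by rewrite /Rintegral (integral_cst_level k 1 (fB i)) mul1r.
(* With an indicator at coordinate [i] the induction hypothesis applies. The indicator of the whole
   line removes that factor; that of a singleton restricts to a level set of [N (B i)]. *)
have IHu (g' : 'I_n -> R -> R) A : measurable A ->
    (forall j, measurable_fun setT (g' j)) ->
    (forall j, P.-integrable setT (EFin \o (g' j \o N (B j)))) ->
    (forall j, j \notin i :: s -> exists2 A, measurable A & g' j = \1_A) ->
    let g'' j := if j == i then \1_A else g' j in
    P.-integrable setT (EFin \o (fun o => \prod_(i < n) g'' i (N (B i) o))) /\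
  \int[P]_o (\prod_(i < n) g'' i (N (B i) o)) =
    \prod_(i < n) \int[P]_o g'' i (N (B i) o).
  move=> mA mg' ig' g'A g''; apply: IH.
  - by move=> j; rewrite /g''; case: ifP => // _; exact: measurable_indic.
  - by move=> j; rewrite /g''; case: eqP => [->|//]; exact: intV.
  move=> j js; rewrite /g''; case: eqP => [_|/eqP ji]; first by exists A.
  by apply: g'A; rewrite in_cons negb_or ji.
pose ga j x := `|g j x|.
have mga j : measurable_fun setT (ga j) by exact: measurableT_comp.
have iga j : P.-integrable setT (EFin \o (ga j \o N (B j))).
  exact: (integrable_norm (ig j)).
have gaA j : j \notin i :: s -> exists2 A, measurable A & ga j = \1_A.
  move=> /gA[A mA gj]; exists A => //; apply/funext => x.
  by rewrite /ga gj ger0_norm.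
have WT : (fun o => \prod_(j < n) h (\1_setT) j (N (B j) o)) = W.
  by apply/funext => o; rewrite split_i indicT/= mulr1.
have iW : P.-integrable setT (EFin \o W).
  by rewrite -WT; exact: (IHu g setT measurableT mg ig gA).1.
have lv (g' : 'I_n -> R -> R) k : (forall j, measurable_fun setT (g' j)) ->
    (forall j, P.-integrable setT (EFin \o (g' j \o N (B j)))) ->
    (forall j, j \notin i :: s -> exists2 A, measurable A & g' j = \1_A) ->
    \int[P]_(x in level_set (B i) k) (\prod_(j < n | j != i) g' j (N (B j) x)) =
    (\prod_(j < n | j != i) \int[P]_o g' j (N (B j) o)) * pois (n_ (B i)) k.
  move=> mg' ig' g'A.
  have [_] := IHu g' _ (measurable_set1 (k%:R - n_ (B i))) mg' ig' g'A.
  rewrite [in RHS](bigD1 i)//= eqxx lvl mulrC levelE => E.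
  rewrite (_ : (fun x => _) = (fun x => \prod_(j < n)
     (if j == i then \1_[set k%:R - n_ (B i)] else g' j) (N (B j) x))).
    rewrite E; congr (_ * _); apply: eq_bigr => j ji; apply: eq_Rintegral => o _.
    by rewrite (negbTE ji).
  apply/funext => o; rewrite [in RHS](bigD1 i)//= eqxx mulrC; congr (_ * _).
  by apply: eq_bigr => j /negbTE ->.
have [] := @indep_step (B i) W (g i)
  (\prod_(j < n | j != i) \int[P]_o g j (N (B j) o))
  (\prod_(j < n | j != i) \int[P]_o ga j (N (B j) o)) (fB i) _ (mg i) iW (ig i).
- by apply: prodr_ge0 => j _; apply: Rintegral_ge0 => x _; exact: normr_ge0.
- by move=> k; exact: lv.
- move=> k; rewrite -lv//; apply: eq_Rintegral => o _.
  by rewrite /W normr_prod.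
rewrite (_ : (fun o => \prod_(j < n) g j (N (B j) o)) = (fun x => W x * g i (N (B i) x))).
  by move=> iWg ->; split=> //; rewrite [in RHS](bigD1 i)//= mulrC.
by apply/funext => o; rewrite -split_i hg.
Qed.

End poisson_variables.

(** * Words of disjoint cells *)

Lemma Rintegral_wsum d (T : measurableType d) (R : realType)
    (mu : {measure set T -> \bar R}) (X : finType) m (Z : seq X -> T -> R) :
  (forall a, size a = m -> mu.-integrable setT (EFin \o Z a)) ->
  mu.-integrable setT (EFin \o (fun o => wsum (fun=> 1) m (Z ^~ o))) /\
  \int[mu]_o wsum (fun=> 1) m (Z ^~ o) = wsum (fun=> 1) m (fun a => \int[mu]_o Z a o).
Proof.
elim: m Z => [|m IH] Z iZ /=; first by split=> //; exact: iZ.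
have IHx x := IH (fun a => Z (x :: a)) (fun a am => iZ (x :: a) (congr1 S am)).
have iF x : mu.-integrable setT (EFin \o (fun o => 1 * wsum (fun=> 1) m (fun a => Z (x :: a) o))).
  rewrite (_ : (fun o => _) = (fun o => wsum (fun=> 1) m (fun a => Z (x :: a) o))).
    exact: (IHx x).1.
  by apply/funext => o; rewrite mul1r.
have [h1 h2] := Rintegral_sum (index_enum X) iF.
split=> //; rewrite h2; apply: eq_bigr => x _.
by rewrite mul1r -(IHx x).2; apply: eq_Rintegral => o _; rewrite mul1r.
Qed.

Lemma measure_cells d (T : measurableType d) (R : realType)
    (mu : {measure set T -> \bar R}) (I : finType) (S : pred I) (B : I -> set T) :
  (forall i, measurable (B i)) -> trivIset setT B ->
  (mu (\bigcup_(i in [set i | S i]) B i) = \sum_(i | S i) mu (B i))%E.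
Proof.
move=> mB tB; rewrite measure_fin_bigcup//; [|exact: finite_finset|exact: sub_trivIset tB].
rewrite (_ : [set i | S i] = [set` [seq i <- index_enum I | S i]]); last first.
  by apply/seteqP; split => i /=; rewrite mem_filter mem_index_enum andbT.
by rewrite -fsbig_seq ?filter_uniq ?index_enum_uniq// big_filter.
Qed.

Section poisson_cells.
Context (d : measure_display) (T : measurableType d) (R : realType).
Context (d' : measure_display) (Omega : measurableType d').
Variable nu : {sigma_finite_measure set T -> \bar R}.
Variable P : probability Omega R.
Variable N : set T -> {RV P >-> R}.
Hypothesis HN : compensated_poisson nu N.

Lemma L2_ae0 (U : Omega -> R) : L2 P U -> \int[P]_o (U o * U o) = 0 ->
  U = (fun=> 0) %[ae P].
Proof.
move=> UL U0; have N0 : ('N[P]_2%:E[EFin \o U] = 0)%E.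
  rewrite L2_fin//; congr (_%:E); apply/eqP; rewrite -sqrf_eq0 -eqe -L2_sqint//.
  have i2 := L2_mul_integrable UL UL.
  rewrite /sqint -(@fineK _ (\int[P]_x _)%E); last exact: (integrable_fin_num measurableT i2).
  by rewrite -[X in X%:E == _]/(\int[P]_x (U x ^+ 2)) U0.
have mU : measurable_fun setT (EFin \o U).
  by apply/measurable_EFinP; exact: L2_measurable UL.
have := Lnorm_eq0_eq0 mU _ N0; rewrite lte_fin ltr0n => /(_ isT).
by apply: filterS => x /= /[apply] -[].
Qed.

(* The covariance identity makes E (N A - sum_i N (B i))^2 vanish. *)
Lemma N_sum (I : finType) (S : pred I) (A : set T) (B : I -> set T) :
  finite_sets nu A -> (forall i, finite_sets nu (B i)) -> trivIset setT B ->
  A = \bigcup_(i in [set i | S i]) B i ->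
  (N A : Omega -> R) = (fun o => \sum_(i | S i) N (B i) o) %[ae P].
Proof.
move=> fA fB tB AE.
pose U o := N A o - \sum_(i | S i) N (B i) o.
have sE o : \sum_(i | S i) N (B i) o = \sum_i ((S i)%:R * N (B i) o).
  by rewrite big_mkcond; apply: eq_bigr => i _; case: (S i); rewrite ?mul1r ?mul0r.
have sL : L2 P (fun o => \sum_i ((S i)%:R * N (B i) o)).
  by apply: L2_sum => i; apply: L2Z; exact: (N_L2 HN).
have UL : L2 P U.
  rewrite (_ : U = fun o => N A o - \sum_i ((S i)%:R * N (B i) o)).
    by apply: L2B => //; exact: (N_L2 HN).
  by apply/funext => o; rewrite /U sE.
have UC C : finite_sets nu C -> \int[P]_o (U o * N C o) = 0.
  move=> fC; have CL := N_L2 HN fC.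
  transitivity (\int[P]_o (N A o * N C o - \sum_i ((S i)%:R * (N (B i) o * N C o)))).
    apply: eq_Rintegral => o _; rewrite /U sE mulrBl mulr_suml; congr (_ - _).
    by apply: eq_bigr => i _; rewrite mulrA.
  have iBC i : P.-integrable setT (EFin \o (fun o => (S i)%:R * (N (B i) o * N C o))).
    rewrite (_ : _ \o _ = (fun o => ((S i)%:R%:E * (N (B i) o * N C o)%:E)%E)).
      by apply: integrableZl => //; apply: L2_mul_integrable => //; exact: (N_L2 HN).
    by apply/funext => o; rewrite /= EFinM.
  have [i1 i2] := Rintegral_sum (index_enum I) iBC.
  rewrite RintegralB//; last by apply: L2_mul_integrable => //; exact: (N_L2 HN).
  rewrite i2 (N_mul HN)//; apply/eqP; rewrite subr_eq0; apply/eqP.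
  have mC : measurable C by case: fC.
  have mB i : measurable (B i) by case: (fB i).
  rewrite AE setI_bigcupl measure_cells//; last 2 first.
  - by move=> i; exact: measurableI.
  - apply/trivIsetP => i j _ _ ij; rewrite setIACA (trivIsetP.1 tB)//.
    by rewrite set0I.
  rewrite big_mkcond/= -[LHS]/(fine _) (_ : (\sum_i _)%E =
      (\sum_i ((S i)%:R * fine (nu (B i `&` C)))%:E)%E).
    rewrite sumEFin/=; apply: eq_bigr => i _.
    by rewrite RintegralZl ?(N_mul HN)//; apply: L2_mul_integrable => //; exact: (N_L2 HN).
  apply: eq_bigr => i _; case: (S i); rewrite ?mul1r ?mul0r// fineK//.
  rewrite ge0_fin_numE//; have [_] := fB i; apply: le_lt_trans.
  by apply: le_measure; rewrite ?inE//; exact: measurableI.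
suff : U = (fun=> 0) %[ae P].
  by apply: filterS => o /= /[apply] /eqP; rewrite subr_eq0 => /eqP.
apply: L2_ae0 => //.
transitivity (\int[P]_o (U o * N A o - \sum_i ((S i)%:R * (U o * N (B i) o)))).
  apply: eq_Rintegral => o _; rewrite {2}/U sE mulrBr mulr_sumr; congr (_ - _).
  by apply: eq_bigr => i _; rewrite mulrCA.
have iUB i : P.-integrable setT (EFin \o (fun o => (S i)%:R * (U o * N (B i) o))).
  rewrite (_ : _ \o _ = (fun o => ((S i)%:R%:E * (U o * N (B i) o)%:E)%E)).
    by apply: integrableZl => //; apply: L2_mul_integrable => //; exact: (N_L2 HN).
  by apply/funext => o; rewrite /= EFinM.
have [i1 i2] := Rintegral_sum (index_enum I) iUB.
rewrite RintegralB//; last by apply: L2_mul_integrable => //; exact: (N_L2 HN).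
rewrite i2 UC// sub0r big1 ?oppr0// => i _.
rewrite RintegralZl ?UC ?mulr0//.
by apply: L2_mul_integrable => //; exact: (N_L2 HN).
Qed.

Section fixed_cells.
Context (X : finType) (D : X -> set T).
Hypothesis fD : forall x, finite_sets nu (D x).
Hypothesis tD : trivIset setT D.

Let n_ (B : set T) : R := fine (nu B).

Lemma indep_cells (g : X -> R -> R) : (forall x, measurable_fun setT (g x)) ->
  (forall x, P.-integrable setT (EFin \o (g x \o N (D x)))) ->
  P.-integrable setT (EFin \o (fun o => \prod_x g x (N (D x) o))) /\
  \int[P]_o (\prod_x g x (N (D x) o)) = \prod_x \int[P]_o g x (N (D x) o).
Proof.
move=> mg ig; pose B (i : 'I_#|X|) := D (enum_val i).
have dB : disjoint_family nu B.
  split=> [i|]; first exact: fD.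
  apply/trivIsetP => i j _ _ ij; apply: (trivIsetP.1 tD) => //.
  by apply: contra_neq ij; exact: enum_val_inj.
have prodE (F : X -> R) : \prod_x F x = \prod_(i < #|X|) F (enum_val i).
  by rewrite -big_enum_val; apply: eq_bigl => x; rewrite inE.
have [] := indep_prod HN (g := fun i => g (enum_val i)) dB (fun i => mg _) (fun i => ig _).
rewrite (_ : (fun o => \prod_(i < #|X|) _) = (fun o => \prod_x g x (N (D x) o))).
  by rewrite (prodE (fun x => \int[P]_o g x (N (D x) o))).
by apply/funext => o; rewrite prodE.
Qed.

Definition empty_cell x (o : Omega) : R := \1_[set - n_ (D x)] (N (D x) o).

Definition void (S : pred X) (o : Omega) : R := \prod_(x | S x) empty_cell x o.

Lemma Rintegral_empty_cell x : \int[P]_o empty_cell x o = expR (- n_ (D x)).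
Proof.
have := level_setE HN 0 (fD x); rewrite /pois expr0 divr1 mul1r => E.
have mL := measurable_level_set nu N (D x) 0.
transitivity (\int[P]_o (\1_(level_set nu N (D x) 0) o : R)).
  apply: eq_Rintegral => o _.
  rewrite /empty_cell /level_set !indicE; congr ((nat_of_bool _)%:R).
  by apply/idP/idP; rewrite !inE/= sub0r.
rewrite /Rintegral integral_indic// setIT.
by transitivity (fine (P (level_set nu N (D x) 0))) => //; rewrite E.
Qed.

Lemma prod_count (w : seq X) (F : X -> R) :
  \prod_(x <- w) F x = \prod_x F x ^+ count_mem x w.
Proof.
elim: w => [|y w IH]; first by rewrite big_nil big1.
rewrite big_cons IH (bigD1 y)//= [RHS](bigD1 y)//= eqxx add1n exprS mulrA.
congr (_ * _); apply: eq_bigr => x xy.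
by rewrite eq_sym (negbTE xy).
Qed.

(** Independence factors the expectation over the cells. For a cell in [S], N equals - nu(D x) on
    the void event, so its moments are those of mean - nu(D x) and variance 0; for the others the
    mean is 0 and the variance nu(D x). These are nu phi and nu + nu phi at phi = - 1_S. *)
Lemma word_expectation (S : pred X) (w : seq X) :
  (forall x, (count_mem x w <= 2)%N) ->
  P.-integrable setT (EFin \o (fun o => (\prod_(x <- w) N (D x) o) * void S o)) /\
  \int[P]_o ((\prod_(x <- w) N (D x) o) * void S o) =
    expR (- \sum_(x | S x) n_ (D x)) *
    word_moment (fun x => n_ (D x) * - (S x)%:R)
                (fun x => n_ (D x) + n_ (D x) * - (S x)%:R) w.
Proof.
move=> cw.
pose g x (y : R) := y ^+ count_mem x w * (if S x then \1_[set - n_ (D x)] y else 1).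
have mg x : measurable_fun setT (g x).
  apply: measurable_funM; first exact: measurable_funX.
  by case: (S x) => //; exact: measurable_indic.
have gE o : (\prod_(x <- w) N (D x) o) * void S o = \prod_x g x (N (D x) o).
  rewrite prod_count /void [X in _ * X]big_mkcond -big_split/=; apply: eq_bigr => x _.
  by rewrite /g; case: (S x).
have NL x := N_L2 HN (fD x).
have gx x : P.-integrable setT (EFin \o (g x \o N (D x))) /\
    \int[P]_o g x (N (D x) o) = (if S x then expR (- n_ (D x)) else 1) *
    moment (fun x => n_ (D x) * - (S x)%:R)
                (fun x => n_ (D x) + n_ (D x) * - (S x)%:R) x (count_mem x w).
  have [Sx|Sx] := boolP (S x).
    have E : g x \o N (D x) = (fun o => (- n_ (D x)) ^+ count_mem x w * empty_cell x o).
      apply/funext => o; rewrite /g /empty_cell /= Sx indicE.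
      case: (boolP (_ \in _)); rewrite ?mulr0//.
      by rewrite inE/= => ->.
    have ie : P.-integrable setT (EFin \o empty_cell x).
      have mL := measurable_level_set nu N (D x) 0.
      rewrite (_ : empty_cell x = \1_(level_set nu N (D x) 0)).
        exact: integrable_indic.
      apply/funext => o; rewrite /empty_cell /level_set !indicE; congr ((nat_of_bool _)%:R).
      by apply/idP/idP; rewrite !inE/= sub0r.
    have -> : \int[P]_o g x (N (D x) o) = \int[P]_o (g x \o N (D x)) o by [].
    rewrite E; split.
      rewrite (_ : _ \o _ = (fun o => ((- n_ (D x)) ^+ count_mem x w)%:E * (empty_cell x o)%:E)%E).
        exact: integrableZl.
      by apply/funext => o; rewrite /= EFinM.
    rewrite RintegralZl// Rintegral_empty_cell mulrC; congr (_ * _).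
    have S1 : (S x)%:R = 1 :> R by rewrite Sx.
    by move: (cw x); case: (count_mem x w) => [|[|[|//]]] _ /=; rewrite ?S1; ring.
  have E : g x \o N (D x) = (fun o => N (D x) o ^+ count_mem x w).
    by apply/funext => o; rewrite /g /= (negbTE Sx) mulr1.
  have -> : \int[P]_o g x (N (D x) o) = \int[P]_o (g x \o N (D x)) o by [].
  rewrite E mul1r; move: (cw x); case: (count_mem x w) => [|[|[|//]]] _ /=.
  - split; first by apply: finite_measure_integrable_cst.
    rewrite -[LHS]/(\int[P]_o 1) Rintegral_cst// mul1r.
    by transitivity (fine (P setT)) => //; rewrite probability_setT.
  - split; first exact: (L2_integrable (NL x)).
    by rewrite -[LHS]/(\int[P]_o N (D x) o) (N_mean HN)// (negbTE Sx) oppr0 mulr0.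
  split; first exact: (L2_mul_integrable (NL x) (NL x)).
  rewrite -[LHS]/(\int[P]_o (N (D x) o * N (D x) o)) (N_mul HN)// setIid.
  by rewrite (negbTE Sx) oppr0 !mulr0 expr0n/= add0r addr0.
have [h1 h2] := indep_cells mg (fun x => (gx x).1).
rewrite (_ : (fun o => _) = (fun o => \prod_x g x (N (D x) o))); last first.
  by apply/funext => o.
split=> //; rewrite h2 (eq_bigr _ (fun x _ => (gx x).2)) big_split/=; congr (_ * _).
rewrite -big_mkcond/= -sumrN; elim/big_rec2 : _ => [|x y z _ ->].
  by rewrite expR0.
by rewrite expRD.
Qed.

Lemma cells_product_formula (S : pred X) p q (F G : seq X -> R) :
  perm_inv F -> perm_inv G ->
  (forall s, ~~ uniq s -> F s = 0) -> (forall s, ~~ uniq s -> G s = 0) ->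
  \int[P]_o (wsum (fun x => N (D x) o) p F * wsum (fun x => N (D x) o) q G * void S o) =
  expR (- \sum_(x | S x) n_ (D x)) *
  \sum_(r < (minn p q).+1) r`!%:R * 'C(p, r)%:R * 'C(q, r)%:R *
    \sum_(l < r.+1) 'C(r, l)%:R * wsum (fun x => n_ (D x)) (p + q - r) (fun c =>
       F (take p c) * G (take r c ++ drop p c) * \prod_(x <- drop l c) - (S x)%:R).
Proof.
move=> pF pG uF uG; rewrite -discrete_product_formula// -wsumZ.
pose K a b o := F a * (G b * ((\prod_(x <- a ++ b) N (D x) o) * void S o)).
have iK a b : P.-integrable setT (EFin \o K a b) /\ \int[P]_o K a b o =
    F a * (G b * (expR (- \sum_(x | S x) n_ (D x)) *
    word_moment (fun x => n_ (D x) * - (S x)%:R)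
                (fun x => n_ (D x) + n_ (D x) * - (S x)%:R) (a ++ b))).
  (* Only the first two moments of N are available, so words with a repeated letter are discarded
     before integrability is claimed. *)
  have K0 : F a = 0 \/ G b = 0 -> K a b = cst 0.
    by move=> ab; apply/funext => o; rewrite /K /=; case: ab => ->; rewrite !(mul0r, mulr0).
  have i0 : P.-integrable setT (EFin \o cst 0) /\ \int[P]_o (cst 0 o : R) = 0.
    by split; [exact: integrable0|rewrite /Rintegral integral0].
  have [ua|ua] := boolP (uniq a); last first.
    by have F0 := uF _ ua; rewrite (K0 (or_introl F0)) F0 mul0r.
  have [ub|ub] := boolP (uniq b); last first.
    by have G0 := uG _ ub; rewrite (K0 (or_intror G0)) G0 mul0r mulr0.
  have [|h1 h2] := @word_expectation S (a ++ b).
    by move=> x; rewrite count_cat !count_uniq_mem//; case: (_ \in _); case: (_ \in _).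
  have KE : K a b = (fun o => (F a * G b) * ((\prod_(x <- a ++ b) N (D x) o) * void S o)).
    by apply/funext => o; rewrite /K mulrA.
  rewrite KE; split.
    rewrite (_ : _ \o _ = (fun o => (F a * G b)%:E * ((\prod_(x <- a ++ b) N (D x) o) * void S o)%:E)%E).
      exact: integrableZl.
    by apply/funext => o; rewrite /= EFinM.
  by rewrite RintegralZl// h2 -mulrA.
have iK2 a : size a = p -> P.-integrable setT (EFin \o (fun o => wsum (fun=> 1) q (fun b => K a b o))).
  by move=> _; apply: (Rintegral_wsum (fun b _ => (iK a b).1)).1.
transitivity (\int[P]_o wsum (fun=> 1) p (fun a => wsum (fun=> 1) q (fun b => K a b o))).
  apply: eq_Rintegral => o _; rewrite [X in X * _ * _]wsum1 [X in _ * X * _]wsum1.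
  rewrite -!wsumZr; apply: eq_wsum => a _.
  rewrite mulrAC -wsumZ; apply: eq_wsum => b _.
  by rewrite /K big_cat/=; ring.
rewrite (Rintegral_wsum iK2).2; apply: eq_wsum => a _.
rewrite (Rintegral_wsum (fun b _ => (iK a b).1)).2 mulrCA -!wsumZ; apply: eq_wsum => b _.
by rewrite (iK a b).2; ring.
Qed.

End fixed_cells.

End poisson_cells.

(** * Functions constant on cells *)

Lemma sum_cst_Sn {R : pzRingType} m (c : R) : \sum_(w : 'S_m) c = m`!%:R * c.
Proof. by rewrite sumr_const mulr_natl -(card_Sn m). Qed.

Lemma fact_unit {R : numFieldType} m : m`!%:R != 0 :> R.
Proof. by rewrite pnatr_eq0 -lt0n fact_gt0. Qed.

Section L2s_theory.
Context (d : measure_display) (T : measurableType d) (R : realType).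
Variable nu : {sigma_finite_measure set T -> \bar R}.
Local Notation pm := (power_measure nu).

Lemma L2s_L2 m f : L2s nu f -> L2 (pm m) f.
Proof. by case. Qed.

Lemma L2s_lin m a f g : L2s nu f -> L2s nu g ->
  L2s nu (fun x : m.-tuple T => a * f x + g x).
Proof.
move=> [fL fs] [gL gs]; split; first by apply: L2D => //; exact: L2Z.
move=> w; have := gs w; have := fs w; apply: filterS2 => x /= hf hg _.
by rewrite hf// hg.
Qed.

Lemma L2s_0 m : L2s nu (fun _ : m.-tuple T => 0 : R).
Proof. by split; [exact: L2_0|move=> w; apply: aeW]. Qed.

Lemma L2s_sum m (I : Type) (s : seq I) (c : I -> R) (F : I -> m.-tuple T -> R) :
  (forall i, L2s nu (F i)) -> L2s nu (fun x => \sum_(i <- s) c i * F i x).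
Proof.
move=> FL; elim: s => [|i s IH].
  by under eq_fun do rewrite big_nil; exact: L2s_0.
by under eq_fun do rewrite big_cons; exact: L2s_lin.
Qed.

Lemma finite_rect m (C : 'I_m -> set T) : (forall i, finite_sets nu (C i)) ->
  measurable (rect C) /\ (pm m (rect C) < +oo)%E.
Proof.
move=> fC; have mC i : measurable (C i) by case: (fC i).
split; first exact: measurable_rect.
rewrite power_measure_rect// -ge0_fin_numE ?prode_ge0// prode_fin_num// => i _.
by rewrite ge0_fin_numE//; case: (fC i).
Qed.

Lemma sym_rectE m (C : 'I_m -> set T) :
  sym_rect C = \bigcup_(w in [set: 'S_m]) rect (fun i => C (w i)).
Proof. by []. Qed.

Lemma finite_sym_rect m (C : 'I_m -> set T) : (forall i, finite_sets nu (C i)) ->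
  measurable (sym_rect C) /\ (pm m (sym_rect C) < +oo)%E.
Proof.
move=> fC; have fr (w : 'S_m) := finite_rect (fun i => fC (w i)).
have mS : measurable (sym_rect C).
  rewrite sym_rectE; apply: fin_bigcup_measurable.
      exact: (@finite_finset {perm 'I_m}).
    by move=> w _; case: (fr w).
split=> //; rewrite sym_rectE -ge0_fin_numE//.
rewrite (_ : [set: 'S_m] = [set` index_enum ('S_m : finType)]); last first.
  by apply/seteqP; split => w //= _; rewrite mem_index_enum.
rewrite bigcup_seq; elim: (index_enum _) => [|w s IH]; first by rewrite big_nil measure0.
rewrite big_cons ge0_fin_numE//.
have ms : measurable (\big[setU/set0]_(t <- s) rect (fun i => C (t i))).
  by apply: bigsetU_measurable => t _; case: (fr t).
have [mw woo] := fr w.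
apply: le_lt_trans (measureU2 _ _ _) _ => //.
by rewrite lte_add_pinfty// -ge0_fin_numE.
Qed.

Lemma L2_indic m (A : set (m.-tuple T)) : measurable A -> (pm m A < +oo)%E ->
  L2 (pm m) (\1_A : m.-tuple T -> R).
Proof.
move=> mA Aoo; apply/L2P; split; first exact: measurable_indic.
rewrite /sqint (eq_integral (fun x => (\1_A x)%:E)); first by rewrite integral_indic// setIT.
by move=> x _; rewrite indicE expr2 -natrM mulnb andbb.
Qed.

Lemma sym_rect_permute m (C : 'I_m -> set T) (w : 'S_m) x :
  sym_rect C (permute w x) <-> sym_rect C x.
Proof.
split=> [] [u _ h].
  exists (w^-1 * u)%g => // i.
  by have := h ((w^-1)%g i); rewrite /= tnth_mktuple permKV permM.
by exists (w * u)%g => // i; rewrite tnth_mktuple permM; exact: h.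
Qed.

Lemma L2s_sym_rect m (C : 'I_m -> set T) : (forall i, finite_sets nu (C i)) ->
  L2s nu (\1_(sym_rect C) : m.-tuple T -> R).
Proof.
move=> fC; have [mS Soo] := finite_sym_rect fC.
split; first exact: L2_indic.
move=> w; apply: aeW => x _ /=; rewrite !indicE; congr ((nat_of_bool _)%:R).
by apply/idP/idP; rewrite !inE => h; apply/(sym_rect_permute C w x).
Qed.

Lemma L2_permute m (w : 'S_m) f : L2 (pm m) f ->
  L2 (pm m) (f \o permute w) /\ norm2 (pm m) (f \o permute w) = norm2 (pm m) f.
Proof.
move=> /[dup] fL /L2P[mf foo].
have mfw : measurable_fun [set: m.-tuple T] (f \o permute w).
  by apply: measurableT_comp => //; exact: measurable_permute.
have E : sqint (pm m) (f \o permute w) = sqint (pm m) f.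
  rewrite /sqint -[RHS](ge0_integral_permute nu w)//.
    by apply/measurable_EFinP/measurable_funX.
  by move=> x; rewrite lee_fin sqr_ge0.
have fwL : L2 (pm m) (f \o permute w) by apply/L2P; rewrite E.
split=> //; apply/eqP; rewrite -(@eqrXn2 _ 2)// ?norm2_ge0//.
by rewrite -eqe -!L2_sqint// E.
Qed.

Lemma L2_symmetrize m (h : m.-tuple T -> R) : L2 (pm m) h ->
  L2s nu (symmetrize h) /\ norm2 (pm m) (symmetrize h) <= norm2 (pm m) h.
Proof.
move=> hL; have hwL (w : 'S_m) : L2 (pm m) (fun x => h (permute w x)).
  exact: (L2_permute w hL).1.
have sL : L2 (pm m) (fun x => \sum_(w : 'S_m) h (permute w x)) by exact: L2_sum.
split.
  split; first exact: L2Z.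
  move=> u; apply: aeW => x _ /=; rewrite /symmetrize; congr (_ * _).
  rewrite [RHS](reindex_inj (mulIg u))/=; apply: eq_bigr => w _; congr h.
  by apply: eq_from_tnth => i; rewrite !tnth_mktuple permM.
rewrite /symmetrize norm2Z// ger0_norm// ler_pdivrMl ?ltr0n ?fact_gt0//.
apply: (@le_trans _ _ (\sum_(w : 'S_m) norm2 (pm m) (fun x => h (permute w x)))).
  elim: (index_enum _) => [|w s IH].
    under eq_fun do rewrite big_nil; rewrite big_nil.
    by rewrite -(mul0r (0 : R)) norm2Z ?normr0 ?mul0r//; exact: L2_0.
  under eq_fun do rewrite big_cons; rewrite big_cons.
  by apply: le_trans (norm2D _ _) _ => //; [exact: L2_sum|exact: lerD].
under eq_bigr do rewrite (L2_permute _ hL).2.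
by rewrite sum_cst_Sn.
Qed.

(** [f] agrees almost everywhere with its symmetrization, and symmetrization does not increase the
    norm. *)
Lemma norm2_sym_le m f h : L2s nu f -> L2 (pm m) h ->
  norm2 (pm m) (fun x => f x - symmetrize h x) <= norm2 (pm m) (fun x => f x - h x).
Proof.
move=> [fL fs] hL; have fhL := L2B fL hL.
have [sL sle] := L2_symmetrize fhL.
have [sfL _] := L2_symmetrize hL.
have E : (fun x => f x - symmetrize h x) = symmetrize (fun x => f x - h x) %[ae pm m].
  have : {ae pm m, forall x, forall w : 'S_m, f (permute w x) = f x}.
    apply: filter_forall => w; apply: filterS (fs w) => x /= hx; exact: hx.
  apply: filterS => x fx _; rewrite /symmetrize sumrB.
  rewrite (_ : \sum_(w : 'S_m) f (permute w x) = m`!%:R * f x).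
    by rewrite mulrBr mulrA mulVf ?mul1r ?fact_unit.
  by rewrite -sum_cst_Sn; apply: eq_bigr => w _; exact: fx.
have shL : L2 (pm m) (fun x => f x - symmetrize h x).
  by apply: L2B => //; case: (L2_symmetrize hL) => -[].
by rewrite -(ae_eq_norm2 (L2_measurable sL.1) E shL).2.
Qed.

(** A change of variables moves each permutation onto [k], which absorbs it. *)
Lemma integral_symmetrize_mul m (h k : m.-tuple T -> R) : L2 (pm m) h -> L2 (pm m) k ->
  (forall w : 'S_m, k \o permute w = k) ->
  \int[pm m]_x (symmetrize h x * k x) = \int[pm m]_x (h x * k x).
Proof.
move=> hL kL ks.
have iw (w : 'S_m) : (pm m).-integrable setT (EFin \o (fun x => h (permute w x) * k x)).
  by apply: L2_mul_integrable => //; exact: (L2_permute w hL).1.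
have [i1 i2] := Rintegral_sum (index_enum ('S_m : finType)) iw.
transitivity (\int[pm m]_x ((m`!%:R)^-1 * \sum_(w : 'S_m) (h (permute w x) * k x))).
  by apply: eq_Rintegral => x _; rewrite /symmetrize -mulrA mulr_suml.
rewrite RintegralZl// i2 (eq_bigr (fun=> \int[pm m]_x (h x * k x))).
  by rewrite sum_cst_Sn mulrA mulVf ?mul1r ?fact_unit.
move=> w _; rewrite /Rintegral; congr fine; rewrite -[RHS](integral_permute nu w)//.
  apply: eq_integral => x _; congr (_ * _)%:E.
  exact: (esym (congr1 (@^~ x) (ks w))).
by apply/measurable_EFinP/measurable_funM; [exact: L2_measurable hL|exact: L2_measurable kL].
Qed.

End L2s_theory.

Section cells.
Context (d : measure_display) (T : measurableType d) (R : realType).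
Variable nu : {sigma_finite_measure set T -> \bar R}.
Variable W : nat -> set T.
Hypothesis fW : forall i, finite_sets nu (W i).
Local Notation pm := (power_measure nu).

Definition code n : finType := {ffun 'I_n -> bool}.

Definition sig n (x : T) : code n := [ffun i : 'I_n => `[< W i x >]].

Definition good n (s : code n) : bool := [exists i, s i].

(** The all-false code stands for the complement of the first n sets, whose measure may be infinite;
    its cell is made empty so that every cell has finite measure. *)
Definition cell n (s : code n) : set T := [set x | good s /\ sig n x = s].

Lemma measurable_sig n (s : code n) : measurable [set x | sig n x = s].
Proof.
rewrite (_ : [set x | _] =
    \bigcap_(i in [set: 'I_n]) (if s i then W i else ~` W i)); last first.
  apply/seteqP; split => x.
    by move=> /= <- i _; rewrite ffunE; case: asboolP.
  move=> h; apply/ffunP => i; rewrite ffunE; have := h i I.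
  by case: (s i) => hi; apply/asboolP.
apply: fin_bigcap_measurable => [|i _]; first exact: finite_finset.
have [mW _] := fW i; case: ifP => _ //; exact: measurableC.
Qed.

Lemma finite_cell n (s : code n) : finite_sets nu (cell s).
Proof.
have mc : measurable (cell s).
  rewrite /cell; case: (boolP (good s)) => gs.
    rewrite (_ : [set x | _] = [set x | sig n x = s]); first exact: measurable_sig.
    by apply/seteqP; split=> x /= => [[]|].
  rewrite (_ : [set x | _] = set0)//.
  by apply/seteqP; split=> x //= [].
split=> //; have [/existsP[i si]|gs] := boolP (good s); last first.
  rewrite (_ : cell s = set0) ?measure0 ?ltry//.
  by apply/seteqP; split=> x // []; rewrite (negbTE gs).
have [mW Woo] := fW i; apply: le_lt_trans Woo; apply: le_measure; rewrite ?inE//.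
by move=> x [_ h]; move: si; rewrite -h ffunE => /asboolP.
Qed.

Lemma trivIset_cell n : trivIset setT (@cell n).
Proof.
apply/trivIsetP => s t _ _ /eqP st; apply/seteqP; split => // x [[_ h1] [_ h2]].
by apply: st; rewrite -h1.
Qed.

Definition cellm n (s : code n) : R := fine (nu (cell s)).

Lemma cellmE n (s : code n) : nu (cell s) = (cellm s)%:E.
Proof. by have [mc coo] := finite_cell s; rewrite fineK// ge0_fin_numE. Qed.

Definition restr n m (nm : (n <= m)%N) (s : code m) : code n :=
  [ffun i => s (widen_ord nm i)].

Lemma restr_sig n m (nm : (n <= m)%N) x : restr nm (sig m x) = sig n x.
Proof. by apply/ffunP => i; rewrite !ffunE. Qed.

Lemma good_restr n m (nm : (n <= m)%N) s : good (restr nm s) -> good s.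
Proof. by move=> /existsP[i]; rewrite ffunE => h; apply/existsP; exists (widen_ord nm i). Qed.

Lemma cell_restr n m (nm : (n <= m)%N) (s : code n) : good s ->
  cell s = \bigcup_(t in [set t | restr nm t == s]) cell t.
Proof.
move=> gs; apply/seteqP; split=> x.
  move=> [_ xs]; exists (sig m x); first by rewrite /= restr_sig xs.
  by split=> //; apply: (@good_restr n m nm); rewrite restr_sig xs.
by move=> [t /= /eqP ts [gt xt]]; split=> //; rewrite -(restr_sig nm) xt.
Qed.

(** Coefficients of a symmetric elementary function based on the level-n cells: no mass on the
    diagonals, none outside the union of the cells. *)
Record cell_function n (F : seq (code n) -> R) : Prop := {
  cell_function_perm : perm_inv F ;
  cell_function_uniq : forall s, ~~ uniq s -> F s = 0 ;
  cell_function_good : forall s, ~~ all (@good n) s -> F s = 0 }.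

Definition lift n (F : seq (code n) -> R) k (x : k.-tuple T) : R := F (map (sig n) x).

Lemma lift_restr n m (nm : (n <= m)%N) F : cell_function F ->
  cell_function (F \o map (restr nm)) /\
  forall k, @lift n F k = @lift m (F \o map (restr nm)) k.
Proof.
move=> [pF uF gF]; split.
  split=> s /=.
  - by move=> t st; apply: pF; exact: perm_map.
  - by move=> us; apply: uF; apply: contra us; exact: map_uniq.
  - move=> gs; apply: gF; apply: contra gs => /allP h; apply/allP => t ts.
    by apply: (@good_restr n m nm); apply: h; exact: map_f.
move=> k; apply/funext => x; rewrite /lift/= -map_comp; congr F.
by apply: eq_map => y; rewrite /= restr_sig.
Qed.

Lemma lift_sum n (H : seq (code n) -> R) k (x : k.-tuple T) :
  (forall s, ~~ all (@good n) s -> H s = 0) ->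
  lift H x = \sum_(a : k.-tuple (code n)) H a * \1_(rect (fun i => cell (tnth a i))) x.
Proof.
move=> gH; rewrite (bigD1 (map_tuple (sig n) x))//= big1 ?addr0; last first.
  move=> a ax; rewrite indicE memNset ?mulr0// => h; move: ax => /eqP; apply.
  by apply: eq_from_tnth => i; rewrite tnth_map; have [_] := h i.
rewrite /lift; have [g|/gH->] := boolP (all (@good n) (map (sig n) x)); last by rewrite mul0r.
rewrite indicE mem_set ?mulr1// => i; rewrite tnth_map; split=> //.
by apply: (allP g); apply: map_f; exact: mem_tnth.
Qed.

Lemma Rintegral_indic_rect n k (a : k.-tuple (code n)) :
  (pm k).-integrable setT (EFin \o (\1_(rect (fun i => cell (tnth a i))) : k.-tuple T -> R)) /\
  \int[pm k]_x (\1_(rect (fun i => cell (tnth a i))) x : R) = \prod_(s <- a) cellm s.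
Proof.
have [mr roo] := finite_rect (fun i => finite_cell (tnth a i)).
have E : (\int[pm k]_x (\1_(rect (fun i => cell (tnth a i))) x)%:E = pm k (rect (fun i => cell (tnth a i))))%E.
  by rewrite integral_indic// setIT.
split.
  apply/integrableP; split; first by apply/measurable_EFinP; exact: measurable_indic.
  by under eq_integral do rewrite /= ger0_norm//; rewrite E.
rewrite /Rintegral E power_measure_rect; last by move=> i; case: (finite_cell (tnth a i)).
by rewrite (eq_bigr _ (fun i _ => cellmE _)) prodEFin/= big_tuple.
Qed.

Lemma Rintegral_lift n (H : seq (code n) -> R) k :
  (forall s, ~~ all (@good n) s -> H s = 0) ->
  (pm k).-integrable setT (EFin \o @lift n H k) /\
  \int[pm k]_x lift H x = wsum (@cellm n) k H.
Proof.
move=> gH; rewrite (_ : @lift n H k = fun x => \sum_(a : k.-tuple (code n))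
    H a * \1_(rect (fun i => cell (tnth a i))) x); last first.
  by apply/funext => x; exact: lift_sum.
have iZ (a : k.-tuple (code n)) : (pm k).-integrable setT
    (EFin \o (fun x => H a * \1_(rect (fun i => cell (tnth a i))) x)).
  rewrite (_ : _ \o _ = (fun x => (H a)%:E * (\1_(rect (fun i => cell (tnth a i))) x)%:E)%E).
    by apply: integrableZl => //; exact: (Rintegral_indic_rect a).1.
  by apply/funext => o; rewrite /= EFinM.
have [i1 i2] := Rintegral_sum (index_enum _) iZ.
split=> //; rewrite i2 wsum_tuple; apply: eq_bigr => a _.
by rewrite RintegralZl ?(Rintegral_indic_rect a).2 1?mulrC//; exact: (Rintegral_indic_rect a).1.
Qed.

Lemma measurable_lift n (H : seq (code n) -> R) k : measurable_fun [set: k.-tuple T] (@lift n H k).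
Proof.
(* [H] may be nonzero at the all-false code, so full preimages under [sig] take the place of
   [cell]. *)
rewrite (_ : @lift n H k = fun x => \sum_(a : k.-tuple (code n))
    H a * \1_(rect (fun i => [set y | sig n y = tnth a i])) x).
  apply: measurable_sum => a; apply: measurable_funM => //; apply: measurable_indic.
  by apply: measurable_rect => i; exact: measurable_sig.
apply/funext => x; rewrite (bigD1 (map_tuple (sig n) x))//= big1 ?addr0; last first.
  move=> a ax; rewrite indicE memNset ?mulr0// => h; move: ax => /eqP; apply.
  by apply: eq_from_tnth => i; rewrite tnth_map; exact/esym/(h i).
by rewrite indicE mem_set ?mulr1// => i; rewrite tnth_map.
Qed.

Lemma L2_lift n (H : seq (code n) -> R) k :
  (forall s, ~~ all (@good n) s -> H s = 0) -> L2 (pm k) (@lift n H k).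
Proof.
move=> gH; apply/L2P; split; first exact: measurable_lift.
have [] := @Rintegral_lift n (fun s => H s ^+ 2) k.
  by move=> s /gH ->; rewrite expr0n.
by move=> i _; apply: integrable_lty i.
Qed.

Lemma L2s_lift n (F : seq (code n) -> R) k : cell_function F -> L2s nu (@lift n F k).
Proof.
move=> [pF uF gF]; split; first exact: L2_lift.
move=> w; apply: aeW => x _; rewrite /lift/=; apply: pF.
by apply: perm_map; apply/tuple_permP; exists w.
Qed.

(** The sum over tuples meets each symmetrized rectangle once for every ordering of its cells, hence
    the division by k!. *)
Lemma lift_sym_rect n (F : seq (code n) -> R) k (x : k.-tuple T) : cell_function F ->
  lift F x = \sum_(a : k.-tuple (code n))
    (F a / k`!%:R) * \1_(sym_rect (fun i => cell (tnth a i))) x.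
Proof.
move=> [pF uF gF].
pose b := map_tuple (sig n) x.
pose prm (w : 'S_k) (a : k.-tuple (code n)) := [tuple tnth a (w i) | i < k].
transitivity (\sum_(a : k.-tuple (code n)) \sum_(w : 'S_k)
    (F a / k`!%:R * (b == prm w a)%:R)).
  rewrite exchange_big/=.
  rewrite (eq_bigr (fun=> F b / k`!%:R)).
    by rewrite sum_cst_Sn mulrC mulfVK ?fact_unit.
  move=> w _; rewrite (bigD1 (prm (w^-1)%g b))//= big1 ?addr0; last first.
    move=> a ab; case: eqP => [bE|]; rewrite ?mulr0//; move: ab; rewrite bE.
    case/eqP; apply: eq_from_tnth => i; by rewrite !tnth_mktuple permKV.
  rewrite (_ : _ == _) ?mulr1; last first.
    by apply/eqP/eq_from_tnth => i; rewrite !tnth_mktuple permK.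
  by congr (_ / _); apply: pF; apply/tuple_permP; exists (w^-1)%g.
apply: eq_bigr => a _; rewrite -mulr_sumr.
have [->|Fa] := eqVneq (F a) 0; first by rewrite !mul0r.
have ua : uniq a by apply: contra_neqT Fa => /uF.
have ga : all (@good n) a by apply: contra_neqT Fa => /gF.
congr (_ * _).
have bE (w : 'S_k) : b == prm w a <-> rect (fun i => cell (tnth a (w i))) x.
  split=> [/eqP bw i|h].
    have := congr1 (fun t => tnth t i) bw; rewrite tnth_map tnth_mktuple => xi.
    by split=> //; apply: (allP ga); exact: mem_tnth.
  apply/eqP/eq_from_tnth => i; rewrite tnth_map tnth_mktuple.
  by have [_] := h i.
rewrite indicE; case: (boolP (x \in _)) => [|].
  (* Since [a] has distinct entries, a single permutation turns it into the word of [x]. *)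
  rewrite inE => -[w0 _ hw0]; have /eqP bw0 := (bE w0).2 hw0.
  rewrite (bigD1 w0)//= {1}bw0 eqxx big1 ?addr0// => w ww0.
  rewrite {1}bw0; case: eqP => // h; case/eqP: ww0; apply/permP => i.
  have := congr1 (fun t => tnth t i) h; rewrite !tnth_mktuple => hi.
  exact/esym/(elimT (tuple_uniqP a) ua).
rewrite notin_setE => nx; rewrite big1// => w _.
by case: (boolP (b == _)) => // /bE hw; case: nx; exists w.
Qed.

End cells.

(** * Multiple integrals of functions constant on cells *)

Section chaos_of_cells.
Context (d : measure_display) (T : measurableType d) (R : realType).
Variable nu : {sigma_finite_measure set T -> \bar R}.
Variable W : nat -> set T.
Hypothesis fW : forall i, finite_sets nu (W i).
Context (d' : measure_display) (Omega : measurableType d').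
Variable P : probability Omega R.
Variable N : set T -> {RV P >-> R}.
Variable m : nat.
Variable J : (m.-tuple T -> R) -> Omega -> R.
Hypothesis HJ : multiple_integral nu N J.
Local Notation pm := (power_measure nu).

Lemma multiple_integral_lin a f g : L2s nu f -> L2s nu g ->
  J (fun x => a * f x + g x) = (fun o => a * J f o + J g o) %[ae P].
Proof. by case: HJ => _ h _ _; exact: h. Qed.

Lemma multiple_integral0 : J (fun=> 0) = (fun=> 0) %[ae P].
Proof.
have h0 := L2s_0 nu m (R := R); have := multiple_integral_lin 1 h0 h0.
rewrite (_ : (fun x => _) = (fun=> 0)); last by apply/funext => x; rewrite mulr0 addr0.
apply: filterS => o /= /[apply]; rewrite mul1r => /eqP.
by rewrite -subr_eq subrr => /eqP.
Qed.

Lemma multiple_integral_sum (I : Type) (s : seq I) (c : I -> R)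
    (F : I -> m.-tuple T -> R) : (forall i, L2s nu (F i)) ->
  J (fun x => \sum_(i <- s) c i * F i x) =
  (fun o => \sum_(i <- s) c i * J (F i) o) %[ae P].
Proof.
move=> FL; elim: s => [|i s IH].
  rewrite (_ : (fun x : m.-tuple T => _) = (fun=> 0)); last first.
    by apply/funext => x; rewrite big_nil.
  have := multiple_integral0.
  by apply: filterS => o /= /[apply] ->; rewrite big_nil.
rewrite (_ : (fun x : m.-tuple T => _) =
    (fun x => c i * F i x + \sum_(i <- s) c i * F i x)); last first.
  by apply/funext => x; rewrite big_cons.
have := multiple_integral_lin (c i) (FL i) (L2s_sum s c FL).
move: IH; apply: filterS2 => o /= h1 h2 _.
by rewrite big_cons h2// h1.
Qed.

(** The m! in the value of [J] on an indicator cancels the one in [lift_sym_rect]. Words with a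
    repeated cell, on which [J] is not prescribed, have coefficient 0. *)
Lemma multiple_integral_lift n (F : seq (code n) -> R) : cell_function F ->
  J (lift W F (k := m)) = (fun o => wsum (fun s => N (cell W s) o) m F) %[ae P].
Proof.
move=> cF; have [pF uF gF] := cF.
rewrite (_ : lift W F (k := m) = fun x => \sum_(a : m.-tuple (code n))
    (F a / m`!%:R) * \1_(sym_rect (fun i => cell W (tnth a i))) x); last first.
  by apply/funext => x; exact: lift_sym_rect.
have sL (a : m.-tuple (code n)) :
    L2s nu (\1_(sym_rect (fun i => cell W (tnth a i))) : m.-tuple T -> R).
  by apply: L2s_sym_rect => i; exact: finite_cell.
have := multiple_integral_sum (index_enum _) (fun a : m.-tuple (code n) => F a / m`!%:R) sL.
have : {ae P, forall o, forall a : m.-tuple (code n),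
    (F a / m`!%:R) * J (\1_(sym_rect (fun i => cell W (tnth a i)))) o =
    (\prod_(s <- a) N (cell W s) o) * F a}.
  apply: filter_forall => a; have [ua|/uF->] := boolP (uniq a); last first.
    by apply: aeW => o; rewrite !(mul0r, mulr0).
  have dC : disjoint_family nu (fun i => cell W (tnth a i)).
    split=> [i|]; first exact: finite_cell.
    apply/trivIsetP => i j _ _ ij; apply: (trivIsetP.1 (@trivIset_cell _ _ W n)) => //.
    by apply: contra_neq ij; exact: (elimT (tuple_uniqP a) ua).
  case: HJ => _ _ _ /(_ _ dC); apply: filterS => o /= -> //.
  by rewrite mulrA mulfVK ?fact_unit// big_tuple mulrC.
apply: filterS2 => o h1 h2 _; rewrite h2// wsum_tuple.
by apply: eq_bigr => a _; exact: h1.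
Qed.

End chaos_of_cells.

(** * Density of functions constant on cells *)

Section wsum_order.
Context {R : realFieldType} {X : finType}.
Implicit Types (w : X -> R) (H : seq X -> R).

Lemma le_wsum w m H H' : (forall x, 0 <= w x) ->
  (forall s, size s = m -> H s <= H' s) -> wsum w m H <= wsum w m H'.
Proof.
move=> w0; elim: m H H' => [|m IH] H H' HH' /=; first exact: HH'.
by apply: ler_sum => x _; apply: ler_wpM2l => //; apply: IH => s sm; rewrite HH'//= sm.
Qed.

Lemma wsum_cst w m c : wsum w m (fun=> c) = (\sum_x w x) ^+ m * c.
Proof.
elim: m => [|m IH] /=; first by rewrite mul1r.
by rewrite IH -mulr_suml exprS mulrA.
Qed.

(** Union bound over the k positions of [x]; each of the k - 1 other letters contributes a factor at
    most [E]. *)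
Lemma wsum_mem_le (E : R) w x : 0 <= E -> (forall x, 0 <= w x) ->
  \sum_x w x <= E -> forall k,
  wsum w k (fun s => (x \in s)%:R) <= w x * (k%:R * E ^+ k.-1).
Proof.
move=> E0 w0 wE; have S0 : 0 <= \sum_x w x by apply: sumr_ge0.
elim=> [|k IH] /=; first by rewrite mul0r mulr0.
apply: (@le_trans _ _ (\sum_y w y * wsum w k (fun s => (y == x)%:R + (x \in s)%:R))).
  apply: ler_sum => y _; apply: ler_wpM2l => //; apply: le_wsum => // s _.
  by rewrite in_cons eq_sym; case: (y == x); case: (x \in s); rewrite /= ?addr0 ?add0r// lerDl.
under eq_bigr do rewrite wsumD wsum_cst mulrDr.
rewrite big_split/= -mulr_suml -natr1 mulrDl mul1r mulrDr addrC; apply: lerD.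
  have -> : w x * (k%:R * E ^+ k) = E * (w x * (k%:R * E ^+ k.-1)).
    by case: k {IH} => [|k]; rewrite ?mul0r ?mulr0// exprS/=; ring.
  apply: ler_pM => //; rewrite -(mul0r (wsum w k (fun=> 0))) -wsumZ.
  by apply: le_wsum => // s _; rewrite mul0r.
set S := (\sum_x w x) ^+ k; rewrite (bigD1 x)//= eqxx mulr1 big1 ?addr0; last first.
  by move=> y yx; rewrite (negbTE yx) !mulr0.
by apply: ler_wpM2l => //; apply: lerXn2r; rewrite ?nnegrE.
Qed.

End wsum_order.

(** A repeated letter costs the square of its weight. The constant depends on [m] and [E] alone, as
    the alphabet will be refined with the total weight fixed. *)
Lemma wsum_dup_le {R : realFieldType} m (E : R) : 0 <= E -> exists2 C, 0 <= C &
  forall (X : finType) (w : X -> R), (forall x, 0 <= w x) -> \sum_x w x <= E ->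
  wsum w m (fun s => (~~ uniq s)%:R) <= C * \sum_x w x ^+ 2.
Proof.
move=> E0; elim: m => [|m [C C0 IH]]; first by exists 0 => // X w w0 _ /=; rewrite mul0r.
exists (m%:R * E ^+ m.-1 + E * C) => [|X w w0 wE].
  by rewrite addr_ge0 ?mulr_ge0// exprn_ge0.
have S0 : 0 <= \sum_x w x by apply: sumr_ge0.
rewrite /=; apply: (@le_trans _ _ (\sum_x w x *
    (wsum w m (fun s => (x \in s)%:R) + wsum w m (fun s => (~~ uniq s)%:R)))).
  apply: ler_sum => x _; apply: ler_wpM2l => //; rewrite -wsumD; apply: le_wsum => // s _.
  by case: (x \in s); case: (uniq s); rewrite /= ?addr0 ?add0r// lerDl.
rewrite (eq_bigr _ (fun x _ => mulrDr (w x) _ _)) big_split/= -mulr_suml mulrDl.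
apply: lerD.
  rewrite mulr_sumr; apply: ler_sum => x _.
  rewrite mulrC expr2 mulrA [leRHS]mulrC mulrA; apply: ler_wpM2r => //.
  apply: le_trans (wsum_mem_le x E0 w0 wE m) _.
  by rewrite mulrC.
rewrite -mulrA; apply: ler_pM => //; last exact: IH.
rewrite -(mul0r (wsum w m (fun=> 0))) -wsumZ.
by apply: le_wsum => // s _; rewrite mul0r.
Qed.


Section small_cells.
Context (d : measure_display) (T : measurableType d) (R : realType).
Variable nu : {sigma_finite_measure set T -> \bar R}.
Variable W : nat -> set T.
Hypothesis fW : forall i, finite_sets nu (W i).
Hypothesis sepW : forall x y, (forall i, W i x <-> W i y) -> x = y.
Hypothesis null1 : forall x, nu [set x] = 0%E.

Definition base k : set T := \bigcup_(i in [set i | (i < k)%N]) W i.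

Definition goodb k n (s : code n) : bool := [exists i : 'I_n, (i < k)%N && s i].

Lemma finite_base k : finite_sets nu (base k).
Proof.
rewrite /base bigcup_mkord; elim: k => [|k [mk koo]].
  by rewrite big_ord0; split=> //; rewrite measure0.
rewrite big_ord_recr/=; have [mW Woo] := fW k; split; first exact: measurableU.
apply: le_lt_trans (measureU2 _ _ _) _ => //.
by rewrite lte_add_pinfty.
Qed.

Lemma goodb_sig k n x : (k <= n)%N -> goodb k (sig W n x) <-> base k x.
Proof.
move=> kn; split=> [/existsP[i /andP[ik]]|[i /= ik Wx]].
  by rewrite ffunE => /asboolP Wx; exists i.
apply/existsP; exists (widen_ord kn (Ordinal ik)); rewrite /= ik ffunE.
exact/asboolP.
Qed.

Lemma goodb_good k n (s : code n) : goodb k s -> good s.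
Proof. by move=> /existsP[i /andP[_ si]]; apply/existsP; exists i. Qed.

Lemma base_cell k n (s : code n) x : (k <= n)%N -> cell W s x ->
  base k x <-> goodb k s.
Proof. by move=> kn [_ <-]; apply: iff_sym; exact: goodb_sig. Qed.

(** Cell measures confined to [base k]: the total stays equal to nu(base k) while the level n grows,
    whereas the union of all cells grows with n. *)
Definition bweight k n (s : code n) : R := (goodb k s)%:R * cellm nu W s.

Lemma bweight_ge0 k n (s : code n) : 0 <= bweight k s.
Proof. by rewrite mulr_ge0// fine_ge0. Qed.

Lemma sum_bweight k n : (k <= n)%N -> \sum_(s : code n) bweight k s = fine (nu (base k)).
Proof.
move=> kn; rewrite (_ : base k = \bigcup_(s in [set s | goodb k s]) cell W (n := n) s).
  rewrite measure_cells//; last 2 first.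
  - by move=> s; case: (finite_cell fW s).
  - exact: trivIset_cell.
  rewrite (eq_bigr (fun s => (cellm nu W s)%:E)) => [|s _]; last exact: cellmE.
  rewrite sumEFin/= [RHS]big_mkcond/=; apply: eq_bigr => s _.
  by rewrite /bweight; case: ifP; rewrite ?mul1r ?mul0r.
apply/seteqP; split=> x.
  move=> bx; exists (sig W n x); first exact/goodb_sig.
  by split=> //; apply: (@goodb_good k); exact/goodb_sig.
by move=> [s /= gs] /(base_cell kn) h; apply/h.
Qed.

(** The sum is the integral over [base k] of the measure of the cell containing the point. That cell
    shrinks to the point itself because the sets [W i] separate points, and points are null; nu(base
    k) dominates. *)
Lemma cvg_small_cells k :
  \sum_(s : code n) bweight k s ^+ 2 @[n --> \oo] --> 0.
Proof.
have [mb boo] := finite_base k.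
(* Level n + k, so that [base k] is a union of cells. *)
pose g n x : R := \sum_(s : code (n + k)) bweight k s * \1_(cell W s) x.
have mc n (s : code n) : measurable (cell W s) by case: (finite_cell fW s).
have gE n x : g n x = fine (nu (cell W (sig W (n + k) x))) * \1_(base k) x.
  have kn : (k <= n + k)%N by rewrite leq_addl.
  rewrite /g (bigD1 (sig W (n + k) x))//= big1 ?addr0; last first.
    move=> s sx; rewrite indicE memNset ?mulr0// => -[_ xs].
    by rewrite xs eqxx in sx.
  rewrite /bweight indicE mulrAC [LHS]mulrC; congr (_ * _).
  have [gx|gx] := boolP (goodb k (sig W (n + k) x)).
    rewrite mul1r mem_set; last by split=> //; exact: goodb_good gx.
    by rewrite indicE mem_set//; exact/(goodb_sig x kn).
  by rewrite mul0r indicE memNset// => /(goodb_sig x kn); exact/negP.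
have ig n (s : code (n + k)) : nu.-integrable setT
    (EFin \o (fun x => bweight k s * \1_(cell W s) x)).
  rewrite (_ : _ \o _ = (fun x => (bweight k s)%:E * (\1_(cell W s) x)%:E)%E); last first.
    by apply/funext => x; rewrite /= EFinM.
  apply: integrableZl => //; apply/integrableP; split.
    by apply/measurable_EFinP; exact: measurable_indic.
  under eq_integral do rewrite /= ger0_norm//.
  by rewrite integral_indic// setIT; case: (finite_cell fW s).
have Ig n : nu.-integrable setT (EFin \o g n) /\
    \int[nu]_x g n x = \sum_(s : code (n + k)) bweight k s ^+ 2.
  have [h1 h2] := Rintegral_sum (index_enum _) (ig n).
  split=> //; rewrite h2; apply: eq_bigr => s _.
  rewrite RintegralZl//; last first.
    apply/integrableP; split; first by apply/measurable_EFinP; exact: measurable_indic.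
    under eq_integral do rewrite /= ger0_norm//.
    by rewrite integral_indic// setIT; case: (finite_cell fW s).
  rewrite /Rintegral integral_indic// setIT -/(cellm nu W s) /bweight.
  by rewrite expr2; case: (goodb k s); rewrite ?(mul1r, mul0r).
rewrite -(cvg_shiftn k) /=.
have -> : (fun n => \sum_(s : code (n + k)) bweight k s ^+ 2) = (fun n => \int[nu]_x g n x).
  by apply/funext => n; rewrite (Ig n).2.
have subb n x : base k x -> cell W (sig W (n + k) x) `<=` base k.
  have kn : (k <= n + k)%N by rewrite leq_addl.
  by move=> bx y hy; apply/(base_cell kn hy)/goodb_sig.
have cvgg x : g n x @[n --> \oo] --> 0.
  have [bx|bx] := pselect (base k x); last first.
    rewrite (_ : (fun n => g n x) = cst 0); first exact: cvg_cst.
    by apply/funext => n; rewrite gE indicE memNset// mulr0.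
  pose B n := cell W (sig W (n + k) x).
  have kn n : (k <= n + k)%N by rewrite leq_addl.
  have gx n : good (sig W (n + k) x) by apply: (@goodb_good k); exact/goodb_sig.
  (* Continuity from above along the decreasing cells around [x], the first of which has finite
     measure. *)
  have : nu (B n) @[n --> \oo] --> nu (\bigcap_n B n).
    apply: nonincreasing_cvg_mu => //.
    - by case: (finite_cell fW (sig W (0 + k) x)).
    - by move=> n; exact: mc.
    - by apply: bigcapT_measurable => n; exact: mc.
    move=> m n mn; apply/subsetPset => y [_ hy]; split=> //.
    have mnk : (m + k <= n + k)%N by rewrite leq_add2r.
    by rewrite -(restr_sig W mnk) hy restr_sig.
  rewrite (_ : \bigcap_n B n = [set x]) ?null1; last first.
    apply/seteqP; split=> y; last by move=> -> n _; split.
    move=> hy; apply: sepW => i; have [_] := hy i.+1 I.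
    move=> /ffunP/(_ (widen_ord (leq_addr _ _) (Ordinal (ltnSn i)))).
    rewrite !ffunE /= => h; split=> [/asboolP|/asboolP]; first by rewrite h => /asboolP.
    by rewrite -h => /asboolP.
  move=> /fine_cvg; rewrite (_ : fine \o _ = (fun n => g n x))//.
  by apply/funext => n /=; rewrite gE indicE mem_set// mulr1.
have [] := @dominated_convergence _ _ _ nu setT measurableT (fun n => EFin \o g n)
   (cst 0%E) (fun x => (fine (nu (base k)) * \1_(base k) x)%:E).
- by move=> n; case/integrableP: (Ig n).1.
- exact: measurable_cst.
- by apply: aeW => x _; apply: cvg_EFin; [exact: nearW|exact: cvgg].
- rewrite (_ : (fun x => _) = (fun x => (fine (nu (base k)))%:E * (\1_(base k) x)%:E)%E); last first.
    by apply/funext => x; rewrite EFinM.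
  apply: integrableZl => //; apply/integrableP; split.
    by apply/measurable_EFinP; exact: measurable_indic.
  under eq_integral do rewrite /= ger0_norm//.
  by rewrite integral_indic// setIT.
- apply: aeW => x n _; rewrite /= gE indicE; case: (boolP (x \in base k)) => bx; last first.
    by rewrite !mulr0 normr0.
  move: bx; rewrite inE => bx; rewrite !mulr1 lee_fin ger0_norm ?fine_ge0//.
  have [_ coo] := finite_cell fW (sig W (n + k) x).
  apply: fine_le; rewrite ?ge0_fin_numE//.
  by apply: le_measure; rewrite ?inE//; exact: subb.
by move=> _ _; rewrite integral0 => /fine_cvg.
Qed.

End small_cells.

Section density.
Context (d : measure_display) (T : measurableType d) (R : realType).
Variable nu : {sigma_finite_measure set T -> \bar R}.
Variable W : nat -> set T.
Hypothesis fW : forall i, finite_sets nu (W i).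
Hypothesis sepW : forall x y, (forall i, W i x <-> W i y) -> x = y.
Hypothesis null1 : forall x, nu [set x] = 0%E.
Hypothesis genW : forall A, measurable A -> <<s range W >> A.
Hypothesis covW : forall x, exists i, W i x.
Local Notation pm := (power_measure nu).

(** [cell_function] without symmetry, which would not survive the passage through indicators of
    arbitrary sets; [sym_words] restores it at the end. *)
Definition offdiag n (F : seq (code n) -> R) :=
  (forall s, ~~ uniq s -> F s = 0) /\ (forall s, ~~ all (@good n) s -> F s = 0).

Definition approx m (f : m.-tuple T -> R) := L2 (pm m) f /\
  forall e, 0 < e -> exists n (F : seq (code n) -> R),
    offdiag F /\ norm2 (pm m) (fun x => f x - lift W F x) < e.

Lemma norm2_lift n (H : seq (code n) -> R) m :
  (forall s, ~~ all (@good n) s -> H s = 0) ->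
  norm2 (pm m) (lift W H (k := m)) ^+ 2 = wsum (@cellm _ _ _ nu W n) m (fun s => H s ^+ 2).
Proof.
move=> gH; have HL := L2_lift fW m gH.
rewrite -(Rintegral_lift fW (H := fun s => H s ^+ 2) m _).2; last first.
  by move=> s /gH ->; rewrite expr0n.
by rewrite -[LHS]/(fine (_%:E)) -L2_sqint.
Qed.

Lemma good_all_restr n n' (nn : (n <= n')%N) s :
  ~~ all (@good n') s -> ~~ all (@good n) (map (restr nn) s).
Proof.
apply: contra => /allP h; apply/allP => t ts.
by apply: (@good_restr n n' nn); apply: h; exact: map_f.
Qed.

Lemma offdiag_restr n n' (nn : (n <= n')%N) (F : seq (code n) -> R) :
  offdiag F -> offdiag (F \o map (restr nn)) /\
  forall m, @lift _ T R W n F m = @lift _ T R W n' (F \o map (restr nn)) m.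
Proof.
move=> [uF gF]; split.
  split=> s /= h; last by apply: gF; exact: good_all_restr.
  by apply: uF; apply: contra h; exact: map_uniq.
move=> m; apply/funext => x; rewrite /lift/= -map_comp; congr F.
by apply: eq_map => y; rewrite /= restr_sig.
Qed.

Lemma L2_offdiag n (F : seq (code n) -> R) m : offdiag F -> L2 (pm m) (lift W F (k := m)).
Proof. by move=> [_ gF]; exact: L2_lift. Qed.

Lemma approx_lim m (f : m.-tuple T -> R) : L2 (pm m) f ->
  (forall e, 0 < e -> exists g, approx g /\ norm2 (pm m) (fun x => f x - g x) < e) ->
  approx f.
Proof.
move=> fL fg; split=> // e e0.
have e20 : 0 < e / 2 by rewrite divr_gt0.
have [g [[gL ga] fge]] := fg _ e20; have [n [F [oF gF]]] := ga _ e20.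
exists n, F; split=> //.
apply: le_lt_trans (norm2_triangle fL gL (L2_offdiag m oF)) _.
by rewrite (splitr e) ltrD.
Qed.

Lemma approxD m (f g : m.-tuple T -> R) : approx f -> approx g ->
  approx (fun x => f x + g x).
Proof.
move=> [fL fa] [gL ga]; split; first exact: L2D.
move=> e e0; have e20 : 0 < e / 2 by rewrite divr_gt0.
have [n [F [oF fF]]] := fa _ e20; have [n' [G [oG gG]]] := ga _ e20.
have [oF' F'E] := offdiag_restr (leq_maxl n n') oF.
have [oG' G'E] := offdiag_restr (leq_maxr n n') oG.
move: oF' F'E oG' G'E; set F' := F \o _; set G' := G \o _ => oF' F'E oG' G'E.
exists (maxn n n'), (fun s => F' s + G' s); split.
  split=> s h; rewrite ?(oF'.1 _ h) ?(oG'.1 _ h) ?(oF'.2 _ h) ?(oG'.2 _ h) ?addr0//.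
rewrite (_ : (fun x => _) = (fun x => (f x - lift W F x) + (g x - lift W G x))).
  apply: le_lt_trans (norm2D _ _) _.
  - by apply: L2B => //; exact: L2_offdiag.
  - by apply: L2B => //; exact: L2_offdiag.
  by rewrite (splitr e) ltrD.
by apply/funext => x; rewrite F'E G'E /lift; ring.
Qed.

Lemma approxZ m a (f : m.-tuple T -> R) : approx f -> approx (fun x => a * f x).
Proof.
move=> [fL fa]; split; first exact: L2Z.
move=> e e0; have e1 : 0 < e / (`|a| + 1) by rewrite divr_gt0// ltr_wpDl.
have [n [F [oF fF]]] := fa _ e1; exists n, (fun s => a * F s); split.
  by split=> s h; rewrite ?(oF.1 _ h) ?(oF.2 _ h) ?mulr0.
rewrite (_ : (fun x => _) = (fun x => a * (f x - lift W F x))); last first.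
  by apply/funext => x; rewrite mulrBr.
rewrite norm2Z; last by apply: L2B => //; exact: L2_offdiag.
apply: (@le_lt_trans _ _ ((`|a| + 1) * norm2 (pm m) (fun x => f x - lift W F x))).
  by apply: ler_wpM2r; rewrite ?norm2_ge0// lerDl.
by rewrite mulrC -ltr_pdivlMr// ltr_wpDl.
Qed.

Lemma approx0 m : approx (fun _ : m.-tuple T => 0 : R).
Proof.
split; first exact: L2_0.
move=> e e0; exists 0%N, (fun=> 0); split=> //.
rewrite (_ : (fun x => _) = (fun _ : m.-tuple T => 0 * 0)); last first.
  by apply/funext => x; rewrite /lift subr0 mulr0.
by rewrite norm2Z ?normr0 ?mul0r//; exact: L2_0.
Qed.

Lemma approx_sum m (I : Type) (s : seq I) (F : I -> m.-tuple T -> R) :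
  (forall i, approx (F i)) -> approx (fun x => \sum_(i <- s) F i x).
Proof.
move=> aF; elim: s => [|i s IH].
  by under eq_fun do rewrite big_nil; exact: approx0.
by under eq_fun do rewrite big_cons; exact: approxD.
Qed.

(* At finer levels the words with a repeated cell become negligible. *)
Lemma approx_lift n (H : seq (code n) -> R) m :
  (forall s, ~~ all (@good n) s -> H s = 0) -> approx (lift W H (k := m)).
Proof.
move=> gH; split; first exact: L2_lift.
move=> e e0.
have [C C0 hC] := @wsum_dup_le R m (fine (nu (base W n))) (fine_ge0 (measure_ge0 _ _)).
pose M := \sum_(a : m.-tuple (code n)) `|H a|.
have HM (s : seq (code n)) : size s = m -> `|H s| <= M.
  move=> /eqP sm; rewrite /M (bigD1 (Tuple sm))//= lerDl.
  by apply: sumr_ge0.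
have M0 : 0 <= M by apply: sumr_ge0.
have MC0 : 0 < M ^+ 2 * C + 1 by rewrite ltr_wpDl// mulr_ge0// exprn_ge0.
(* The squared error will be at most M^2 C times the sum of the squared masses; the 1 keeps the
   denominator positive. *)
have q0 : 0 < e ^+ 2 / (M ^+ 2 * C + 1) by rewrite divr_gt0// exprn_gt0.
have /cvgrPdist_lt/(_ _ q0)[n0 _ hn0] := cvg_small_cells fW sepW null1 n.
pose n' := maxn n n0; have nn' : (n <= n')%N := leq_maxl _ _.
have {hn0} := hn0 n' (leq_maxr _ _); rewrite sub0r normrN ger0_norm ?sumr_ge0//; last first.
  by move=> s _; exact: sqr_ge0.
move=> qn.
pose K s := H (map (restr nn') s) * (~~ uniq s)%:R.
have gK s : ~~ all (@good n') s -> K s = 0.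
  by move=> gs; rewrite /K gH ?mul0r//; exact: good_all_restr.
exists n', (fun s => H (map (restr nn') s) * (uniq s)%:R); split.
  split=> s h; first by rewrite (negbTE h) mulr0.
  by rewrite gH ?mul0r//; exact: good_all_restr.
rewrite (_ : (fun x => _) = lift W K (k := m)); last first.
  apply/funext => x; rewrite /lift /K -map_comp.
  rewrite (_ : map (sig W n) x = map (restr nn' \o sig W n') x); last first.
    by apply: eq_map => y; rewrite /= restr_sig.
  by case: (uniq _); rewrite /= !(mulr1, mulr0) ?subrr ?subr0.
have KL := L2_lift fW m gK.
apply: norm2_lt => //; rewrite L2_sqint// lte_fin norm2_lift//.
have bw s : ~~ all (goodb n (n:=n')) s -> K s = 0.
  move=> gs; rewrite /K gH ?mul0r//; apply: contra gs => /allP h; apply/allP => t ts.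
  have /existsP[i ti] := h _ (map_f (restr nn') ts).
  apply/existsP; exists (widen_ord nn' i); rewrite /= ltn_ord/=.
  by move: ti; rewrite ffunE.
(* [K] lives on words of cells inside [base W n], so the weights may be confined there and
   [wsum_dup_le] applies with a bound independent of the level. *)
have -> : wsum (@cellm _ _ _ nu W n') m (fun s => K s ^+ 2) =
          wsum (@bweight _ _ _ nu W n n') m (fun s => K s ^+ 2).
  rewrite [LHS]wsum1 [RHS]wsum1; apply: eq_wsum => s _.
  have [g|/bw->] := boolP (all (goodb n (n:=n')) s); last by rewrite expr0n !mulr0.
  congr (_ * _); apply: eq_big_seq => t ts.
  by rewrite /bweight (allP g _ ts) mul1r.
apply: (@le_lt_trans _ _ (wsum (@bweight _ _ _ nu W n n') m
    (fun s => M ^+ 2 * (~~ uniq s)%:R))).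
  apply: le_wsum; first by move=> s; exact: bweight_ge0.
  move=> s sm; rewrite /K exprMn; case: (uniq s) => /=; first by rewrite expr0n !mulr0.
  rewrite expr1n !mulr1 -[leLHS]real_normK ?num_real// ler_pXn2r ?nnegrE//.
  by apply: HM; rewrite size_map.
rewrite wsumZ; apply: (@le_lt_trans _ _ (M ^+ 2 * (C * \sum_s bweight nu W n s ^+ 2))).
  apply: ler_wpM2l; first exact: sqr_ge0.
  apply: hC; first by move=> s; exact: bweight_ge0.
  by rewrite (sum_bweight fW nn').
rewrite mulrA; move: qn; rewrite ltr_pdivlMr// mulrDr mulr1 mulrC => qn.
by apply: le_lt_trans qn; rewrite lerDl sumr_ge0// => s _; exact: sqr_ge0.
Qed.

Definition box m k : set (m.-tuple T) := rect (fun=> base W k).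
Arguments box : clear implicits.

Lemma finite_box m k : measurable (box m k) /\ (pm m (box m k) < +oo)%E.
Proof. by apply: finite_rect => i; exact: finite_base. Qed.

(** The sets decided by the codes of the coordinates at some finite level: a generating class closed
    under intersection, on which approximation is immediate. *)
Definition coded m : set (set (m.-tuple T)) :=
  [set A | exists n (H : pred (seq (code n))), A = [set x : m.-tuple T | H (map (sig W n) x)]].

Lemma coded_restr m n n' (nn : (n <= n')%N) (H : pred (seq (code n))) :
  [set x : m.-tuple T | H (map (sig W n) x)] =
  [set x : m.-tuple T | H (map (restr nn) (map (sig W n') x))].
Proof.
apply/seteqP; split=> x /=; rewrite -map_comp;
  by rewrite (_ : map (restr nn \o sig W n') x = map (sig W n) x)//; apply: eq_map => y /=; rewrite restr_sig.
Qed.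

Lemma setI_coded m : setI_closed (@coded m).
Proof.
move=> _ _ [n [H ->]] [n' [H' ->]].
exists (maxn n n'), (fun s => H (map (restr (leq_maxl n n')) s) &&
                              H' (map (restr (leq_maxr n n')) s)).
rewrite (coded_restr m (leq_maxl n n')) (coded_restr m (leq_maxr n n')).
by apply/seteqP; split => x /= => [[-> ->]|/andP].
Qed.

Lemma coded_measurable m : @coded m `<=` @measurable _ (m.-tuple T).
Proof.
move=> _ [n [H ->]].
rewrite (_ : [set x | _] = lift W (fun s => (H s)%:R : R) (k := m) @^-1` [set 1]).
  by rewrite -[X in measurable X]setTI; apply: measurable_lift.
apply/seteqP; split=> x /=; rewrite /lift; first by move=> ->.
by case: (H _) => // /eqP; rewrite eq_sym oner_eq0.
Qed.

Lemma measurable_coded m : measurable = <<s @coded m >>.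
Proof.
apply/seteqP; split; last first.
  by apply: smallest_sub; [exact: sigma_algebra_measurable|exact: coded_measurable].
apply: smallest_sub; first exact: smallest_sigma_algebra.
rewrite -bigcup_seq => A /= [i _ [Y mY <-]]; rewrite setTI.
have sg := @smallest_sigma_algebra _ [set: m.-tuple T] (@coded m).
suff : <<s range W >> `<=` [set Y | <<s @coded m >> ((fun x => tnth x i) @^-1` Y)].
  by move=> /(_ _ (genW mY)).
apply: smallest_sub; first split.
- by rewrite /= preimage_set0; case: sg.
- by move=> B hB; rewrite /= setTD preimage_setC -setTD; case: sg => _ h _; exact: h.
- by move=> F hF; rewrite /= preimage_bigcup; case: sg => _ _ h; exact: h.
move=> _ [j _ <-]; apply: sub_sigma_algebra.
pose a0 : code j.+1 := [ffun=> false].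
exists j.+1, (fun s => (nth a0 s i) (inord j)).
apply/seteqP; split=> x /=.
  move=> h; rewrite (nth_map (tnth x i)) ?size_tuple// ffunE inordK// -tnth_nth.
  exact/asboolP.
by rewrite (nth_map (tnth x i)) ?size_tuple// ffunE inordK// -tnth_nth => /asboolP.
Qed.

(** Dynkin induction from [coded]. Intersecting with a fixed box of finite measure keeps complements
    and countable unions in L2. *)
Lemma approx_indic m k A : measurable A ->
  approx (\1_(A `&` box m k) : m.-tuple T -> R).
Proof.
move=> mA; have [mB Boo] := finite_box m k.
have IL (B : set (m.-tuple T)) : measurable B -> L2 (pm m) (\1_(B `&` box m k) : _ -> R).
  move=> mB'; apply: L2_indic; first exact: measurableI.
  by apply: le_lt_trans Boo; apply: le_measure; rewrite ?inE//; exact: measurableI.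
have coded_case n (H : pred (seq (code n))) :
    approx (\1_([set x : m.-tuple T | H (map (sig W n) x)] `&` box m k) : m.-tuple T -> R).
  pose n' := maxn n k; have nn : (n <= n')%N := leq_maxl _ _.
  have kn : (k <= n')%N := leq_maxr _ _.
  rewrite (coded_restr m nn).
  rewrite (_ : \1_ _ = lift W (fun s => (H (map (restr nn) s) && all (goodb k (n:=n')) s)%:R : R) (k := m)).
    apply: approx_lift => s gs; rewrite (_ : all _ _ = false) ?andbF//.
    apply/negbTE; apply: contra gs => /allP h; apply/allP => t ts.
    by apply: (@goodb_good k); exact: h.
  apply/funext => x; rewrite indicE /lift; congr ((nat_of_bool _)%:R).
  apply/idP/andP.
    rewrite inE => -[/= hH hx]; split=> //; apply/allP => _ /mapP[y /tnthP[i ->] ->].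
    exact/(goodb_sig _ _ kn).
  move=> [hH /allP hx]; rewrite inE; split=> //= i.
  by apply/(goodb_sig W _ kn); apply: hx; apply: map_f; exact: mem_tnth.
have boxT : \1_(setT `&` box m k) = \1_(box m k) :> (_ -> R) by rewrite setTI.
apply: (@dynkin_induction _ _ (@coded m) (fun A => approx (\1_(A `&` box m k) : _ -> R))).
- exact: measurable_coded.
- exact: setI_coded.
- have := coded_case 0%N predT; congr approx; congr (\1_(_ `&` _)).
  by apply/seteqP; split.
- by move=> _ [n [H ->]]; exact: coded_case.
- move=> S mS aS.
  rewrite (_ : \1_ _ = fun x => \1_(setT `&` box m k) x + (-1) * \1_(S `&` box m k) x).
    apply: approxD; last exact: approxZ.
    have := coded_case 0%N predT; congr approx; congr (\1_(_ `&` _)).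
    by apply/seteqP; split.
  apply/funext => x; rewrite !indicE !in_setI in_setC in_setT.
  by case: (x \in S); case: (x \in box m k); rewrite /= ?(mulr0, mulr1, addr0, subrr)// addr0.
- move=> F mF tF aF.
  (* For a disjoint union the partial sums are indicators too, so the box dominates them and they
     converge in L2. *)
  pose u n : m.-tuple T -> R := fun x => \sum_(i < n) \1_(F i `&` box m k) x.
  have [fL uL ucvg] : [/\ L2 (pm m) (\1_(\bigcup_i F i `&` box m k) : _ -> R),
      forall n, L2 (pm m) (u n) & norm2 (pm m) (fun x => u n x - \1_(\bigcup_i F i `&` box m k) x) @[n --> \oo] --> 0].
    have uE n x : u n x = \1_(\bigcup_(i in [set i | (i < n)%N]) F i `&` box m k) x.
      rewrite /u; have [[i /= iF]|h] := pselect (exists i, F i x); last first.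
        rewrite big1; first by rewrite indicE memNset// => -[[i _ Fi] _]; apply: h; exists i.
        by move=> i _; rewrite indicE memNset// => -[Fi _]; apply: h; exists i.
      have iuniq j : F j x -> j = i.
        move=> jF; apply: contrapT => /eqP ji.
        by have := trivIsetP.1 tF _ _ I I ji; apply/eqP/set0P; exists x.
      have [lin|nin] := ltnP i n.
        rewrite (bigD1 (Ordinal lin))//= big1 ?addr0; last first.
          move=> j ji; rewrite indicE memNset// => -[/iuniq jE _].
          by case/eqP: ji; exact/val_inj.
        rewrite !indicE !in_setI; congr ((nat_of_bool (_ && _))%:R).
        by rewrite !mem_set//; exists i.
      rewrite big1; first by rewrite indicE memNset// => -[[j /= jn /iuniq ji] _]; move: nin; rewrite -ji leqNgt jn.
      by move=> j _; rewrite indicE memNset// => -[/iuniq ji _]; move: nin; rewrite -ji leqNgt ltn_ord.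
    apply: (@dominated_norm2 _ _ _ _ _ _ (\1_(box m k))).
    - move=> n; apply: measurable_sum => i; apply: measurable_indic.
      exact: measurableI.
    - by apply: measurable_indic; apply: measurableI => //; exact: bigcupT_measurable.
    - exact: L2_indic.
    - apply: aeW => x; have [[i Fi]|h] := pselect (exists i, F i x).
        apply: cvg_near_cst; exists i.+1 => // n /= lin.
        rewrite uE !indicE !in_setI; congr ((nat_of_bool (_ && _))%:R).
        by rewrite !mem_set//; exists i.
      rewrite (_ : (fun n => u n x) = cst (\1_(\bigcup_i F i `&` box m k) x)).
        exact: cvg_cst.
      apply/funext => n; rewrite uE /= !indicE !memNset//.
        by move=> -[[i _ Fi] _]; apply: h; exists i.
      by move=> -[[i _ Fi] _]; apply: h; exists i.
    - move=> n x; rewrite uE !indicE !in_setI.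
      by case: (x \in box m k); rewrite ?andbF ?normr0// andbT; case: (_ \in _); rewrite ?normr0 ?normr1.
  apply: approx_lim => // e e0.
  have /cvgrPdist_lt/(_ _ e0)[n _ /(_ n (leqnn n))/=] := ucvg.
  rewrite sub0r normrN ger0_norm ?norm2_ge0// norm2BC => un.
  by exists (u n); split=> //; apply: approx_sum => i; exact: aF.
by rewrite -measurable_coded.
Qed.

Import HBNNSimple.

(** Simple functions increasing to [f] are cut off to growing boxes, which exhaust the space as
    every point lies in some [W i]; [f] itself dominates. *)
Lemma approx_ge0 m (f : m.-tuple T -> R) : L2 (pm m) f -> (forall x, 0 <= f x) ->
  approx f.
Proof.
move=> fL f0; have mf := L2_measurable fL.
have mEf : measurable_fun [set: m.-tuple T] (EFin \o f) by exact/measurable_EFinP.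
pose g := nnsfun_approx measurableT mEf.
have fE0 x : [set: m.-tuple T] x -> (0 <= (EFin \o f) x)%E by rewrite lee_fin.
have gle n x : g n x <= f x.
  by rewrite -lee_fin /g nnsfun_approxE; exact: le_approx.
have gf x : g n x @[n --> \oo] --> f x.
  have := cvg_nnsfun_approx measurableT mEf fE0 (I : [set: m.-tuple T] x).
  by move=> /fine_cvg.
pose u n x := g n x * \1_(box m n) x.
have au n : approx (u n).
  have fr : finite_set (range (g n)) by exact: fimfunP.
  rewrite (_ : u n = fun x => \sum_(r <- finmap.enum_fset (fset_set (range (g n))))
     (r * \1_((g n @^-1` [set r]) `&` box m n) x)).
    apply: approx_sum => r; apply: approxZ; apply: approx_indic.
    by rewrite -[X in measurable X]setTI; exact: (measurable_funPT (g n)).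
  apply/funext => x; rewrite /u [in LHS]fimfunE fsbig_finite//= mulr_suml.
  apply: eq_bigr => r _; rewrite -mulrA; congr (_ * _).
  by rewrite !indicE in_setI -natrM mulnb.
have [_ _ uf] : [/\ L2 (pm m) f, forall n, L2 (pm m) (u n) &
    norm2 (pm m) (fun x => u n x - f x) @[n --> \oo] --> 0].
  apply: (@dominated_norm2 _ _ _ _ _ _ f) => //.
  - by move=> n; case: (au n) => /L2_measurable.
  - apply: aeW => x.
    have /choice[k hk] : forall i : 'I_m, exists k, W k (tnth x i) by move=> i; exact: covW.
    rewrite -[X in _ --> X]mulr1; apply: cvgM; first exact: gf.
    apply: cvg_near_cst; exists (\max_(i < m) (k i).+1)%N => // n /= kn.
    rewrite indicE mem_set// => i; exists (k i) => //=.
    by apply: leq_trans kn; exact: (leq_bigmax i).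
  - move=> n x; rewrite /u ger0_norm ?mulr_ge0//.
    by rewrite -[leRHS]mulr1; apply: ler_pM => //; rewrite indicE; case: (_ \in _).
apply: approx_lim => // e e0.
have /cvgrPdist_lt/(_ _ e0)[n _ /(_ n (leqnn n))/=] := uf.
rewrite sub0r normrN ger0_norm ?norm2_ge0// norm2BC => un.
by exists (u n).
Qed.

Lemma approx_L2 m (f : m.-tuple T -> R) : L2 (pm m) f -> approx f.
Proof.
move=> fL; have mf := L2_measurable fL.
have nL : L2 (pm m) (fun x => `|f x|).
  apply/L2P; split; first exact: measurableT_comp.
  rewrite (_ : sqint _ _ = sqint (pm m) f); first by case: ((L2P _ f).1 fL).
  by apply: eq_integral => x _; rewrite real_normK ?num_real.
rewrite (_ : f = fun x => 2^-1 * (`|f x| + f x) + (- 2^-1) * (`|f x| - f x)); last first.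
  by apply/funext => x; field.
apply: approxD; apply: approxZ; apply: approx_ge0.
- exact: L2D.
- by move=> x; rewrite -lerBlDr sub0r -normrN ler_norm.
- exact: L2B.
- by move=> x; rewrite subr_ge0 ler_norm.
Qed.

(** The counterpart of [symmetrize] for words of length m; words of other lengths get the harmless
    value 0. *)
Definition sym_words n m (F : seq (code n) -> R) (s : seq (code n)) : R :=
  if insub s is Some b then
    m`!%:R^-1 * \sum_(w : 'S_m) F [tuple tnth (b : m.-tuple (code n)) (w i) | i < m]
  else 0.

Lemma perm_eq_mktuple (X : eqType) m (w : 'S_m) (b : m.-tuple X) :
  perm_eq [tuple tnth b (w i) | i < m] b.
Proof. by apply/tuple_permP; exists w. Qed.

Lemma cell_function_sym_words n m (F : seq (code n) -> R) : offdiag F ->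
  cell_function (sym_words m F).
Proof.
move=> [uF gF]; split => s.
- move=> t st; rewrite /sym_words; case: insubP => [b _ bs|]; last first.
    by rewrite (perm_size st); case: insubP => // b ->.
  case: insubP => [c _ ct|]; last first.
    by rewrite -(perm_size st) -bs size_tuple eqxx.
  congr (_ * _); move: st; rewrite -bs -ct => /tuple_permP[u bE].
  rewrite [RHS](reindex_inj (mulIg u))/=; apply: eq_bigr => w _; congr F.
  apply: eq_map => i; rewrite permM.
  have /val_inj -> : val b = val [tuple tnth c (u i) | i < m] by exact: bE.
  by rewrite tnth_mktuple.
- move=> us; rewrite /sym_words; case: insubP => [b _ bs|//].
  rewrite big1 ?mulr0// => w _; apply: uF.
  by rewrite (perm_uniq (perm_eq_mktuple w b)) [tval b]bs.
- move=> us; rewrite /sym_words; case: insubP => [b _ bs|//].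
  rewrite big1 ?mulr0// => w _; apply: gF.
  by rewrite (perm_all _ (perm_eq_mktuple w b)) [tval b]bs.
Qed.

Lemma lift_sym_words n m (F : seq (code n) -> R) :
  lift W (sym_words m F) (k := m) = symmetrize (lift W F (k := m)).
Proof.
apply/funext => x; rewrite /lift /symmetrize /sym_words.
case: insubP => [b _ bs|]; last by rewrite size_map size_tuple eqxx.
congr (_ * _); apply: eq_bigr => w _; congr F.
have -> : b = map_tuple (sig W n) x by apply: val_inj.
rewrite /= -map_comp; apply: eq_map => i /=.
by rewrite tnth_map.
Qed.

Lemma density m (f : m.-tuple T -> R) e : L2s nu f -> 0 < e ->
  exists n (F : seq (code n) -> R), cell_function F /\
    norm2 (pm m) (fun x => f x - lift W F x) < e.
Proof.
move=> fL e0; have [_ /(_ _ e0)[n [F [oF fF]]]] := approx_L2 (L2s_L2 fL).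
exists n, (sym_words m F); split; first exact: cell_function_sym_words.
rewrite lift_sym_words; apply: le_lt_trans fF.
by apply: norm2_sym_le => //; exact: L2_offdiag.
Qed.

End density.

(** * Contractions *)

Section selections.
Context (d : measure_display) (T : measurableType d) (R : realType).
Variable nu : {sigma_finite_measure set T -> \bar R}.
Local Notation pm := (power_measure nu).

Lemma eval_seqE m (f : m.-tuple T -> R) (s : m.-tuple T) : eval_seq f s = f s.
Proof. by rewrite /eval_seq valK. Qed.

(** The arguments of a contraction are lists cut out by [take] and [drop]; measurability becomes
    visible once they are exhibited as coordinate selections [h]. *)
Lemma measurable_eval_seq n q (h : 'I_q -> 'I_n) (g : n.-tuple T -> seq T)
    (f : q.-tuple T -> R) : measurable_fun [set: q.-tuple T] f ->
  (forall x, g x = [tuple tnth x (h i) | i < q]) ->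
  measurable_fun [set: n.-tuple T] (fun x => eval_seq f (g x)).
Proof.
move=> mf gh; rewrite (_ : (fun x => _) = f \o (fun x : n.-tuple T => [tuple tnth x (h i) | i < q])).
  apply: measurableT_comp => //; apply/measurable_fun_tnthP => i.
  rewrite (_ : _ \o _ = @tnth n T ^~ (h i)); first exact: measurable_tnth.
  by apply/funext => x; exact: tnth_mktuple.
by apply/funext => x; rewrite gh eval_seqE.
Qed.

Lemma nth_select q n (h : 'I_q -> 'I_n) (x : n.-tuple T) (s : seq T) :
  size s = q -> (forall i : 'I_q, nth point s i = nth point x (h i)) ->
  s = [tuple tnth x (h i) | i < q].
Proof.
move=> sq sh; apply: (@eq_from_nth _ point); first by rewrite sq size_tuple.
move=> i; rewrite sq => iq; rewrite -[i]/(nat_of_ord (Ordinal iq)) sh.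
by rewrite -!tnth_nth tnth_mktuple.
Qed.

Lemma measurable_prod_tuple n k (h : 'I_k -> 'I_n) (g : n.-tuple T -> seq T)
    (psi : T -> R) : measurable_fun setT psi ->
  (forall x, g x = [tuple tnth x (h i) | i < k]) ->
  measurable_fun [set: n.-tuple T] (fun x => \prod_(y <- g x) psi y).
Proof.
move=> mpsi gh.
rewrite (_ : (fun x => _) = (fun x : n.-tuple T => \prod_(i < k) psi (tnth x (h i)))).
  apply: measurable_prod => i _; apply: (measurableT_comp mpsi).
  exact: measurable_tnth.
by apply/funext => x; rewrite gh big_tuple; apply: eq_bigr => i _; rewrite tnth_mktuple.
Qed.

Lemma take_select q m (x : (q + m).-tuple T) :
  take q x = [tuple tnth x (lshift m i) | i < q].
Proof.
apply: nth_select; first by rewrite size_takel// size_tuple leq_addr.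
by move=> i; rewrite nth_take.
Qed.

Lemma drop_select q m (x : (q + m).-tuple T) :
  drop q x = [tuple tnth x (rshift q i) | i < m].
Proof.
apply: nth_select; first by rewrite size_drop size_tuple addKn.
by move=> i; rewrite nth_drop.
Qed.

Variables (phi : T -> R) (C : set T).
Hypothesis mphi : measurable_fun setT phi.
Hypothesis fC : finite_sets nu C.
Hypothesis phiC : forall y, `|phi y| <= \1_C y.

Let cC : R := fine (nu C).

Lemma ge0_integral_take_drop q m (f : q.-tuple T -> R) :
  measurable_fun [set: q.-tuple T] f ->
  (\int[pm (q + m)]_x (eval_seq f (take q x) ^+ 2 * \prod_(y <- drop q x) \1_C y)%:E =
   sqint (pm q) f * (cC ^+ m)%:E)%E.
Proof.
move=> mf; have [mC _] := fC.
pose h (y : q.-tuple T) : \bar R := (f y ^+ 2)%:E.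
pose k (z : m.-tuple T) : \bar R := (\prod_(y <- z) \1_C y)%:E.
have mh : measurable_fun [set: q.-tuple T] h.
  by apply/measurable_EFinP/measurable_funX.
have kE z : k z = (\1_(rect (fun=> C)) z)%:E.
  congr (_%:E); rewrite [RHS]indicE; case: (boolP (_ \in _)) => [|].
    rewrite inE => hz; rewrite big_seq big1// => y yz.
    by have /tnthP[i ->] := yz; rewrite indicE mem_set//; exact: hz.
  rewrite notin_setE => /existsNP[i hi]; rewrite big_tuple (bigD1 i)//=.
  by rewrite indicE memNset// mul0r.
have mk : measurable_fun [set: m.-tuple T] k.
  rewrite (_ : k = EFin \o \1_(rect (fun=> C))); last by apply/funext => z; rewrite kE.
  by apply/measurable_EFinP; apply: measurable_indic; apply: measurable_rect => i.
have k0 z : (0 <= k z)%E by rewrite kE lee_fin.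
have ik : (\int[pm m]_z k z = (cC ^+ m)%:E)%E.
  under eq_integral do rewrite kE.
  rewrite integral_indic//; last exact: measurable_rect.
  transitivity (pm m (rect (fun _ : 'I_m => C))); first by rewrite setIT.
  rewrite power_measure_rect// (eq_bigr (fun=> cC%:E)) => [|i _].
    by rewrite prodEFin prodr_const card_ord.
  exact: fine_nuE.
have tE (z : q.-tuple T * m.-tuple T) : ((eval_seq f (take q (tcat z)) ^+ 2 *
    \prod_(y <- drop q (tcat z)) \1_C y)%:E = h z.1 * k z.2)%E.
  rewrite /tcat/= take_size_cat ?size_tuple// drop_size_cat ?size_tuple//.
  by rewrite eval_seqE EFinM.
have mhk : measurable_fun [set: q.-tuple T * m.-tuple T] (fun z => (h z.1 * k z.2)%E).
  by apply: emeasurable_funM; [exact: measurableT_comp|exact: measurableT_comp].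
rewrite ge0_integral_tcat; last 2 first.
- apply/measurable_EFinP; apply: measurable_funM.
    by apply: measurable_funX; apply: (measurable_eval_seq mf) => x; exact: take_select.
  apply: measurable_prod_tuple; first exact: measurable_indic.
  by move=> x; exact: drop_select.
- move=> x; rewrite lee_fin mulr_ge0 ?sqr_ge0// prodr_ge0//.
under eq_integral do rewrite tE.
rewrite fubini_tonelli1//=; last by move=> z; rewrite mule_ge0// lee_fin sqr_ge0.
rewrite /fubini_F/=.
under eq_integral do rewrite ge0_integralZl_EFin ?sqr_ge0// ik.
rewrite ge0_integralZr//.
  by move=> y _; rewrite lee_fin sqr_ge0.
by rewrite lee_fin exprn_ge0// fine_ge0.
Qed.

Lemma prod_indic_idem (s : seq T) :
  (\prod_(y <- s) \1_C y : R) ^+ 2 = \prod_(y <- s) \1_C y.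
Proof.
rewrite -prodrXl; apply: eq_bigr => y _.
by rewrite indicE; case: (_ \in _); rewrite ?expr1n ?expr0n.
Qed.

Lemma norm_prod_le (s : seq T) : `|\prod_(y <- s) phi y| <= \prod_(y <- s) \1_C y.
Proof. by rewrite normr_prod; apply: ler_prod => y _; rewrite normr_ge0/=. Qed.

Lemma prod_indic_le1 (s : seq T) : (\prod_(y <- s) \1_C y : R) <= 1.
Proof.
by apply: prodr_ile1 => y _; rewrite indicE; case: (_ \in _); rewrite ?ler01 ?lexx.
Qed.

(** After the permutation [w], [f] sees the first q coordinates and the other m are confined to [C]
    by [psi]; Tonelli then gives the factor nu(C)^m for the squared norm. *)
Lemma L2_select n q m (w : 'S_n) (f : q.-tuple T -> R) (psi : n.-tuple T -> R) :
  n = (q + m)%N -> L2 (pm q) f -> measurable_fun [set: n.-tuple T] psi ->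
  (forall x, `|psi x| <= \prod_(y <- drop q (permute w x)) \1_C y) ->
  L2 (pm n) (fun x => eval_seq f (take q (permute w x)) * psi x) /\
  norm2 (pm n) (fun x => eval_seq f (take q (permute w x)) * psi x) <=
    norm2 (pm q) f * (1 + cC ^+ m).
Proof.
move=> nE fL; subst n => mpsi psile; have mf := L2_measurable fL; have [mC _] := fC.
have K0 : 0 <= cC ^+ m by rewrite exprn_ge0// fine_ge0.
pose h (x : (q + m).-tuple T) : R := eval_seq f (take q x).
have mh : measurable_fun [set: (q + m).-tuple T] h.
  by apply: (measurable_eval_seq mf) => x; exact: take_select.
have mU : measurable_fun [set: (q + m).-tuple T] (fun x => h (permute w x) * psi x).
  apply: measurable_funM => //; apply: (measurableT_comp mh); exact: measurable_permute.
have mG : measurable_fun [set: (q + m).-tuple T] (fun x : (q + m).-tuple T =>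
    (h x ^+ 2 * \prod_(y <- drop q x) \1_C y)%:E).
  apply/measurable_EFinP; apply: measurable_funM; first exact: measurable_funX.
  by apply: measurable_prod_tuple; [exact: measurable_indic|exact: drop_select].
have G0 (x : (q + m).-tuple T) : (0 <= (h x ^+ 2 * \prod_(y <- drop q x) \1_C y)%:E)%E.
  by rewrite lee_fin mulr_ge0 ?sqr_ge0// prodr_ge0.
have le1 : (sqint (pm (q + m)) (fun x => (h (permute w x) * psi x)%R) <= sqint (pm q) f * (cC ^+ m)%:E)%E.
  rewrite -ge0_integral_take_drop// -[leRHS](ge0_integral_permute nu w)//.
  apply: ge0_le_integral => //.
  - by move=> x _; rewrite lee_fin sqr_ge0.
  - by apply/measurable_EFinP; exact: measurable_funX.
  - by apply: (measurableT_comp mG); exact: measurable_permute.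
  move=> x _; rewrite lee_fin exprMn; apply: ler_wpM2l; first exact: sqr_ge0.
  by rewrite -prod_indic_idem -[leLHS]real_normK ?num_real// ler_pXn2r ?nnegrE// prodr_ge0.
have UL : L2 (pm (q + m)) (fun x => h (permute w x) * psi x).
  apply/L2P; split=> //; apply: le_lt_trans le1 _.
  by rewrite L2_sqint// -EFinM ltry.
split=> //; apply: norm2_le => //; first by rewrite mulr_ge0 ?norm2_ge0// addr_ge0.
(* The inequality K <= (1 + K)^2 spares the square root of K = nu(C)^m. *)
apply: le_trans le1 _; rewrite L2_sqint// -EFinM lee_fin exprMn.
by apply: ler_wpM2l; [exact: sqr_ge0|nra].
Qed.

(** * The bilinear form dual to a contraction *)

Section bilinear_form.
Variables (p q r l : nat).
Hypotheses (rp : (r <= p)%N) (rq : (r <= q)%N) (lr : (l <= r)%N).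
Let n := (p + q - r)%N.

(** The weights [phi] of the coordinates from [l] on are shared between [formU] and [formV] so that
    each factor is weighted on all coordinates its own function does not see. Both are then in L2,
    and the form is continuous in f and g. *)
Definition formU (f : p.-tuple T -> R) (x : n.-tuple T) : R :=
  eval_seq f (take p x) * \prod_(y <- drop p x) phi y.

Definition formV (g : q.-tuple T -> R) (x : n.-tuple T) : R :=
  eval_seq g (take r x ++ drop p x) * \prod_(y <- take (p - l) (drop l x)) phi y.

Definition contraction_form f g := \int[pm n]_x (formU f x * formV g x).

Lemma formUV (f : p.-tuple T -> R) (g : q.-tuple T -> R) x :
  formU f x * formV g x =
  eval_seq f (take p x) * eval_seq g (take r x ++ drop p x) * \prod_(y <- drop l x) phi y.
Proof.
rewrite /formU /formV -[in RHS](cat_take_drop (p - l) (drop l x)) big_cat/=.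
rewrite drop_drop subnK; last exact: leq_trans rp.
by ring.
Qed.

Lemma formU_lin a (f g : p.-tuple T -> R) x :
  formU (fun y => f y - a * g y) x = formU f x - a * formU g x.
Proof.
rewrite /formU /eval_seq; case: insubP => [b _ _|_]; ring.
Qed.

Lemma formV_lin a (f g : q.-tuple T -> R) x :
  formV (fun y => f y - a * g y) x = formV f x - a * formV g x.
Proof.
rewrite /formV /eval_seq; case: insubP => [b _ _|_]; ring.
Qed.

(** Brings the coordinates seen by [g], the first r and those from p on, to the front, as
    [L2_select] wants them. *)
Let swapv (i : nat) : nat :=
  if (i < r)%N then i else if (i < q)%N then (p + (i - r))%N else (r + (i - q))%N.

Let swapf (i : 'I_n) : 'I_n := insubd i (swapv i).

Let swapfE i : swapf i = swapv i :> nat.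
Proof.
rewrite /swapf val_insubd; case: ifP => // /negbT; rewrite -leqNgt /swapv.
have := ltn_ord i; rewrite /n; case: ifP; [lia|case: ifP]; lia.
Qed.

Let swapf_inj : injective swapf.
Proof.
move=> i j /(congr1 val) /=; rewrite !swapfE /swapv => h; apply: val_inj => /=.
have hi : (i < p + q - r)%N := ltn_ord i; have hj : (j < p + q - r)%N := ltn_ord j.
by move: h; repeat (case: ltnP => ?); lia.
Qed.

Let swap : 'S_n := perm swapf_inj.

Let take_swap (x : n.-tuple T) : take q (permute swap x) = take r x ++ drop p x.
Proof.
have qn : (q <= n)%N by rewrite /n; lia.
apply: (@eq_from_nth _ point).
  by rewrite size_cat !size_takel ?size_drop ?size_tuple//; rewrite /n; lia.
move=> i; rewrite size_takel ?size_tuple// => iq; rewrite nth_take//.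
have iN : (i < n)%N by apply: leq_trans qn.
rewrite -[i]/(nat_of_ord (Ordinal iN)) -tnth_nth tnth_mktuple permE (tnth_nth point) swapfE /swapv/=.
rewrite nth_cat size_takel ?size_tuple; last by rewrite /n; lia.
case: ltnP => ir; first by rewrite nth_take.
by rewrite iq nth_drop.
Qed.

Let drop_swap (x : n.-tuple T) : drop q (permute swap x) = take (p - r) (drop r x).
Proof.
have qn : (q <= n)%N by rewrite /n; lia.
apply: (@eq_from_nth _ point).
  by rewrite size_drop size_takel ?size_drop ?size_tuple; rewrite /n; lia.
move=> i; rewrite size_drop size_tuple => iq; rewrite nth_drop.
have iN : (q + i < n)%N by lia.
rewrite -[(q + i)%N]/(nat_of_ord (Ordinal iN)) -tnth_nth tnth_mktuple permE (tnth_nth point) swapfE /swapv/=.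
rewrite ltnNge (leq_trans rq) ?leq_addr//= ltnNge leq_addr/= addKn.
rewrite nth_take ?nth_drop//; move: iN; rewrite /n; lia.
Qed.

Lemma permute1 (k : nat) (x : k.-tuple T) : permute 1%g x = x.
Proof. by apply: eq_from_tnth => i; rewrite tnth_mktuple perm1. Qed.

Lemma formU_bound f : L2 (pm p) f -> L2 (pm n) (formU f) /\
  norm2 (pm n) (formU f) <= norm2 (pm p) f * (1 + cC ^+ (q - r)).
Proof.
move=> fL; have nE : n = (p + (q - r))%N by rewrite /n; lia.
have := @L2_select n p (q - r) 1%g f (fun x => \prod_(y <- drop p x) phi y) nE fL.
rewrite (_ : (fun x : n.-tuple T => eval_seq f (take p (permute 1%g x)) *
    \prod_(y <- drop p x) phi y) = formU f); last first.
  by apply/funext => x; rewrite permute1.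
apply; last by move=> x; rewrite permute1; exact: norm_prod_le.
pose h (i : 'I_(q - r)) : 'I_n := cast_ord (esym nE) (rshift p i).
apply: (@measurable_prod_tuple _ _ h) => // x; apply: nth_select.
  by rewrite size_drop size_tuple nE addKn.
by move=> i; rewrite nth_drop.
Qed.

Lemma formV_bound g : L2 (pm q) g -> L2 (pm n) (formV g) /\
  norm2 (pm n) (formV g) <= norm2 (pm q) g * (1 + cC ^+ (p - r)).
Proof.
move=> gL; have nE : n = (q + (p - r))%N by rewrite /n; lia.
have := @L2_select n q (p - r) swap g (fun x => \prod_(y <- take (p - l) (drop l x)) phi y) nE gL.
rewrite (_ : (fun x : n.-tuple T => eval_seq g (take q (permute swap x)) *
    \prod_(y <- take (p - l) (drop l x)) phi y) = formV g); last first.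
  by apply/funext => x; rewrite take_swap.
have ln i : (i < p - l)%N -> (l + i < n)%N by rewrite /n; lia.
apply.
  pose h (i : 'I_(p - l)) : 'I_n := Ordinal (ln i (ltn_ord i)).
  apply: (@measurable_prod_tuple _ _ h) => // x; apply: nth_select.
    by rewrite size_takel// size_drop size_tuple; rewrite /n; lia.
  by move=> i; rewrite nth_take// nth_drop.
move=> x; rewrite drop_swap; apply: le_trans (norm_prod_le _) _.
(* The first r - l weights sit on coordinates that [g] also sees; they are merely bounded by 1. *)
rewrite (_ : (p - l = (r - l) + (p - r))%N); last lia.
rewrite takeD big_cat/= drop_drop subnK// -[leRHS]mul1r.
by apply: ler_wpM2r; [rewrite prodr_ge0|exact: prod_indic_le1].
Qed.

Lemma contraction_form_integrable f g : L2 (pm p) f -> L2 (pm q) g ->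
  (pm n).-integrable setT (fun x => (formU f x * formV g x)%:E).
Proof. by move=> fL gL; apply: L2_mul_integrable; [case: (formU_bound fL)|case: (formV_bound gL)]. Qed.

Definition star_integrand (f : p.-tuple T -> R) (g : q.-tuple T -> R) (z x : seq T) : R :=
  eval_seq f (z ++ take (r - l) x ++ take (p - r) (drop (r - l) x)) *
  eval_seq g (z ++ take (r - l) x ++ drop (p - l) x).

(** Defined on lists, so that the same integrand can be read on tuples of length p + q - r and of
    length l + (p + q - r - l), two types that are not convertible. *)
Let Psi (f : p.-tuple T -> R) (g : q.-tuple T -> R) (s : seq T) : R := eval_seq f (take p s) * eval_seq g (take r s ++ drop p s) *
  \prod_(y <- drop l s) phi y.

Let PsiE f g (z : l.-tuple T) (x : (p + q - r - l).-tuple T) :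
  Psi f g (tcat (z, x)) = star_integrand f g z x * \prod_(y <- x) phi y.
Proof.
rewrite /Psi /star_integrand /tcat/=.
have h1 : (p < l)%N = false by lia.
have h2 : (r < l)%N = false by lia.
rewrite !take_cat !drop_cat size_tuple h1 h2 ltnn subnn drop0 -takeD -catA.
by (rewrite (_ : (r - l + (p - r) = p - l)%N); last lia).
Qed.

Let integrable_Psi f g : L2 (pm p) f -> L2 (pm q) g ->
  (pm (l + (p + q - r - l))).-integrable setT (fun x => (Psi f g x)%:E) /\
  contraction_form f g = \int[pm (l + (p + q - r - l))]_x Psi f g x.
Proof.
move=> fL gL; have ifg := contraction_form_integrable fL gL.
have nE : n = (l + (p + q - r - l))%N by rewrite /n; lia.
have -> : contraction_form f g = \int[pm n]_x Psi f g x.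
  by apply: eq_Rintegral => x _; exact: formUV.
have {}ifg : (pm n).-integrable setT (fun x : n.-tuple T => (Psi f g x)%:E).
  by rewrite (_ : (fun x => _) = (fun x => (formU f x * formV g x)%:E))//; apply/funext => x; rewrite formUV.
have E k : n = k -> (pm k).-integrable setT (fun x : k.-tuple T => (Psi f g x)%:E) /\
    \int[pm n]_x Psi f g x = \int[pm k]_x Psi f g x by move=> <-.
exact: E.
Qed.

Lemma star_integrable f g : L2 (pm p) f -> L2 (pm q) g ->
  (pm l \x pm (p + q - r - l))%E.-integrable setT
    (fun z => (star_integrand f g z.1 z.2 * \prod_(y <- z.2) phi y)%:E).
Proof.
move=> fL gL; have [iPsi _] := integrable_Psi fL gL; have mPsi := measurable_int _ iPsi.
rewrite (_ : (fun z => _) = (fun z => (Psi f g (tcat z))%:E)); last first.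
  by apply/funext => -[z x]; rewrite PsiE.
have mPsi2 : measurable_fun [set: l.-tuple T * (p + q - r - l).-tuple T] (fun z => (Psi f g (tcat z))%:E).
  exact: (measurableT_comp mPsi (@measurable_tcat _ T l (p + q - r - l))).
apply/integrableP; split=> //.
rewrite -(@ge0_integral_tcat _ _ _ nu l (p + q - r - l) (fun x => `|(Psi f g x)%:E|%E))//.
  by case/integrableP: iPsi.
exact: measurableT_comp.
Qed.

(** Fubini: the first l coordinates carry no weight [phi], and integrating over them yields the
    contraction. *)
Lemma contraction_formE f g : L2 (pm p) f -> L2 (pm q) g ->
  measurable_fun [set: (p + q - r - l).-tuple T] (star_contraction nu f g r l) ->
  \int[pm (p + q - r - l)]_x (star_contraction nu f g r l x * \prod_(y <- x) phi y) =
  contraction_form f g.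
Proof.
move=> fL gL ms; have iS := star_integrable fL gL.
have [iPsi ->] := integrable_Psi fL gL; have mPsi := measurable_int _ iPsi.
rewrite /Rintegral; congr fine; rewrite (integral_tcat nu mPsi).
rewrite (_ : (fun z => _) = (fun z : l.-tuple T * (p + q - r - l).-tuple T =>
    (star_integrand f g z.1 z.2 * \prod_(y <- z.2) phi y)%:E)); last first.
  by apply/funext => -[z x]; rewrite PsiE.
rewrite -integral21_prod_meas1//; apply: ae_eq_integral => //.
- apply/measurable_EFinP; apply: measurable_funM => //.
  apply: (@measurable_prod_tuple _ _ id) => // x; apply: nth_select => //.
  exact: size_tuple.
- exact: (measurable_fubini_G iS).
have := ae_integrable2 iS; apply: filterS => x ix _.
(* Fubini controls the integrand only together with its weight. Where the weight is zero both sides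
   vanish, whether or not the integral defining the contraction converges; elsewhere one divides by
   it. *)
rewrite /fubini_G; have [Phi0|Phi0] := eqVneq (\prod_(y <- x) phi y) 0.
  rewrite Phi0 mulr0 (_ : (fun z : l.-tuple T => _) = cst 0%E) ?integral0//.
  by apply/funext => z; rewrite /= mulr0.
have ia : (pm l).-integrable setT (EFin \o (fun z : l.-tuple T => star_integrand f g z x)).
  rewrite (_ : EFin \o _ = (fun z : l.-tuple T => ((\prod_(y <- x) phi y)^-1)%:E *
      (star_integrand f g z x * \prod_(y <- x) phi y)%:E)%E).
    exact: integrableZl.
  by apply/funext => z; rewrite /= -EFinM mulrCA mulVf ?mulr1.
under [RHS]eq_integral do rewrite /= mulrC EFinM.
rewrite integralZl// [LHS]EFinM muleC; congr (_ * _)%E.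
rewrite /star_contraction /Rintegral fineK//; exact: (integrable_fin_num measurableT ia).
Qed.

End bilinear_form.

End selections.

(** * The test identity *)

Section empty_sets.
Context (d : measure_display) (T : measurableType d) (R : realType).
Context (d' : measure_display) (Omega : measurableType d').
Variable nu : {sigma_finite_measure set T -> \bar R}.
Variable P : probability Omega R.
Variable N : set T -> {RV P >-> R}.
Hypothesis HN : compensated_poisson nu N.

Definition empty_set B (o : Omega) : R := \1_[set - fine (nu B)] (N B o).

Lemma empty_setE B o : empty_set B o = (N B o + fine (nu B) == 0)%:R.
Proof.
rewrite /empty_set indicE; congr ((nat_of_bool _)%:R).
by apply/idP/idP; rewrite inE/= addr_eq0 => /eqP.
Qed.

Lemma measurable_empty_set B : measurable_fun setT (empty_set B).
Proof. by apply: measurableT_comp => //; exact: measurable_indic. Qed.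

Lemma N_ge B : finite_sets nu B -> {ae P, forall o, 0 <= N B o + fine (nu B)}.
Proof.
move=> fB; exists (~` \bigcup_k level_set nu N B k); split.
- by apply: measurableC; apply: bigcupT_measurable => k; exact: measurable_level_set.
- exact: bigcup_level_set.
- apply: subsetC => o [k _]; rewrite /level_set/= => ->; rewrite subrK; exact: ler0n.
Qed.

(** Almost surely the number of points in [A] is the sum of the numbers in the [B i]; being
    nonnegative, they have sum zero only if all are zero. *)
Lemma empty_set_prod (I : finType) (S : pred I) (A : set T) (B : I -> set T) :
  finite_sets nu A -> (forall i, finite_sets nu (B i)) -> trivIset setT B ->
  A = \bigcup_(i in [set i | S i]) B i ->
  empty_set A = (fun o => \prod_(i | S i) empty_set (B i) o) %[ae P].
Proof.
move=> fA fB tB AE; have nE : fine (nu A) = \sum_(i | S i) fine (nu (B i)).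
  rewrite AE measure_cells//; last by move=> i; case: (fB i).
  by rewrite (eq_bigr _ (fun i _ => fine_nuE (fB i))) sumEFin.
have := N_sum HN fA fB tB AE.
have : {ae P, forall o i, 0 <= N (B i) o + fine (nu (B i))}.
  by apply: filter_forall => i; exact: N_ge.
apply: filterS2 => o Bo NA _; rewrite empty_setE NA// nE -big_split/=.
rewrite (eq_bigr _ (fun i _ => empty_setE (B i) o)) psumr_eq0// -big_all.
rewrite (big_morph (fun b : bool => b%:R : R) (id1 := 1) (op1 := *%R) (id2 := true) (op2 := andb))//.
  by rewrite [LHS]big_mkcond [RHS]big_mkcond/=; apply: eq_bigr => i _; case: (S i).
by case=> [] []; rewrite ?mulr1 ?mulr0 ?mul0r.
Qed.

Section void_bounds.
Context (X : finType) (D : X -> set T).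

Lemma voidE (S : pred X) o : void nu N D S o = \prod_(x | S x) empty_set (D x) o.
Proof. by []. Qed.

Lemma measurable_void (S : pred X) : measurable_fun setT (void nu N D S).
Proof.
rewrite (_ : void nu N D S = fun o => \prod_(x <- [seq x <- index_enum X | S x]) empty_set (D x) o).
  by apply: measurable_prod => x _; exact: measurable_empty_set.
by apply/funext => o; rewrite big_filter.
Qed.

Lemma void01 (S : pred X) o : 0 <= void nu N D S o <= 1.
Proof.
rewrite voidE; apply/andP; split.
  by apply: prodr_ge0 => x _; rewrite empty_setE ler0n.
by apply: prodr_ile1 => x _; rewrite empty_setE; case: eqP => _; rewrite ?ler01 ?lexx.
Qed.

End void_bounds.

End empty_sets.

Section void_levels.
Context (d : measure_display) (T : measurableType d) (R : realType).
Variable nu : {sigma_finite_measure set T -> \bar R}.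
Variable W : nat -> set T.
Hypothesis fW : forall i, finite_sets nu (W i).
Context (d' : measure_display) (Omega : measurableType d').
Variable P : probability Omega R.
Variable N : set T -> {RV P >-> R}.
Hypothesis HN : compensated_poisson nu N.

(** [S] stays at level k while the approximants of f and g live at finer levels. The codes in [S]
    are good because the empty cell of the all-false code has nonempty refinements. *)
Lemma void_restr k n (kn : (k <= n)%N) (S : pred (code k)) :
  (forall s, S s -> good s) ->
  void nu N (cell W (n := k)) S = void nu N (cell W (n := n)) (S \o restr kn) %[ae P].
Proof.
move=> gS.
have : {ae P, forall o, forall s, S s -> empty_set nu N (cell W s) o =
    \prod_(t | restr kn t == s) empty_set nu N (cell W t) o}.
  apply: filter_forall => s; have [Ss|nSs] := boolP (S s); last exact: aeW.
  have := empty_set_prod HN (S := fun t => restr kn t == s) (finite_cell fW s)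
    (fun t => finite_cell fW t) (@trivIset_cell _ _ W n) (cell_restr W kn (gS _ Ss)).
  by apply: filterS => o /= h _; exact: h.
apply: filterS => o /= h _; rewrite !voidE (eq_bigr _ h).
rewrite [RHS](partition_big (restr kn) S)//; apply: eq_bigr => s Ss.
by apply: eq_bigl => t /=; case: eqP => [->|]; rewrite ?Ss ?andbF.
Qed.

End void_levels.

(** * Multiple integrals of every order, zero included *)

Section chaos.
Context (d : measure_display) (T : measurableType d) (R : realType).
Context (d' : measure_display) (Omega : measurableType d').
Variable nu : {sigma_finite_measure set T -> \bar R}.
Variable P : probability Omega R.
Variable N : set T -> {RV P >-> R}.
Local Notation pm := (power_measure nu).

Lemma multiple_integral_cvg m (J : (m.-tuple T -> R) -> Omega -> R)
    (u : nat -> m.-tuple T -> R) f :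
  multiple_integral nu N J -> (forall j, L2s nu (u j)) -> L2s nu f ->
  norm2 (pm m) (fun x => u j x - f x) @[j --> \oo] --> 0 ->
  norm2 P (fun o => J (u j) o - J f o) @[j --> \oo] --> 0.
Proof.
move=> [JL _ Jc _] uL fL /cvgrPdist_lt cuf; apply/cvgrPdist_lt => e e0.
have [del del0 h] := Jc f fL e e0; near=> j.
rewrite sub0r normrN ger0_norm ?norm2_ge0// -lte_fin -L2_fin; last first.
  by apply: L2B; exact: JL.
apply: h => //; rewrite L2_fin; last by apply: L2B; exact: L2s_L2.
rewrite lte_fin -[ltLHS]ger0_norm ?norm2_ge0// -normrN -sub0r.
by near: j; exact: cuf.
Unshelve. all: by end_near. Qed.

Variable I : forall m : nat, (m.-tuple T -> R) -> Omega -> R.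

(* [I 0] is only constrained on constants almost everywhere. *)
Definition chaos m : (m.-tuple T -> R) -> Omega -> R :=
  match m with 0 => fun h _ => h [tuple] | m'.+1 => @I m'.+1 end.

Hypothesis HI : wiener_ito nu N I.

Lemma chaosE m (h : m.-tuple T -> R) : I h = chaos h %[ae P].
Proof.
case: m h => [|m] h; last exact: aeW.
have [h0 _] := HI; rewrite (_ : h = fun=> h [tuple]); first exact: h0.
by apply/funext => x; rewrite tuple0.
Qed.

Lemma norm2_cst (c : R) : L2 P (fun=> c) /\ norm2 P (fun=> c) = `|c|.
Proof.
have E : sqint P (fun=> c) = (`|c| ^+ 2)%:E.
  rewrite /sqint (_ : (fun x => _) = cst (`|c| ^+ 2)%:E) ?integral_cst//.
    by transitivity ((`|c| ^+ 2)%:E * P setT)%E => //; rewrite probability_setT mule1.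
  by apply/funext => x; rewrite real_normK ?num_real.
have cL : L2 P (fun=> c) by apply/L2P; split; [exact: measurable_cst|rewrite E ltry].
split=> //; apply/eqP; rewrite -(@eqrXn2 _ 2)// ?norm2_ge0//.
by rewrite -eqe -L2_sqint// E.
Qed.

Lemma norm2_pm0 (h : 0.-tuple T -> R) : L2 (pm 0) h -> norm2 (pm 0) h = `|h [tuple]|.
Proof.
move=> hL; apply/eqP; rewrite -(@eqrXn2 _ 2)// ?norm2_ge0//.
rewrite -eqe -L2_sqint// /sqint/= integral_dirac//.
  by rewrite diracT mul1e real_normK ?num_real.
by apply/measurable_EFinP; apply: measurable_funX; exact: L2_measurable hL.
Qed.

(** With order 0 included, neither the constant term r = l = p = q nor the test with q = 0 needs a
    separate treatment. *)
Lemma multiple_integral_chaos m : multiple_integral nu N (@chaos m).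
Proof.
case: m => [|m]; last by case: HI => _; exact.
split.
- by move=> f _; exact: (norm2_cst _).1.
- by move=> a f g _ _; exact: aeW.
- move=> f fL e e0; exists e => // g gL.
  have gfL : L2 (pm 0) (fun x => g x - f x) by apply: L2B; exact: L2s_L2.
  rewrite (L2_fin gfL) norm2_pm0//= (L2_fin (norm2_cst (g [tuple] - f [tuple])).1).
  by rewrite (norm2_cst _).2.
- move=> C _; apply: aeW => o /= _; rewrite big_ord0 mulr1 indicE mem_set//.
  by exists 1%g => // -[].
Qed.

End chaos.

Lemma cvg_big_sum {R : realType} (J : finType) (s : seq J) (u : J -> nat -> R) (a : J -> R) :
  (forall i, u i n @[n --> \oo] --> a i) ->
  \sum_(i <- s) u i n @[n --> \oo] --> \sum_(i <- s) a i.
Proof.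
move=> ua; elim: s => [|i s IH].
  under eq_fun do rewrite big_nil; rewrite big_nil; exact: cvg_cst.
by under eq_fun do rewrite big_cons; rewrite big_cons; apply: cvgD.
Qed.

Lemma ae_eq_Rintegral d (T : measurableType d) (R : realType)
    (mu : {measure set T -> \bar R}) (f g : T -> R) :
  measurable_fun setT f -> measurable_fun setT g -> f = g %[ae mu] ->
  \int[mu]_x f x = \int[mu]_x g x.
Proof.
move=> mf mg fg; rewrite /Rintegral; congr fine; apply: ae_eq_integral => //.
- exact/measurable_EFinP.
- exact/measurable_EFinP.
- by apply: filterS fg => x /= h xT; rewrite h.
Qed.

Lemma norm2_mul_le1 d (T : measurableType d) (R : realType)
    (mu : {measure set T -> \bar R}) (f v : T -> R) :
  measurable_fun setT v -> (forall x, `|v x| <= 1) -> L2 mu f ->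
  L2 mu (fun x => f x * v x) /\ norm2 mu (fun x => f x * v x) <= norm2 mu f.
Proof.
move=> mv v1 fL; have mf := L2_measurable fL.
have le1 : (sqint mu (fun x => (f x * v x)%R) <= (norm2 mu f ^+ 2)%:E)%E.
  rewrite -L2_sqint//; apply: ge0_le_integral => //.
  - by move=> x _; rewrite lee_fin sqr_ge0.
  - by apply/measurable_EFinP; apply: measurable_funX; exact: measurable_funM.
  - by apply/measurable_EFinP; exact: measurable_funX.
  move=> x _; rewrite lee_fin exprMn ler_piMr ?sqr_ge0//.
  by rewrite -real_normK ?num_real// exprn_ile1.
have fvL : L2 mu (fun x => f x * v x).
  apply/L2P; split; first exact: measurable_funM.
  by apply: le_lt_trans le1 _; rewrite ltry.
by split=> //; apply: norm2_le => //; exact: norm2_ge0.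
Qed.

Lemma measurable_wsum d (T : measurableType d) (R : realType) (X : finType)
    (w : X -> T -> R) m H :
  (forall x, measurable_fun setT (w x)) -> measurable_fun setT (fun o => wsum (w ^~ o) m H).
Proof.
move=> mw; elim: m H => [|m IH] H /=; first exact: measurable_cst.
by apply: measurable_sum => x; apply: measurable_funM.
Qed.

(** The case p = q = 0 of [cells_product_formula], with [F] the indicator of the empty word. *)
Lemma Rintegral_void d (T : measurableType d) (R : realType)
    d' (Omega : measurableType d') (nu : {sigma_finite_measure set T -> \bar R})
    (W : nat -> set T) (P : probability Omega R) (N : set T -> {RV P >-> R})
    k (S : pred (code k)) :
  (forall i, finite_sets nu (W i)) -> compensated_poisson nu N ->
  \int[P]_o void nu N (cell W (n := k)) S o = expR (- \sum_(s | S s) cellm nu W s).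
Proof.
move=> fW HN; pose F (s : seq (code k)) : R := (size s == 0)%:R.
have pF : perm_inv F by move=> s t /perm_size st; rewrite /F st.
have uF s : ~~ uniq s -> F s = 0 by case: s.
have := cells_product_formula HN (fun t => finite_cell fW t) (@trivIset_cell _ _ W k) S 0 0 pF pF uF uF.
rewrite minnn !big_ord1/= big_nil /F/= !bin0 !mulr1.
by under eq_Rintegral do rewrite !mul1r.
Qed.

Section test_identity.
Context (d : measure_display) (T : measurableType d) (R : realType).
Variable nu : {sigma_finite_measure set T -> \bar R}.
Variable W : nat -> set T.
Hypothesis fW : forall i, finite_sets nu (W i).
Hypothesis sepW : forall x y, (forall i, W i x <-> W i y) -> x = y.
Hypothesis null1 : forall x, nu [set x] = 0%E.
Hypothesis genW : forall A, measurable A -> <<s range W >> A.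
Hypothesis covW : forall x, exists i, W i x.
Context (d' : measure_display) (Omega : measurableType d').
Variable P : probability Omega R.
Variable N : set T -> {RV P >-> R}.
Hypothesis HN : compensated_poisson nu N.
Local Notation pm := (power_measure nu).
Variables (k : nat) (S : pred (code k)).
Hypothesis gS : forall s, S s -> good s.

Definition void_weight (y : T) : R := - (S (sig W k y))%:R.
Let phi := void_weight.
Let V := void nu N (cell W (n := k)) S.

Lemma measurable_void_weight : measurable_fun setT phi.
Proof.
rewrite (_ : phi = fun y => - \sum_(s : code k) (S s)%:R * \1_[set x | sig W k x = s] y).
  apply: measurableT_comp => //; apply: measurable_sum => s; apply: measurable_funM => //.
  by apply: measurable_indic; exact: measurable_sig.
apply/funext => y; rewrite /phi /void_weight (bigD1 (sig W k y))//= big1 ?addr0; last first.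
  by move=> s sy; rewrite indicE memNset ?mulr0// => /= h; rewrite h eqxx in sy.
by rewrite indicE mem_set ?mulr1.
Qed.

Lemma void_weight_le y : `|phi y| <= \1_(base W k) y.
Proof.
rewrite /phi /void_weight normrN normr_nat; case Sy : (S _) => //.
rewrite indicE mem_set// -(@goodb_sig _ _ W k k)//.
by have /existsP[i si] := gS Sy; apply/existsP; exists i; rewrite ltn_ord.
Qed.

Lemma eval_seq_lift n (F : seq (code n) -> R) m (s : seq T) : size s = m ->
  eval_seq (lift W F (k := m)) s = F (map (sig W n) s).
Proof. by move=> sm; rewrite /eval_seq insubT ?sm// => e; rewrite /lift. Qed.

Section level.
Variables (p q n : nat) (kn : (k <= n)%N) (F G : seq (code n) -> R).
Hypotheses (cF : cell_function F) (cG : cell_function G).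

(** Identifies the sums produced by the formula on words with integrals that make sense for
    arbitrary f and g. *)
Lemma contraction_form_lift r l : (r <= p)%N -> (r <= q)%N -> (l <= r)%N ->
  contraction_form nu phi r l (lift W F (k := p)) (lift W G (k := q)) =
  wsum (cellm nu W (n := n)) (p + q - r) (fun c => F (take p c) * G (take r c ++ drop p c) *
    \prod_(x <- drop l c) - ((S \o restr kn) x)%:R).
Proof.
move=> rp rq lr; pose H c := F (take p c) * G (take r c ++ drop p c) *
    \prod_(x <- drop l c) - ((S \o restr kn) x)%:R : R.
have gH s : ~~ all (@good n) s -> H s = 0.
  rewrite -[s in all _ s](cat_take_drop p) all_cat negb_and /H => /orP[h|h].
    by rewrite (cell_function_good cF h) !mul0r.
  by rewrite (cell_function_good cG) ?mulr0 ?mul0r// all_cat negb_and h orbT.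
rewrite -(Rintegral_lift fW _ gH).2; apply: eq_Rintegral => x _.
rewrite formUV// !eval_seq_lift; first last.
- by rewrite size_takel// size_tuple; lia.
- by rewrite size_cat size_takel ?size_drop size_tuple; lia.
rewrite /lift /H map_cat !map_take !map_drop; congr (_ * _).
rewrite -map_drop big_map; apply: eq_bigr => y _.
by rewrite /phi /void_weight /= restr_sig.
Qed.

End level.

Definition test_rhs p q (f : p.-tuple T -> R) (g : q.-tuple T -> R) : R :=
  \sum_(r < (minn p q).+1) r`!%:R * 'C(p, r)%:R * 'C(q, r)%:R *
    \sum_(l < r.+1) 'C(r, l)%:R * contraction_form nu phi r l f g.

Lemma Rintegral_void_level n (kn : (k <= n)%N) :
  \int[P]_o V o = expR (- \sum_(s | (S \o restr kn) s) cellm nu W s).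
Proof.
rewrite -(Rintegral_void _ fW HN); apply: ae_eq_Rintegral.
- exact: measurable_void.
- exact: measurable_void.
- exact: void_restr.
Qed.

Definition level n m (f : m.-tuple T -> R) := exists2 F : seq (code n) -> R,
  cell_function F & f = lift W F (k := m).

Lemma level_le n n' m (f : m.-tuple T -> R) : (n <= n')%N -> level n f -> level n' f.
Proof. by move=> nn [F cF ->]; have [c E] := lift_restr W nn cF; exists (F \o map (restr nn)). Qed.

Section test.
Variables (p q : nat) (Jp : (p.-tuple T -> R) -> Omega -> R) (Jq : (q.-tuple T -> R) -> Omega -> R).
Hypotheses (HJp : multiple_integral nu N Jp) (HJq : multiple_integral nu N Jq).

Lemma test_level n (f : p.-tuple T -> R) (g : q.-tuple T -> R) : (k <= n)%N ->
  level n f -> level n g ->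
  \int[P]_o (Jp f o * Jq g o * V o) = (\int[P]_o V o) * test_rhs f g.
Proof.
move=> kn [F cF ->] [G cG ->]; rewrite (Rintegral_void_level kn).
have [pF uF gF] := cF; have [pG uG gG] := cG.
have := cells_product_formula HN (fun t => finite_cell fW t) (@trivIset_cell _ _ W n)
  (S \o restr kn) p q pF pG uF uG.
rewrite (_ : \int[P]_o (Jp _ o * _ * _) = \int[P]_o (wsum (fun x => N (cell W x) o) p F *
    wsum (fun x => N (cell W x) o) q G * void nu N (cell W (n := n)) (S \o restr kn) o)).
  move=> ->; congr (_ * _); rewrite /test_rhs.
  apply: eq_bigr => r _; congr (_ * _); apply: eq_bigr => l _; congr (_ * _).
  have := ltn_ord r; have := ltn_ord l; rewrite !ltnS leq_min => lr /andP[rp rq].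
  by rewrite contraction_form_lift.
apply: ae_eq_Rintegral.
- do 2?[apply: measurable_funM]; last exact: measurable_void.
  + by case: HJp => h _ _ _; apply: L2_measurable; apply: h; exact: L2s_lift.
  + by case: HJq => h _ _ _; apply: L2_measurable; apply: h; exact: L2s_lift.
- do 2?[apply: measurable_funM]; last exact: measurable_void.
  + by apply: measurable_wsum => x; exact: measurable_funPT.
  + by apply: measurable_wsum => x; exact: measurable_funPT.
have h1 := multiple_integral_lift fW HJp cF; have h2 := multiple_integral_lift fW HJq cG.
have h3 := void_restr fW HN kn gS; move: h1 h2 h3; apply: filterS3 => o /= a1 a2 a3 _.
by rewrite a1// a2// /V a3.
Qed.

Lemma level_L2s n m (f : m.-tuple T -> R) : level n f -> L2s nu f.
Proof. by move=> [F cF ->]; exact: L2s_lift. Qed.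

Lemma level_seq m (f : m.-tuple T -> R) : L2s nu f ->
  exists2 u : nat -> m.-tuple T -> R, (forall j, exists n, level n (u j)) &
    norm2 (pm m) (fun x => u j x - f x) @[j --> \oo] --> 0.
Proof.
move=> fL; have /choice[u hu] (j : nat) : exists v : m.-tuple T -> R, (exists n, level n v) /\
    norm2 (pm m) (fun x => v x - f x) < j.+1%:R^-1.
  have j0 : 0 < (j.+1%:R^-1 : R) by rewrite invr_gt0.
  have [n [F [cF Fj]]] := density fW sepW null1 genW covW fL j0.
  exists (lift W F (k := m)); split; first by exists n, F.
  by rewrite norm2BC.
exists u => [j|]; first by have [] := hu j.
apply: (@squeeze_cvgr _ _ _ _ (fun=> 0) (fun j => j.+1%:R^-1)).
- by near=> j; rewrite norm2_ge0 ltW//; have [] := hu j.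
- exact: cvg_cst.
- exact: cvg_harmonic.
Unshelve. all: by end_near. Qed.

Lemma normV_le1 o : `|V o| <= 1.
Proof. by have /andP[V0 V1] := void01 nu N (cell W (n := k)) S o; rewrite ger0_norm. Qed.

Lemma cvg_formU r l (u : nat -> p.-tuple T -> R) f : (r <= p)%N -> (r <= q)%N -> (l <= r)%N ->
  (forall j, L2 (pm p) (u j)) -> L2 (pm p) f ->
  norm2 (pm p) (fun x => u j x - f x) @[j --> \oo] --> 0 ->
  norm2 (pm (p + q - r)) (fun x => formU phi (q := q) (r := r) (u j) x - formU phi (q := q) (r := r) f x) @[j --> \oo] --> 0.
Proof.
move=> rp rq lr uL fL uf.
have bd g := formU_bound measurable_void_weight (finite_base fW k) void_weight_le rp rq lr (f := g).
set c := fine (nu (base W k)) in bd.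
apply: (@squeeze_cvgr _ _ _ _ (fun=> 0)
  (fun j => norm2 (pm p) (fun x => u j x - f x) * (1 + c ^+ (q - r)))).
- near=> j; rewrite norm2_ge0/=; have [_] := bd _ (L2B (uL j) fL).
  apply: le_trans; rewrite le_eqVlt; apply/orP; left; apply/eqP; congr norm2.
  apply/funext => x; have := formU_lin phi (q := q) (r := r) 1 (u j) f x; rewrite mul1r => <-.
  by congr formU; apply/funext => y; rewrite mul1r.
- exact: cvg_cst.
- by rewrite -(mul0r (1 + c ^+ (q - r))); apply: cvgM => //; exact: cvg_cst.
Unshelve. all: by end_near. Qed.

Lemma cvg_formV r l (u : nat -> q.-tuple T -> R) f : (r <= p)%N -> (r <= q)%N -> (l <= r)%N ->
  (forall j, L2 (pm q) (u j)) -> L2 (pm q) f ->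
  norm2 (pm q) (fun x => u j x - f x) @[j --> \oo] --> 0 ->
  norm2 (pm (p + q - r)) (fun x => formV phi (p := p) (r := r) l (u j) x - formV phi (p := p) (r := r) l f x) @[j --> \oo] --> 0.
Proof.
move=> rp rq lr uL fL uf.
have bd g := formV_bound measurable_void_weight (finite_base fW k) void_weight_le rp rq lr (g := g).
set c := fine (nu (base W k)) in bd.
apply: (@squeeze_cvgr _ _ _ _ (fun=> 0)
  (fun j => norm2 (pm q) (fun x => u j x - f x) * (1 + c ^+ (p - r)))).
- near=> j; rewrite norm2_ge0/=; have [_] := bd _ (L2B (uL j) fL).
  apply: le_trans; rewrite le_eqVlt; apply/orP; left; apply/eqP; congr norm2.
  apply/funext => x; have := formV_lin phi (p := p) (r := r) l 1 (u j) f x; rewrite mul1r => <-.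
  by congr formV; apply/funext => y; rewrite mul1r.
- exact: cvg_cst.
- by rewrite -(mul0r (1 + c ^+ (p - r))); apply: cvgM => //; exact: cvg_cst.
Unshelve. all: by end_near. Qed.

(** Each term is an inner product of [formU] and [formV], both bounded linear in L2; the
    contractions themselves are not involved. *)
Lemma cvg_test_rhs u v f g :
  (forall j, L2 (pm p) (u j)) -> L2 (pm p) f -> (forall j, L2 (pm q) (v j)) -> L2 (pm q) g ->
  norm2 (pm p) (fun x => u j x - f x) @[j --> \oo] --> 0 ->
  norm2 (pm q) (fun x => v j x - g x) @[j --> \oo] --> 0 ->
  test_rhs (u j) (v j) @[j --> \oo] --> test_rhs f g.
Proof.
move=> uL fL vL gL uf vg; rewrite /test_rhs.
apply: cvg_big_sum => r; apply: cvgM; first exact: cvg_cst.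
apply: cvg_big_sum => l; apply: cvgM; first exact: cvg_cst.
have := ltn_ord r; have := ltn_ord l; rewrite !ltnS leq_min => lr /andP[rp rq].
have bU h := formU_bound measurable_void_weight (finite_base fW k) void_weight_le rp rq lr (f := h).
have bV h := formV_bound measurable_void_weight (finite_base fW k) void_weight_le rp rq lr (g := h).
apply: cvg_Rintegral_mul.
- by move=> j; case: (bU _ (uL j)).
- by move=> j; case: (bV _ (vL j)).
- by case: (bU _ fL).
- by case: (bV _ gL).
- exact: (cvg_formU rp rq lr).
- exact: (cvg_formV rp rq lr).
Qed.

(** Both sides are continuous in f and g for the L2 norms, and they agree on functions constant on
    cells, which are dense. *)
Theorem test_product f g : L2s nu f -> L2s nu g ->
  \int[P]_o (Jp f o * Jq g o * V o) = (\int[P]_o V o) * test_rhs f g.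
Proof.
move=> fL gL; have [u lu uf] := level_seq fL; have [v lv vg] := level_seq gL.
have uL j : L2s nu (u j) by have [n] := lu j; exact: level_L2s.
have vL j : L2s nu (v j) by have [n] := lv j; exact: level_L2s.
have JpL h : L2s nu h -> L2 P (Jp h) by case: HJp => h1 _ _ _; exact: h1.
have JqL h : L2s nu h -> L2 P (Jq h) by case: HJq => h1 _ _ _; exact: h1.
have JV h : L2 P h -> _ := norm2_mul_le1 (measurable_void nu N (cell W (n := k)) S) normV_le1 (f := h).
(* [V] is bounded by 1, so it can be absorbed in the second factor without harming L2
   convergence. *)
have lhs : \int[P]_o (Jp (u j) o * (Jq (v j) o * V o)) @[j --> \oo] --> \int[P]_o (Jp f o * (Jq g o * V o)).
  apply: cvg_Rintegral_mul.
  - by move=> j; exact: JpL.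
  - by move=> j; case: (JV _ (JqL _ (vL j))).
  - exact: JpL.
  - by case: (JV _ (JqL _ gL)).
  - exact: (multiple_integral_cvg HJp uL fL uf).
  apply: (@squeeze_cvgr _ _ _ _ (fun=> 0) (fun j => norm2 P (fun o => Jq (v j) o - Jq g o))).
  - near=> j; rewrite norm2_ge0/=; have [_] := JV _ (L2B (JqL _ (vL j)) (JqL _ gL)).
    apply: le_trans; rewrite le_eqVlt; apply/orP; left; apply/eqP; congr norm2.
    by apply/funext => o; rewrite mulrBl.
  - exact: cvg_cst.
  - exact: (multiple_integral_cvg HJq vL gL vg).
under eq_Rintegral do rewrite -mulrA.
have E j : \int[P]_o (Jp (u j) o * (Jq (v j) o * V o)) = (\int[P]_o V o) * test_rhs (u j) (v j); last first.
  move: lhs; under eq_fun do rewrite E; move=> lhs; apply: (cvg_unique _ lhs) => //.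
  apply: cvgM; first exact: cvg_cst.
  by apply: cvg_test_rhs => // [j||j|]; exact: L2s_L2.
(* The two approximants are carried to a common level, at least as fine as that of [S]. *)
have [n1 l1] := lu j; have [n2 l2] := lv j.
rewrite -(@test_level (maxn k (maxn n1 n2))).
- by apply: eq_Rintegral => o _; rewrite mulrA.
- exact: leq_maxl.
- by apply: level_le l1; rewrite leq_max leq_maxl orbT.
- by apply: level_le l2; rewrite leq_max leq_maxr orbT.
Unshelve. all: by end_near. Qed.

End test.

End test_identity.

Lemma L2s_one d (T : measurableType d) (R : realType)
  (nu : {sigma_finite_measure set T -> \bar R}) : L2s nu (fun _ : 0.-tuple T => 1 : R).
Proof.
split; last by move=> w; exact: aeW.
apply/L2P; split; first exact: measurable_cst.
rewrite /sqint /= integral_dirac//; first by rewrite diracE in_setT mul1e ltry.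
Qed.

Section vanishing_test.
Context (d : measure_display) (T : measurableType d) (R : realType).
Variable nu : {sigma_finite_measure set T -> \bar R}.
Variable W : nat -> set T.
Hypothesis fW : forall i, finite_sets nu (W i).
Hypothesis sepW : forall x y, (forall i, W i x <-> W i y) -> x = y.
Hypothesis null1 : forall x, nu [set x] = 0%E.
Hypothesis genW : forall A, measurable A -> <<s range W >> A.
Hypothesis covW : forall x, exists i, W i x.
Context (d' : measure_display) (Omega : measurableType d').
Variable P : probability Omega R.
Variable N : set T -> {RV P >-> R}.
Hypothesis HN : compensated_poisson nu N.
Variable I : forall m : nat, (m.-tuple T -> R) -> Omega -> R.
Hypothesis HI : wiener_ito nu N I.
Local Notation pm := (power_measure nu).
Local Notation J m := (chaos I (m := m)).

Lemma chaos_L2 m h : L2s nu h -> L2 P (J m h).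
Proof. by case: (multiple_integral_chaos HI m) => + _ _ _; exact. Qed.

(** Bridges tuple types of equal but not convertible lengths, such as m and m + 0 - 0; [F] is taken
    on lists for this reason. *)
Lemma cast_integral m n (F : seq T -> R) : m = n ->
  \int[pm m]_x F x = \int[pm n]_x F x.
Proof. by move=> ->. Qed.

Section fixed_void.
Variables (k : nat) (S : pred (code k)).
Hypothesis gS : forall s, S s -> good s.
Let phi : T -> R := void_weight R W S.
Let V := void nu N (cell W (n := k)) S.

Lemma prod_void_weightE m (x : m.-tuple T) : \prod_(y <- x) phi y =
  lift W (fun s => \prod_(t <- s) - (S t)%:R) x.
Proof. by rewrite /lift big_map. Qed.

Lemma L2_prod_void_weight m : L2 (pm m) (fun x => \prod_(y <- x) phi y).
Proof.
rewrite (_ : (fun x => _) = lift W (fun s => \prod_(t <- s) - (S t)%:R) (k := m)).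
  apply: L2_lift => // s /allPn[t ts /negP nt]; rewrite (big_rem t)//=.
  by case St : (S t); [case: nt; exact: gS|rewrite oppr0 mul0r].
by apply/funext => x; exact: prod_void_weightE.
Qed.

(** [test_product] against the constant 1 of order 0, where only the term r = l = 0 is present. *)
Lemma test_chaos m h : L2s nu h -> \int[P]_o (J m h o * V o) =
  (\int[P]_o V o) * \int[pm m]_x (h x * \prod_(y <- x) phi y).
Proof.
move=> hL; pose g (_ : 0.-tuple T) : R := 1.
have gL : L2s nu g := L2s_one nu.
have := test_product fW sepW null1 genW covW HN gS (multiple_integral_chaos HI m)
  (multiple_integral_chaos HI 0) hL gL.
rewrite /=; under eq_Rintegral do rewrite mulr1; move=> ->; congr (_ * _).
rewrite /test_rhs minn0 !big_ord1/= !bin0 !mulr1 !mul1r /contraction_form.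
pose F (s : seq T) := eval_seq h s * \prod_(y <- s) phi y.
transitivity (\int[pm m]_x F x); last first.
  by apply: eq_Rintegral => x _; rewrite /F eval_seqE.
rewrite (@cast_integral m (m + 0 - 0)%N); last by rewrite addn0 subn0.
apply: eq_Rintegral => x _; rewrite formUV// drop0 take0/= /F.
have xm : size x = m by rewrite size_tuple addn0 subn0.
rewrite take_oversize ?xm// drop_oversize ?xm//.
by rewrite (_ : eval_seq g [::] = 1) ?mulr1// -[[::]]/(tval [tuple]) eval_seqE.
Qed.

Lemma test_symmetrize m h : L2 (pm m) h -> \int[P]_o (J m (symmetrize h) o * V o) =
  (\int[P]_o V o) * \int[pm m]_x (h x * \prod_(y <- x) phi y).
Proof.
move=> hL; rewrite test_chaos; last by case: (L2_symmetrize hL).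
congr (_ * _); apply: integral_symmetrize_mul => //; first exact: L2_prod_void_weight.
move=> w; apply/funext => x /=; rewrite [RHS]big_tuple [RHS](reindex_inj (@perm_inj _ w))/=.
by rewrite big_map big_enum.
Qed.

End fixed_void.

Section defect.
Variables (p q : nat) (f : p.-tuple T -> R) (g : q.-tuple T -> R).
Hypotheses (fL : L2s nu f) (gL : L2s nu g).
Hypothesis fgL : forall r l : nat, (r <= minn p q)%N -> (l <= r)%N ->
  L2 (pm (p + q - r - l)) (star_contraction nu f g r l).

Definition product_rhs (o : Omega) : R := \sum_(r < (minn p q).+1)
  r`!%:R * 'C(p, r)%:R * 'C(q, r)%:R *
  \sum_(l < r.+1) 'C(r, l)%:R * J (p + q - r - l) (symmetrize (star_contraction nu f g r l)) o.

Definition defect o := J p f o * J q g o - product_rhs o.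

Lemma L2_product_rhs : L2 P product_rhs.
Proof.
apply: L2_sum => r; apply: L2Z; apply: L2_sum => l; apply: L2Z; apply: chaos_L2.
have := ltn_ord r; have := ltn_ord l; rewrite !ltnS => lr rpq.
by case: (L2_symmetrize (fgL rpq lr)).
Qed.

(** The product is tested by [test_product], each term of the right-hand side by [test_symmetrize];
    [contraction_formE] shows that both give the same forms with the same coefficients. *)
Lemma defect_test k (S : pred (code k)) : (forall s, S s -> good s) ->
  \int[P]_o (defect o * void nu N (cell W (n := k)) S o) = 0.
Proof.
move=> gS; set V := void _ _ _ _.
have JV h : L2 P h -> L2 P (fun o => h o * V o).
  move=> hL; have [] := norm2_mul_le1 (measurable_void nu N (cell W (n := k)) S) _ hL => //.
  by move=> o; exact: normV_le1.
have i1 : P.-integrable setT (EFin \o (fun o => J p f o * J q g o * V o)).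
  rewrite (_ : _ \o _ = (fun o => (J p f o * (J q g o * V o))%:E)).
    by apply: L2_mul_integrable; [exact: chaos_L2|apply: JV; exact: chaos_L2].
  by apply/funext => o /=; rewrite mulrA.
have i2 : P.-integrable setT (EFin \o (fun o => product_rhs o * V o)).
  by apply: L2_integrable; apply: JV; exact: L2_product_rhs.
under eq_Rintegral do rewrite /defect mulrBl.
rewrite RintegralB//.
rewrite (test_product fW sepW null1 genW covW HN gS (multiple_integral_chaos HI p)
  (multiple_integral_chaos HI q) fL gL).
apply/eqP; rewrite subr_eq0; apply/eqP; rewrite /test_rhs.
pose c (r : 'I_(minn p q).+1) : R := r`!%:R * 'C(p, r)%:R * 'C(q, r)%:R.
pose K r l o := J (p + q - r - l) (symmetrize (star_contraction nu f g r l)) o * V o.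
have scL (r : 'I_(minn p q).+1) (l : 'I_r.+1) : L2 (pm (p + q - r - l)) (star_contraction nu f g r l).
  by have := ltn_ord r; have := ltn_ord l; rewrite !ltnS => lr rpq; exact: fgL.
have iK (r : 'I_(minn p q).+1) (l : 'I_r.+1) : P.-integrable setT (EFin \o K r l).
  by apply: L2_integrable; apply: JV; apply: chaos_L2; case: (L2_symmetrize (scL r l)).
have KE (r : 'I_(minn p q).+1) (l : 'I_r.+1) :
    \int[P]_o K r l o = (\int[P]_o V o) * contraction_form nu (void_weight R W S) r l f g.
  rewrite test_symmetrize//; congr (_ * _).
  have := ltn_ord r; have := ltn_ord l; rewrite !ltnS leq_min => lr /andP[rp rq].
  exact: (contraction_formE (measurable_void_weight fW S) (finite_base fW k)
    (void_weight_le R W gS) rp rq lr (L2s_L2 fL) (L2s_L2 gL) (L2_measurable (scL r l))).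
have iZ (a : R) (h : Omega -> R) : P.-integrable setT (EFin \o h) ->
    P.-integrable setT (EFin \o (fun o => a * h o)).
  move=> ih; rewrite (_ : _ \o _ = (fun o => a%:E * (h o)%:E)%E); first exact: integrableZl.
  by apply/funext => o; rewrite /= EFinM.
have h1 (r : 'I_(minn p q).+1) := Rintegral_sum (index_enum _)
  (fun l : 'I_r.+1 => iZ 'C(r, l)%:R _ (iK r l)).
have [_ h2] := Rintegral_sum (index_enum _) (fun r => iZ (c r) _ (h1 r).1).
transitivity (\int[P]_o (\sum_(r < (minn p q).+1) c r * \sum_(l < r.+1) 'C(r, l)%:R * K r l o)).
  rewrite h2 mulr_sumr; apply: eq_bigr => r _.
  rewrite RintegralZl//; last exact: (h1 r).1.
  rewrite (h1 r).2 mulrCA; congr (_ * _); rewrite mulr_sumr; apply: eq_bigr => l _.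
  by rewrite RintegralZl// ?KE 1?mulrCA//; exact: iK.
apply: eq_Rintegral => o _; rewrite /product_rhs mulr_suml; apply: eq_bigr => r _.
rewrite -[RHS]mulrA; congr (_ * _); rewrite mulr_suml; apply: eq_bigr => l _.
by rewrite /K mulrA.
Qed.

End defect.

End vanishing_test.

(** * Separation by void indicators *)

Section clip.
Context {R : realType}.
Implicit Types x y : R.

(** A bounded 1-Lipschitz substitute for x with the same sign: x clip(x) is integrable for x in L1,
    nonnegative, and zero only at x = 0. *)
Definition clip x : R := Num.max (-1) (Num.min 1 x).

Lemma clip_le1 x : `|clip x| <= 1.
Proof.
rewrite /clip ler_norml; apply/andP; split; first by rewrite le_max lexx.
by rewrite ge_max ge_min lexx andbT; lra.
Qed.

Lemma clip_lipschitz x y : `|clip x - clip y| <= `|x - y|.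
Proof.
rewrite /clip /Num.max /Num.min; repeat case: ifPn; rewrite -?leNgt; move=> *;
  rewrite ler_norml; have := ler_norm (x - y); have := ler_norm (y - x); rewrite [`|y - x|]distrC;
  move=> *; apply/andP; split; lra.
Qed.

Lemma mul_clip_ge0 x : 0 <= x * clip x.
Proof.
have [x0|x0] := leP 0 x.
  by apply: mulr_ge0 => //; rewrite /clip le_max le_min x0 ler01 orbT.
by apply: mulr_le0; [exact: ltW|rewrite /clip ge_max ge_min (ltW x0) orbT andbT; lra].
Qed.

Lemma mul_clip_eq0 x : x * clip x = 0 -> x = 0.
Proof.
move=> /eqP; rewrite mulf_eq0 => /orP[/eqP//|/eqP].
by rewrite /clip /Num.max /Num.min; repeat case: ifPn; rewrite -?leNgt; lra.
Qed.

Lemma measurable_clip d (T : measurableType d) (f : T -> R) :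
  measurable_fun setT f -> measurable_fun setT (fun o => clip (f o)).
Proof. by move=> mf; apply: measurable_maxr => //; exact: measurable_minr. Qed.

End clip.

Lemma integrable_mul_le1 d (T : measurableType d) (R : realType)
    (mu : {measure set T -> \bar R}) (f v : T -> R) :
  mu.-integrable setT (EFin \o f) -> measurable_fun setT v -> (forall x, `|v x| <= 1) ->
  mu.-integrable setT (EFin \o (fun x => f x * v x)).
Proof.
move=> fi mv v1; apply: (le_integrable measurableT _ _ fi).
  apply/measurable_EFinP; apply: measurable_funM => //.
  by apply/measurable_EFinP; exact: measurable_int fi.
by move=> x _ /=; rewrite lee_fin normrM ler_piMr.
Qed.

Section real_integrable.
Context d (T : measurableType d) (R : realType) (mu : {measure set T -> \bar R}).
Implicit Types f g : T -> R.

Lemma integrable_realD f g : mu.-integrable setT (EFin \o f) -> mu.-integrable setT (EFin \o g) ->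
  mu.-integrable setT (EFin \o (fun x => f x + g x)).
Proof. by move=> fi gi; exact: (integrableD measurableT fi gi). Qed.

Lemma integrable_realZ a f : mu.-integrable setT (EFin \o f) ->
  mu.-integrable setT (EFin \o (fun x => a * f x)).
Proof. by move=> fi; exact: (integrableZl measurableT a fi). Qed.

Lemma integrable_realB f g : mu.-integrable setT (EFin \o f) -> mu.-integrable setT (EFin \o g) ->
  mu.-integrable setT (EFin \o (fun x => f x - g x)).
Proof. by move=> fi gi; exact: (integrableB measurableT fi gi). Qed.

Lemma integrable_real_norm f : mu.-integrable setT (EFin \o f) ->
  mu.-integrable setT (EFin \o (fun x => `|f x|)).
Proof. by move=> fi; exact: (integrable_abse fi). Qed.

Lemma integrable_real_measurable f : mu.-integrable setT (EFin \o f) -> measurable_fun setT f.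
Proof. by move=> fi; apply/measurable_EFinP; exact: measurable_int fi. Qed.

Lemma ae_le_Rintegral f g : mu.-integrable setT (EFin \o f) -> mu.-integrable setT (EFin \o g) ->
  {ae mu, forall x, f x <= g x} -> \int[mu]_x f x <= \int[mu]_x g x.
Proof.
move=> fi gi fg; rewrite -subr_ge0 -RintegralB//; have gfi := integrable_realB gi fi.
rewrite (@ae_eq_Rintegral _ _ _ mu _ (fun x => `|g x - f x|)).
- by apply: Rintegral_ge0.
- exact: integrable_real_measurable.
- by apply: integrable_real_measurable; exact: integrable_real_norm.
by apply: filterS fg => x /= h _; rewrite ger0_norm ?subr_ge0.
Qed.

End real_integrable.

Section separation.
Context (d : measure_display) (T : measurableType d) (R : realType).
Variable nu : {sigma_finite_measure set T -> \bar R}.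
Variable W : nat -> set T.
Hypothesis fW : forall i, finite_sets nu (W i).
Hypothesis sepW : forall x y, (forall i, W i x <-> W i y) -> x = y.
Hypothesis null1 : forall x, nu [set x] = 0%E.
Context (d' : measure_display) (Omega : measurableType d').
Variable P : probability Omega R.
Variable N : set T -> {RV P >-> R}.
Hypothesis HN : compensated_poisson nu N.

Lemma N_cell_restr n m (nm : (n <= m)%N) : {ae P, forall o, forall s : code n,
  N (cell W s) o = \sum_(t | (restr nm t == s) && good s) N (cell W t) o}.
Proof.
apply: filter_forall => s.
have := N_sum HN (S := fun t => (restr nm t == s) && good s) (finite_cell fW s)
    (fun t => finite_cell fW t) (@trivIset_cell _ _ W m).
have -> : cell W s = \bigcup_(t in [set t | (restr nm t == s) && good s]) cell W t.
  have [gs|gs] := boolP (good s).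
    by rewrite [LHS](cell_restr W nm gs); apply: eq_bigcupl; split=> t /=; rewrite andbT.
  apply/seteqP; split=> x; first by move=> [gs']; rewrite gs' in gs.
  by move=> [t /=]; rewrite andbF.
move=> /(_ erefl); apply: filterS => o /= h; exact: h.
Qed.

(* Up to a null set, at least two points fall in B. *)
Definition crowded B : set Omega := ~` (level_set nu N B 0 `|` level_set nu N B 1).

Lemma measurable_crowded B : measurable (crowded B).
Proof. by apply: measurableC; apply: measurableU; exact: measurable_level_set. Qed.

Lemma crowded_le B : finite_sets nu B -> (P (crowded B) <= (fine (nu B) ^+ 2)%:E)%E.
Proof.
move=> fB; rewrite /crowded.
have m0 := measurable_level_set nu N B 0; have m1 := measurable_level_set nu N B 1.
have -> : P (~` (level_set nu N B 0 `|` level_set nu N B 1)) =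
    (1 - pois (fine (nu B)) 0 - pois (fine (nu B)) 1)%:E.
  rewrite probability_setC; last exact: measurableU.
  have -> : P (level_set nu N B 0 `|` level_set nu N B 1) =
      (pois (fine (nu B)) 0 + pois (fine (nu B)) 1)%:E.
    rewrite measureU//; last first.
      by move/trivIsetP: (@trivIset_level_set _ _ _ _ _ nu P N B) => /(_ 0%N 1%N); exact.
    by rewrite EFinD -!(level_setE HN _ fB).
  by rewrite -EFinB opprD addrA.
by rewrite lee_fin pois_ge2// fine_ge0.
Qed.

(** With zero or one point, the number of points is one minus the emptiness indicator. *)
Lemma crowdedN B o : ~ crowded B o -> N B o = 1 - empty_set nu N B o - fine (nu B).
Proof.
move=> /contrapT [] h; rewrite empty_setE h subrK.
  by rewrite eqxx subrr.
by rewrite oner_eq0 subr0.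
Qed.

(** The number of crowded level-m cells inside [base W n]. It dominates the indicator that one
    exists, and its mean carries the union bound. *)
Definition crowd n m (o : Omega) : R :=
  \sum_(t : code m) (goodb n t)%:R * \1_(crowded (cell W t)) o.

Lemma crowd_ge0 n m o : 0 <= crowd n m o.
Proof. by apply: sumr_ge0 => t _; rewrite mulr_ge0. Qed.

Lemma crowd_ge1 n m o (t : code m) : goodb n t -> crowded (cell W t) o -> 1 <= crowd n m o.
Proof.
move=> gt ct; rewrite /crowd (bigD1 t)//= gt mul1r indicE mem_set// lerDl.
by apply: sumr_ge0 => ? _; rewrite mulr_ge0.
Qed.

Lemma integrable_crowded B (a : R) :
  P.-integrable setT (EFin \o (fun o => a * \1_(crowded B) o)).
Proof.
apply: integrable_mul_le1.
- exact: L2_integrable (norm2_cst P a).1.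
- by apply: measurable_indic; exact: measurable_crowded.
- by move=> o; rewrite indicE normr_nat; case: (_ \in _).
Qed.

Lemma Rintegral_crowd n m : P.-integrable setT (EFin \o crowd n m) /\
  \int[P]_o crowd n m o <= \sum_(t : code m) bweight nu W n t ^+ 2.
Proof.
have [i1 ->] := Rintegral_sum (index_enum (code m : finType))
  (fun t => integrable_crowded (cell W t) (goodb n t)%:R).
split=> //; apply: ler_sum => t _; rewrite RintegralZl//; last first.
  by have := integrable_crowded (cell W t) 1; under eq_fun do rewrite mul1r.
rewrite /bweight exprMn; case: (goodb n t); last by rewrite !mul0r expr0n mul0r.
rewrite mul1r expr1n mul1r /Rintegral integral_indic//; last exact: measurable_crowded.
rewrite setIT -lee_fin; apply: le_trans (crowded_le (finite_cell fW t)).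
by rewrite fineK//; apply: fin_num_measure; exact: measurable_crowded.
Qed.


Definition cell_measurable n (X : Omega -> R) := exists h : (code n -> R) -> R,
  X = (fun o => h (fun s => N (cell W s) o)) %[ae P].

Lemma cell_measurable_le n m X : (n <= m)%N -> cell_measurable n X -> cell_measurable m X.
Proof.
move=> nm [h hX]; exists (fun v => h (fun s => \sum_(t | (restr nm t == s) && good s) v t)).
move: hX (N_cell_restr nm); apply: filterS2 => o /= h1 h2 _; rewrite h1//; congr h.
by apply/funext => s.
Qed.

Definition approximable (Y : Omega -> R) := forall e, 0 < e -> exists n X,
  [/\ cell_measurable n X, P.-integrable setT (EFin \o X) &
     \int[P]_o `|Y o - X o| < e].

(** The whole pattern of emptiness indicators at level n, encoded as a set; a void event then says
    that a given set is included in it. *)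
Definition vacant n (o : Omega) : {set code n} :=
  [set t | good t && (empty_set nu N (cell W t) o != 0)].

Section separate.
Variable Y : Omega -> R.
Hypothesis iY : P.-integrable setT (EFin \o Y).
Hypothesis Y0 : forall k (S : pred (code k)), (forall s, S s -> good s) ->
  \int[P]_o (Y o * void nu N (cell W (n := k)) S o) = 0.
Hypothesis aY : approximable Y.

Lemma void_vacant n (A : {set code n}) o : (forall s, s \in A -> good s) ->
  void nu N (cell W (n := n)) (mem A) o = (A \subset vacant n o)%:R.
Proof.
move=> gA; rewrite voidE; have [/fintype.subsetP AE|/fintype.subsetPn[t tA]] := boolP (A \subset _).
  by apply: big1 => t /AE; rewrite inE => /andP[_]; rewrite empty_setE => /eqP; case: eqP.
rewrite inE gA//= negbK => /eqP t0.
by rewrite (bigD1 t)//= t0 mul0r.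
Qed.

Lemma measurable_vacant n (A : {set code n}) :
  measurable_fun setT (fun o => (vacant n o == A)%:R : R).
Proof.
rewrite (_ : (fun o => _) = (fun o => \prod_(t : code n)
    (if t \in A then (good t)%:R * empty_set nu N (cell W t) o
     else 1 - (good t)%:R * empty_set nu N (cell W t) o))).
  apply: measurable_prod => t _; case: (t \in A).
    by apply: measurable_funM => //; exact: measurable_empty_set.
  apply: measurable_funB => //; apply: measurable_funM => //; exact: measurable_empty_set.
apply/funext => o; rewrite (eq_bigr (fun t => ((t \in A) == (t \in vacant n o))%:R)); last first.
  move=> t _; rewrite inE empty_setE.
  case: (good t); case: (t \in A); case: (N (cell W t) o + fine (nu (cell W t)) =P 0) => _ /=;
    by rewrite ?oner_eq0 ?eqxx ?mul1r ?mul0r ?subr0 ?subrr.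
case: eqP => [->|oA]; first by rewrite big1// => t _; rewrite eqxx.
have /existsP[t tA] : [exists t, (t \in A) != (t \in vacant n o)].
  apply: contra_notT oA; rewrite negb_exists => /forallP h; apply/setP => t.
  by apply/esym/eqP; move: (h t); rewrite negbK.
by rewrite (bigD1 t)//= (negbTE tA) mul0r.
Qed.

Lemma integrable_vacant n (b : {set code n} -> R) : (forall A, `|b A| <= 1) ->
  P.-integrable setT (EFin \o (fun o => Y o * b (vacant n o))) /\
  \int[P]_o (Y o * b (vacant n o)) = 0.
Proof.
move=> b1; pose K (A : {set code n}) o := Y o * (vacant n o == A)%:R.
have iK (A : {set code n}) : P.-integrable setT (EFin \o K A).
  apply: integrable_mul_le1 => //; first exact: measurable_vacant.
  by move=> o; rewrite normr_nat; case: (_ == _).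
have K0 (A : {set code n}) : \int[P]_o K A o = 0.
  (* Descending induction on A: [void A] is the sum over B containing A of the
     indicators of [vacant n = B]. *)
  have [m] := ubnP #|~: A|; elim: m A => // m IH A; rewrite ltnS => Am.
  (* A set containing the all-false code is never the vacant set. *)
  have [/forallP gA|/forallPn[t]] := boolP [forall s, (s \in A) ==> good s]; last first.
    rewrite negb_imply => /andP[tA gt]; transitivity (\int[P]_o (0 : R)); last by rewrite /Rintegral integral0.
    apply: eq_Rintegral => o _.
    rewrite /K; case: eqP => [oA|]; last by rewrite mulr0.
    by move: tA; rewrite -oA inE (negbTE gt).
  have {}gA s : s \in A -> good s by move/implyP: (gA s).
  have VE o : Y o * void nu N (cell W (n := n)) (mem A) o =
      \sum_(B : {set code n}) (A \subset B)%:R * K B o.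
    rewrite (void_vacant _ gA) (bigD1 (vacant n o))//= big1 ?addr0.
      by rewrite /K eqxx mulr1 mulrC.
    by move=> B; rewrite eq_sym /K => /negbTE ->; rewrite !mulr0.
  have iAK (B : {set code n}) : P.-integrable setT (EFin \o (fun o => (A \subset B)%:R * K B o)).
    rewrite (_ : _ \o _ = (fun o => (A \subset B)%:R%:E * (K B o)%:E)%E).
      by apply: integrableZl => //; exact: iK.
    by apply/funext => o; rewrite /= EFinM.
  have := Y0 gA; under eq_Rintegral do rewrite VE.
  rewrite (Rintegral_sum (index_enum _) iAK).2 (bigD1 A)//= big1 ?addr0.
    by rewrite subxx; under eq_Rintegral do rewrite mul1r.
  move=> B BA; rewrite RintegralZl//; have [AB|] := boolP (A \subset B); last by rewrite mul0r.
  rewrite IH ?mulr0//; apply: leq_trans Am; apply: proper_card; rewrite finset.properC finset.properEneq.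
  by rewrite AB eq_sym BA.
have ibK (A : {set code n}) : P.-integrable setT (EFin \o (fun o => b A * K A o)).
  rewrite (_ : _ \o _ = (fun o => (b A)%:E * (K A o)%:E)%E).
    by apply: integrableZl => //; exact: iK.
  by apply/funext => o; rewrite /= EFinM.
have [i1 i2] := Rintegral_sum (index_enum _) ibK.
have E : (fun o => Y o * b (vacant n o)) = (fun o => \sum_(A : {set code n}) b A * K A o).
  apply/funext => o; rewrite (bigD1 (vacant n o))//= big1 ?addr0.
    by rewrite /K eqxx mulr1 mulrC.
  by move=> B; rewrite eq_sym /K => /negbTE ->; rewrite !mulr0.
rewrite E; split=> //; rewrite i2 big1// => A _.
by rewrite RintegralZl// K0 mulr0.
Qed.

Lemma goodb_restr n m (nm : (n <= m)%N) (t : code m) : good (restr nm t) -> goodb n t.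
Proof.
by move=> /existsP[i]; rewrite ffunE => ti; apply/existsP; exists (widen_ord nm i); rewrite ti andbT /= ltn_ord.
Qed.

Lemma integrable_tail (K : nat) :
  P.-integrable setT (EFin \o (fun o => `|Y o| * (K%:R < `|Y o|)%R%:R)).
Proof.
have mY := integrable_real_measurable iY.
apply: integrable_mul_le1; first exact: integrable_real_norm.
  rewrite (_ : (fun o => _) = \1_((fun o => `|Y o|) @^-1` `]K%:R, +oo[)).
    apply: measurable_indic; rewrite -[X in measurable X]setTI.
    exact: (measurableT_comp (@normr_measurable R setT) mY).
  by apply/funext => o; rewrite indicE; congr ((nat_of_bool _)%:R); apply/idP/idP; rewrite inE/= in_itv/= andbT.
by move=> o; rewrite normr_nat; case: (_ < _).
Qed.

Lemma cvg_tail : \int[P]_o (`|Y o| * (K%:R < `|Y o|)%R%:R) @[K --> \oo] --> 0.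
Proof.
have [] := @dominated_convergence _ _ _ P setT measurableT
   (fun (K : nat) o => (`|Y o| * (K%:R < `|Y o|)%R%:R)%:E) (cst 0%E) (fun o => `|Y o|%:E).
- by move=> K; exact: measurable_int (integrable_tail K).
- exact: measurable_cst.
- apply: aeW => o _; apply: cvg_near_cst; near=> K.
  rewrite ltNge (_ : _ <= _) ?mulr0//; apply: ltW; near: K.
  exact: nbhs_infty_gtr.
- exact: integrable_real_norm.
- apply: aeW => o K _; rewrite /= lee_fin normrM normr_id ler_piMr//.
  by rewrite normr_nat; case: (_ < _).
move=> _ _; rewrite integral0 => /fine_cvg; exact.
Unshelve. all: by end_near. Qed.

(** [clip (Y o)] is compared with a bounded function of the emptiness pattern at a fine level,
    against which the integral of [Y] vanishes. *)
Lemma clip_approx e : 0 < e -> \int[P]_o (Y o * clip (Y o)) <= e.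
Proof.
move=> e0.
have mY := integrable_real_measurable iY.
have e4 : 0 < e / 8 by rewrite divr_gt0.
have [K _ /(_ _ (leqnn _)) tK] : \forall K \near \oo, \int[P]_o (`|Y o| * (K%:R < `|Y o|)%R%:R) < e / 8.
  by have /cvgrPdist_lt/(_ _ e4) := cvg_tail; apply: filterS => K; rewrite sub0r normrN => /(le_lt_trans (ler_norm _)).
have K1 : 0 < K.+1%:R :> R by [].
have [n [X [[h hX] iX XY]]] := aY (divr_gt0 e4 K1).
(* [m] is chosen after [K] and [n]: [base W n] is cut so finely that two points in one cell become
   improbable. *)
have [m nm mc] : exists2 m, (n <= m)%N & \sum_(s : code m) bweight nu W n s ^+ 2 < e / 8 / K.+1%:R.
  have /cvgrPdist_lt/(_ _ (divr_gt0 e4 K1)) := cvg_small_cells fW sepW null1 n.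
  move=> [m0 _ hm]; exists (maxn n m0); first exact: leq_maxl.
  have := hm (maxn n m0) (leq_maxr _ _); rewrite /= sub0r normrN.
  exact: (le_lt_trans (ler_norm _)).
(* If no fine cell is crowded, a fine cell outside the vacant set [A] holds exactly one point, and
   [M A] is the vector of values of N on the level-n cells. *)
pose M (A : {set code m}) (s : code n) : R :=
  \sum_(t | (restr nm t == s) && good s) ((t \notin A)%:R - fine (nu (cell W t))).
pose b A := clip (h (M A)).
have [iYb Yb0] := integrable_vacant (fun A => clip_le1 (h (M A)) : `|b A| <= 1).
have iYc : P.-integrable setT (EFin \o (fun o => Y o * clip (Y o))).
  apply: integrable_mul_le1 => //; first exact: measurable_clip.
  by move=> o; exact: clip_le1.
have [icr crle] := Rintegral_crowd n m.
have iT := integrable_tail K.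
have iXY := integrable_real_norm (integrable_realB iY iX).
(* Where |Y| > K the difference is at most 2|Y|; where |Y| <= K and some fine cell is crowded, at
   most 2K; elsewhere [b (vacant m o)] equals clip(X) and the Lipschitz bound applies. *)
have key : {ae P, forall o, Y o * clip (Y o) - Y o * b (vacant m o) <=
    2 * (`|Y o| * (K%:R < `|Y o|)%R%:R) + (K%:R * `|Y o - X o| + 2 * K%:R * crowd n m o)}.
  move: hX (N_cell_restr nm); apply: filterS2 => o hX hN.
  have bc := clip_le1 (Y o); have bb := clip_le1 (h (M (vacant m o))).
  rewrite -mulrBr; apply: le_trans (ler_norm _) _; rewrite normrM.
  have d2 : `|clip (Y o) - b (vacant m o)| <= 2.
    by apply: le_trans (ler_normB _ _) _; rewrite /b; lra.
  have XY0 := normr_ge0 (Y o - X o); have Yo0 := normr_ge0 (Y o); have cr0 := crowd_ge0 n m o.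
  have [YK|YK] := ltP K%:R `|Y o|.
    rewrite mulr1; have : 0 <= K%:R * `|Y o - X o| by rewrite mulr_ge0.
    have : 0 <= 2 * K%:R * crowd n m o by rewrite !mulr_ge0.
    nra.
  rewrite mulr0 mulr0 add0r.
  have [/existsP[t /andP[gt /asboolP ct]]|] :=
      boolP [exists t : code m, goodb n t && `[< crowded (cell W t) o >]].
    have c1 := crowd_ge1 gt ct; have : 0 <= K%:R * `|Y o - X o| by rewrite mulr_ge0.
    have K0 : 0 <= K%:R :> R by [].
    have : `|Y o| * `|clip (Y o) - b (vacant m o)| <= K%:R * 2 by rewrite ler_pM.
    nra.
  rewrite negb_exists => /forallP nc.
  have -> : b (vacant m o) = clip (X o).
    rewrite hX// /b; congr (clip (h _)); apply/funext => s; rewrite hN.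
    apply: eq_bigr => t /andP[/eqP ts gs].
    have gt : goodb n t by apply: (goodb_restr (nm := nm)); rewrite ts.
    have : ~ crowded (cell W t) o by move=> ct; move: (nc t); rewrite gt /= => /negP; apply; exact/asboolP.
    move=> /crowdedN ->; rewrite inE (goodb_good gt) empty_setE /=.
    by case: (N (cell W t) o + fine (nu (cell W t)) =P 0); rewrite ?oner_eq0 ?eqxx ?subrr ?subr0.
  have := clip_lipschitz (Y o) (X o) => cl.
  have : `|Y o| * `|clip (Y o) - clip (X o)| <= K%:R * `|Y o - X o| by rewrite ler_pM.
  have : 0 <= 2 * K%:R * crowd n m o by rewrite !mulr_ge0.
  lra.
have iKXY := integrable_realZ K%:R iXY; have i2T := integrable_realZ 2 iT.
have iKcr := integrable_realZ (2 * K%:R) icr.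
have := ae_le_Rintegral (integrable_realB iYc iYb)
  (integrable_realD i2T (integrable_realD iKXY iKcr)) key.
rewrite RintegralB// Yb0 subr0 RintegralD//; last exact: integrable_realD.
rewrite RintegralD// !RintegralZl// => hle; apply: le_trans hle _.
have K0 : 0 <= K%:R :> R by [].
(* The three errors amount to at most 2, 1 and 2 times e / 8. Dividing by K + 1 pays for the factor
   K and stays legitimate for K = 0. *)
have bd z : z < e / 8 / K.+1%:R -> K%:R * z <= e / 8.
  rewrite ltr_pdivlMr// => hz; have [z0|z0] := leP 0 z.
    by apply: le_trans (ltW hz); rewrite mulrC ler_wpM2l// ler_nat.
  by apply: le_trans (ltW (divr_gt0 e0 _)) => //; rewrite mulr_ge0_le0// ltW.
have := bd _ XY; have := bd _ (le_lt_trans crle mc); rewrite -mulrA; lra.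
Qed.

Theorem separation : Y = (fun=> 0) %[ae P].
Proof.
have mY := integrable_real_measurable iY.
have iYc : P.-integrable setT (EFin \o (fun o => Y o * clip (Y o))).
  apply: integrable_mul_le1 => //; first exact: measurable_clip.
  by move=> o; exact: clip_le1.
have Yc0 : \int[P]_o (Y o * clip (Y o)) = 0.
  apply/eqP; rewrite eq_le; apply/andP; split.
    by apply/ler_addgt0Pr => e e0; rewrite add0r; exact: clip_approx.
  by apply: Rintegral_ge0 => o _; exact: mul_clip_ge0.
have : (\int[P]_o (Y o * clip (Y o))%:E = 0)%E.
  rewrite -(@fineK _ (\int[P]_o _)%E); last exact: (integrable_fin_num measurableT iYc).
  by rewrite -[fine _]/(\int[P]_o (Y o * clip (Y o))) Yc0.
move=> h; have := ae_eq_integral_abs P measurableT (measurable_int _ iYc).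
rewrite (eq_integral (fun o => (Y o * clip (Y o))%:E)) => [[h1 _]|o _]; last first.
  by rewrite /= ger0_norm// mul_clip_ge0.
by have := h1 h; apply: filterS => o /= /[apply] -[] /mul_clip_eq0.
Qed.

End separate.

End separation.

(** * L1 approximation by functions of finitely many cells *)

Section approximation.
Context (d : measure_display) (T : measurableType d) (R : realType).
Variable nu : {sigma_finite_measure set T -> \bar R}.
Variable W : nat -> set T.
Hypothesis fW : forall i, finite_sets nu (W i).
Hypothesis sepW : forall x y, (forall i, W i x <-> W i y) -> x = y.
Hypothesis null1 : forall x, nu [set x] = 0%E.
Hypothesis genW : forall A, measurable A -> <<s range W >> A.
Hypothesis covW : forall x, exists i, W i x.
Context (d' : measure_display) (Omega : measurableType d').
Variable P : probability Omega R.
Variable N : set T -> {RV P >-> R}.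
Hypothesis HN : compensated_poisson nu N.
Local Notation pm := (power_measure nu).
Local Notation approximable := (approximable W N).
Local Notation integrableR Y := (P.-integrable setT (EFin \o Y)).

Lemma cell_measurable_lin n a X1 X2 : cell_measurable W N n X1 -> cell_measurable W N n X2 ->
  cell_measurable W N n (fun o => a * X1 o + X2 o).
Proof.
move=> [h1 e1] [h2 e2]; exists (fun v => a * h1 v + h2 v).
by move: e1 e2; apply: filterS2 => o /= -> // -> //.
Qed.

Lemma cell_measurable_mul n X1 X2 : cell_measurable W N n X1 -> cell_measurable W N n X2 ->
  cell_measurable W N n (fun o => X1 o * X2 o).
Proof.
move=> [h1 e1] [h2 e2]; exists (fun v => h1 v * h2 v).
by move: e1 e2; apply: filterS2 => o /= -> // -> //.
Qed.

Lemma approximable0 : approximable (fun=> 0).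
Proof.
move=> e e0; exists 0, (fun=> 0); split.
- by exists (fun=> 0); exact: aeW.
- exact: L2_integrable (L2_0 P).
- by rewrite /Rintegral (eq_integral (cst 0%E)) ?integral0// => o _; rewrite subrr normr0.
Qed.

Lemma approximable_lin a Y1 Y2 : integrableR Y1 -> integrableR Y2 ->
  approximable Y1 -> approximable Y2 -> approximable (fun o => a * Y1 o + Y2 o).
Proof.
move=> i1 i2 h1 h2 e e0; have a1 : 0 < `|a| + 1 by rewrite ltr_wpDl.
have e2 : 0 < e / 2 by rewrite divr_gt0.
have [n1 [X1 [c1 j1 b1]]] := h1 _ (divr_gt0 e2 a1); have [n2 [X2 [c2 j2 b2]]] := h2 _ e2.
exists (maxn n1 n2), (fun o => a * X1 o + X2 o); split.
- apply: cell_measurable_lin.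
  + by apply: (cell_measurable_le fW HN _ c1); exact: leq_maxl.
  + by apply: (cell_measurable_le fW HN _ c2); exact: leq_maxr.
- by apply: integrable_realD => //; exact: integrable_realZ.
have k1 := integrable_real_norm (integrable_realB i1 j1).
have k2 := integrable_real_norm (integrable_realB i2 j2).
have k1a := integrable_realZ `|a| k1.
apply: (@le_lt_trans _ _ (\int[P]_o (`|a| * `|Y1 o - X1 o| + `|Y2 o - X2 o|))).
  apply: le_Rintegral => //.
  - apply: integrable_real_norm; apply: integrable_realB; apply: integrable_realD => //; exact: integrable_realZ.
  - exact: integrable_realD.
  move=> o _; rewrite -normrM; apply: le_trans (ler_normD _ _); rewrite le_eqVlt; apply/orP; left.
  by apply/eqP; congr `|_|; ring.
rewrite RintegralD// RintegralZl//.
have : `|a| * \int[P]_o `|Y1 o - X1 o| <= e / 2; last by lra.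
move: b1; rewrite ltr_pdivlMr// => b1; apply: le_trans (ltW b1).
rewrite mulrC; apply: ler_wpM2l; last by rewrite lerDl.
by apply: Rintegral_ge0.
Qed.

Lemma approximable_sum (I : Type) (s : seq I) (c : I -> R) (F : I -> Omega -> R) :
  (forall i, integrableR (F i)) -> (forall i, approximable (F i)) ->
  integrableR (fun o => \sum_(i <- s) c i * F i o) /\ approximable (fun o => \sum_(i <- s) c i * F i o).
Proof.
move=> iF aF; elim: s => [|i s [IH1 IH2]].
  rewrite (_ : (fun o => _) = (fun=> 0)); last by apply/funext => o; rewrite big_nil.
  by split; [exact: L2_integrable (L2_0 P)|exact: approximable0].
rewrite (_ : (fun o => _) = (fun o => c i * F i o + \sum_(i <- s) c i * F i o)); last first.
  by apply/funext => o; rewrite big_cons.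
split; last exact: approximable_lin.
by apply: integrable_realD => //; exact: integrable_realZ.
Qed.

Section product.
Variables (p q : nat) (Jp : (p.-tuple T -> R) -> Omega -> R) (Jq : (q.-tuple T -> R) -> Omega -> R).
Hypotheses (HJp : multiple_integral nu N Jp) (HJq : multiple_integral nu N Jq).

Lemma cell_measurable_level m (J : (m.-tuple T -> R) -> Omega -> R) n f :
  multiple_integral nu N J -> level W n f -> cell_measurable W N n (J f).
Proof.
move=> HJ [F cF ->]; exists (fun v => wsum v m F).
exact: multiple_integral_lift.
Qed.

(** Integrals of functions constant on cells are polynomials in the values of N on these cells, and
    products of L2-convergent sequences converge in L1. *)
Lemma approximable_product f g : L2s nu f -> L2s nu g ->
  approximable (fun o => Jp f o * Jq g o).
Proof.
move=> fL gL e e0.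
have [u lu uf] := level_seq fW sepW null1 genW covW fL.
have [v lv vg] := level_seq fW sepW null1 genW covW gL.
have uL j : L2s nu (u j) by have [n] := lu j; exact: level_L2s.
have vL j : L2s nu (v j) by have [n] := lv j; exact: level_L2s.
have JpL h : L2s nu h -> L2 P (Jp h) by case: HJp => h1 _ _ _; exact: h1.
have JqL h : L2s nu h -> L2 P (Jq h) by case: HJq => h1 _ _ _; exact: h1.
have ca := multiple_integral_cvg HJp uL fL uf; have cb := multiple_integral_cvg HJq vL gL vg.
set a := (fun j => norm2 P (fun o => Jp (u j) o - Jp f o)) in ca.
set b := (fun j => norm2 P (fun o => Jq (v j) o - Jq g o)) in cb.
(* Cauchy-Schwarz bound for (Ju - Jf) Jg + Ju (Jv - Jg), with the norm of Ju bounded by that of Jf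
   plus [a j]. *)
pose D j := a j * norm2 P (Jq g) + (norm2 P (Jp f) + a j) * b j.
have cD : D j @[j --> \oo] --> 0.
  rewrite [X in _ --> X](_ : 0 = 0 * norm2 P (Jq g) + (norm2 P (Jp f) + 0) * 0); last by ring.
  by apply: cvgD; apply: cvgM => //; [exact: cvg_cst|apply: cvgD => //; exact: cvg_cst].
have [j De] : exists j, D j < e.
  move/cvgrPdist_lt : cD => /(_ _ e0) [j _ /(_ j (leqnn _))] /=.
  by rewrite sub0r normrN => /(le_lt_trans (ler_norm _)) h; exists j.
have [n1 l1] := lu j; have [n2 l2] := lv j.
have aL := L2B (JpL _ (uL j)) (JpL _ fL); have bL := L2B (JqL _ (vL j)) (JqL _ gL).
have iuv := L2_mul_integrable (JpL _ (uL j)) (JqL _ (vL j)).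
have ifg := L2_mul_integrable (JpL _ fL) (JqL _ gL).
exists (maxn n1 n2), (fun o => Jp (u j) o * Jq (v j) o); split => //.
  apply: cell_measurable_mul.
  + apply: cell_measurable_level => //; apply: level_le l1; exact: leq_maxl.
  + apply: cell_measurable_level => //; apply: level_le l2; exact: leq_maxr.
have k1 := integrable_real_norm (L2_mul_integrable aL (JqL _ gL)).
have k2 := integrable_real_norm (L2_mul_integrable (JpL _ (uL j)) bL).
have Rle (x y : Omega -> R) : L2 P x -> L2 P y -> \int[P]_o `|x o * y o| <= norm2 P x * norm2 P y.
  move=> xL yL; rewrite -lee_fin; apply: le_trans (L2_mul_le xL yL).
  rewrite /Rintegral fineK//; apply: (integrable_fin_num measurableT).
  exact: integrable_real_norm (L2_mul_integrable xL yL).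
apply: le_lt_trans De.
apply: (@le_trans _ _ (\int[P]_o (`|(Jp (u j) o - Jp f o) * Jq g o| + `|Jp (u j) o * (Jq (v j) o - Jq g o)|))).
  apply: le_Rintegral => //.
  - by apply: integrable_real_norm; apply: integrable_realB.
  - exact: integrable_realD.
  move=> o _; rewrite distrC; apply: le_trans (ler_normD _ _); rewrite le_eqVlt; apply/orP; left.
  by apply/eqP; congr `|_|; ring.
rewrite RintegralD//; apply: lerD; first exact: (Rle _ _ aL (JqL _ gL)).
apply: le_trans (Rle _ _ (JpL _ (uL j)) bL) _; apply: ler_wpM2r; first exact: norm2_ge0.
have := norm2D (JpL _ fL) aL; congr (_ <= _); congr norm2.
by apply/funext => o; rewrite addrC subrK.
Qed.

End product.

Variable I : forall m : nat, (m.-tuple T -> R) -> Omega -> R.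
Hypothesis HI : wiener_ito nu N I.

(** The product with the constant 1 of order 0. *)
Lemma approximable_chaos m h : L2s nu h -> approximable (chaos I (m := m) h).
Proof.
move=> hL; have := approximable_product (multiple_integral_chaos HI m)
  (multiple_integral_chaos HI 0) hL (L2s_one nu).
rewrite (_ : (fun o => _) = chaos I (m := m) h)//.
by apply/funext => o /=; rewrite mulr1.
Qed.

Theorem chaos_product_formula p q (f : p.-tuple T -> R) (g : q.-tuple T -> R) :
  (0 < p)%N -> (0 < q)%N -> L2s nu f -> L2s nu g ->
  (forall r l : nat, (r <= minn p q)%N -> (l <= r)%N ->
    L2 (pm (p + q - r - l)) (star_contraction nu f g r l)) ->
  product_formula nu P I f g.
Proof.
move=> p0 q0 fL gL fgL.
have symL (r : 'I_(minn p q).+1) (l : 'I_r.+1) : L2s nu (symmetrize (star_contraction nu f g r l)).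
  have := ltn_ord r; have := ltn_ord l; rewrite !ltnS => lr rpq.
  by case: (L2_symmetrize (fgL _ _ rpq lr)).
have ifg := L2_mul_integrable (chaos_L2 HI fL) (chaos_L2 HI gL).
have h1 (r : 'I_(minn p q).+1) := approximable_sum (index_enum _) (fun l : 'I_r.+1 => 'C(r, l)%:R)
  (fun l => L2_integrable (chaos_L2 HI (symL r l))) (fun l => approximable_chaos (symL r l)).
have [i2 a2] := approximable_sum (index_enum _)
  (fun r : 'I_(minn p q).+1 => r`!%:R * 'C(p, r)%:R * 'C(q, r)%:R) (fun r => (h1 r).1) (fun r => (h1 r).2).
have aD : approximable (defect nu I f g).
  rewrite (_ : defect nu I f g = fun o => -1 * product_rhs nu I f g o + chaos I f o * chaos I g o).
    apply: approximable_lin => //; apply: approximable_product => //; exact: multiple_integral_chaos.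
  by apply/funext => o; rewrite /defect mulN1r addrC.
have := separation fW sepW null1 HN (integrable_realB ifg i2)
  (defect_test fW sepW null1 genW covW HN HI fL gL fgL) aD.
have : {ae P, forall o, forall (r : 'I_(minn p q).+1) (l : 'I_r.+1),
    I (symmetrize (star_contraction nu f g r l)) o =
    chaos I (symmetrize (star_contraction nu f g r l)) o}.
  apply: filter_forall => r; apply: filter_forall => l.
  by have := chaosE HI (symmetrize (star_contraction nu f g r l)); apply: filterS => o /= h; exact: h.
apply: filterS2 => o hE /(_ Logic.I) /eqP; rewrite /defect subr_eq0 => /eqP h _.
(* [chaos] departs from [I] at order 0 only, and p and q are positive. *)
transitivity (chaos I f o * chaos I g o); first by move: p0 q0 f g {fL gL fgL symL ifg h1 i2 a2 aD hE h}; case: p => // ? _; case: q.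
rewrite h; apply: eq_bigr => r _; congr (_ * _); apply: eq_bigr => l _; congr (_ * _).
by rewrite hE.
Qed.

End approximation.

(** * Cells of a Polish space *)

Section polish_cells.
Context (R : realType) (Z : ptopologicalType).
Variable nu : {sigma_finite_measure set (borel Z) -> \bar R}.
Hypotheses (PZ : polish R Z) (nuZ : nonatomic nu).

(** Balls of radius 1/(n+1) around a dense sequence separate points and form a base of the topology;
    intersecting them with a sigma-finite exhaustion makes their measures finite. *)
Lemma countable_generating_sets : exists W : nat -> set (borel Z),
  [/\ forall i, finite_sets nu (W i),
      forall x y, (forall i, W i x <-> W i y) -> x = y,
      forall x, nu [set x] = 0%E,
      forall A, measurable A -> <<s range W >> A
    & forall x, exists i, W i x].
Proof.
have [[D cD dD] [dist [[dist0 disteq0] distC distT nbhsE _]]] := PZ.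
pose B x r : set Z := [set y | dist x y < r].
have oB x r : open (B x r).
  rewrite openE => y /= yr; apply/nbhsE; exists (r - dist x y); first by rewrite subr_gt0.
  by move=> z; rewrite /B/= ltrBrDl; apply: le_lt_trans; exact: distT.
have dxx x : dist x x = 0 by apply/disteq0.
have [e eD] : exists e : nat -> Z, forall x, D x -> exists j, e j = x.
  have /pcard_surjP[e eD] := cD; exists e => x /eD[j _ ejx]; by exists j.
have den x (r : R) : 0 < r -> exists j, dist (e j) x < r.
  move=> r0; have [y [yr /eD[j ejy]]] : B x r `&` D !=set0.
    by apply: dD => //; exists x; rewrite /B/= dxx.
  by exists j; rewrite ejy distC.
have small (r : R) : 0 < r -> exists n : nat, n.+1%:R^-1 + n.+1%:R^-1 < r.
  move=> r0; have r2 : 0 < r / 2 by rewrite divr_gt0.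
  by have [n] := ltr_add_invr r2; rewrite add0r => nr; exists n; rewrite [ltRHS]splitr; exact: ltrD.
have tri (a b c r' r : R) : a < c -> b < c -> c + c < r -> r' <= a + b -> r' < r.
  by move=> ac bc cr /le_lt_trans; apply; apply: lt_trans cr; exact: ltrD.
have [E ET Efin] := sigma_finiteT nu.
pose W (i : nat) : set (borel Z) := if unpickle i is Some (j, n, k)
  then B (e j) n.+1%:R^-1 `&` E k else set0.
have Wjnk j n k : W (pickle (j, n, k)) = B (e j) n.+1%:R^-1 `&` E k by rewrite /W pickleK.
have mO (O : set (borel Z)) : @open Z O -> measurable O by move=> oO; exact: sub_sigma_algebra.
have covE (x : borel Z) : exists k, E k x.
  by have : [set: borel Z] x by []; rewrite ET => -[k _ Ekx]; exists k.
exists W; split.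
- move=> i; rewrite /W; case: (unpickle i) => [[[j n] k]|]; last by split; rewrite ?measure0.
  have [mE Eoo] := Efin k; have mBE : measurable (B (e j) n.+1%:R^-1 `&` E k : set (borel Z)).
    by apply: measurableI => //; exact: mO.
  by split=> //; apply: le_lt_trans Eoo; apply: le_measure; rewrite ?in_setE//; exact: subIsetr.
- move=> x y xy; apply: contrapT => neq.
  have r0 : 0 < dist x y.
    by rewrite lt_neqAle dist0 andbT eq_sym; apply/eqP => /disteq0.
  have [n nr] := small _ r0; have [j jx] := den x n.+1%:R^-1 ltac:(by rewrite invr_gt0).
  have [k kx] := covE x; have [h _] := xy (pickle (j, n, k)).
  move: h; rewrite Wjnk => /(_ (conj jx kx))[/= jy _].
  have := distT x (e j) y; rewrite (distC x (e j)) => /(tri _ _ _ _ _ jx jy nr).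
  by rewrite ltxx.
- move=> x; have mx : measurable ([set x] : set (borel Z)).
    rewrite -[X in measurable X]setCK; apply: measurableC; apply: mO; rewrite openE => y /= yx.
    apply/nbhsE; exists (dist x y).
      by rewrite lt_neqAle dist0 andbT eq_sym; apply/eqP => /disteq0 xy; exact/yx.
    by move=> z /= yz zx; move: yz; rewrite zx distC ltxx.
  apply/eqP; rewrite eq_le measure_ge0 andbT leNgt; apply/negP => x0.
  (* A subset of a singleton is empty or everything, so a singleton of positive measure would be an
     atom. *)
  apply: (nuZ (A := [set x])); split=> // C mC Cx.
  have [Cxx|nCx] := pselect (C x).
    by right; rewrite (_ : _ `\` _ = set0) ?measure0//; apply/seteqP; split=> y // -[/= ->].
  by left; rewrite (_ : C = set0) ?measure0//; apply/seteqP; split=> y // Cy; move: (Cx _ Cy) => /= yx; rewrite yx in Cy.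
- apply: smallest_sub; first exact: smallest_sigma_algebra.
  (* An open set is the union of those [W i] that it contains, and there are only countably many. *)
  move=> O oO; pose F i : set (borel Z) := if `[< W i `<=` O >] then W i else set0.
  have -> : O = \bigcup_i F i.
    apply/seteqP; split=> x; last first.
      by move=> [i _]; rewrite /F; case: asboolP => // h; exact: h.
    move=> Ox; have : nbhs (x : Z) O by move: oO; rewrite openE; exact.
    move=> /nbhsE[r r0 rO]; have [n nr] := small _ r0.
    have [j jx] := den x n.+1%:R^-1 ltac:(by rewrite invr_gt0); have [k kx] := covE x.
    exists (pickle (j, n, k)) => //; rewrite /F asboolT ?Wjnk// => y [/= jy _]; apply: rO => /=.
    by have := distT x (e j) y; rewrite (distC x (e j)) => /(tri _ _ _ _ _ jx jy nr).
  apply: sigma_algebra_bigcup => i; rewrite /F; case: asboolP => _; last exact: sigma_algebra0.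
  by apply: sub_sigma_algebra; exists i.
- move=> x; have [j jx] := den x 1 ltr01; have [k kx] := covE x.
  by exists (pickle (j, 0%N, k)); rewrite Wjnk; split=> //; rewrite /B/= invr1.
Qed.

End polish_cells.

(** * Contractions of elementary functions *)

Section tame_functions.
Context (d : measure_display) (T : measurableType d) (R : realType).
Variable nu : {sigma_finite_measure set T -> \bar R}.
Local Notation pm := (power_measure nu).

(** Bounded by [M] and supported in the m-th power of [A]. Unlike membership in [Es0], this form of
    bound is visibly inherited by contractions. *)
Definition tame m (A : set T) (M : R) (f : m.-tuple T -> R) :=
  measurable_fun setT f /\ forall x, `|f x| <= M * \prod_(y <- x) \1_A y.

Lemma prod_indic_rect m (A : set T) (x : m.-tuple T) :
  \prod_(y <- x) (\1_A y : R) = \1_(rect (fun=> A)) x.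
Proof.
rewrite big_tuple [RHS]indicE; have [h|h] := boolP (x \in rect (fun=> A)).
  by rewrite big1// => i _; rewrite indicE mem_set//; move: h; rewrite inE; exact.
have /existsNP[i Ai] : ~ forall i, A (tnth x i) by move=> k; move/negP: h; apply; rewrite inE.
by rewrite (bigD1 i)//= indicE memNset ?mul0r.
Qed.

Lemma L2_prod_indic m A : finite_sets nu A ->
  L2 (pm m) (fun x => \prod_(y <- x) (\1_A y : R)).
Proof.
move=> fA; rewrite (_ : (fun x => _) = \1_(rect (fun=> A))).
  by have [mr roo] := finite_rect (fun _ : 'I_m => fA); exact: L2_indic.
by apply/funext => x; exact: prod_indic_rect.
Qed.

Lemma tame_L2 m A M (f : m.-tuple T -> R) : finite_sets nu A -> tame A M f -> L2 (pm m) f.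
Proof.
move=> fA [mf bf]; have gL := L2Z M (L2_prod_indic m fA).
apply/L2P; split=> //; apply: (@le_lt_trans _ _ (sqint (pm m) (fun x => M * \prod_(y <- x) \1_A y))).
  apply: ge0_le_integral => //.
  - by move=> x _; rewrite lee_fin sqr_ge0.
  - by apply/measurable_EFinP; exact: measurable_funX.
  - by apply/measurable_EFinP; apply: measurable_funX; exact: L2_measurable gL.
  move=> x _; rewrite lee_fin -[leLHS]real_normK ?num_real// ler_pXn2r ?nnegrE//.
  exact: le_trans (bf x).
by rewrite L2_sqint// ltry.
Qed.

Lemma tame_le m A A' M M' (f : m.-tuple T -> R) : A `<=` A' -> 0 <= M -> M <= M' ->
  tame A M f -> tame A' M' f.
Proof.
move=> AA M0 MM [mf bf]; split=> // x; apply: le_trans (bf x) _.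
apply: ler_pM => //; first exact: prodr_ge0.
apply: ler_prod => y _; rewrite !indicE ler0n ler_nat /=.
by case: (boolP (y \in A)) => // /set_mem/AA/mem_set ->.
Qed.

Lemma finite_bigsetU n (F : 'I_n -> set T) : (forall i, finite_sets nu (F i)) ->
  finite_sets nu (\big[setU/set0]_i F i).
Proof.
move=> fF; apply: big_ind => // [|A B [mA Aoo] [mB Boo]]; first by split; rewrite ?measure0.
split; first exact: measurableU.
by apply: le_lt_trans (measureU2 _ _ _) _ => //; rewrite lte_add_pinfty.
Qed.

Lemma tame_Es0 m (f : m.-tuple T -> R) : Es0 nu f ->
  L2s nu f /\ exists A M, [/\ finite_sets nu A, 0 <= M & tame A M f].
Proof.
move=> [n [a [C [dC ->]]]]; split.
  apply: (L2s_sum (index_enum _) a (F := fun k => \1_(sym_rect (C k)))) => k.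
  by apply: L2s_sym_rect => i; case: (dC k).
exists (\big[setU/set0]_k \big[setU/set0]_i C k i), (\sum_k `|a k|).
have fC (k : 'I_n) (i : 'I_m) : finite_sets nu (C k i) by case: (dC k).
split.
- by apply: finite_bigsetU => k; exact: finite_bigsetU.
- exact: sumr_ge0.
split.
  apply: measurable_sum => k; apply: measurable_funM => //; apply: measurable_indic.
  by case: (finite_sym_rect (fC k)).
move=> x; apply: le_trans (ler_norm_sum _ _ _) _; rewrite mulr_suml; apply: ler_sum => k _.
rewrite normrM ler_wpM2l// indicE normr_nat; case: (boolP (x \in _)) => [xC|_]; last exact: prodr_ge0.
rewrite prod_indic_rect indicE mem_set//; move: xC; rewrite inE => -[w _ wx] i /=.
rewrite (bigD1 k)//=; left; rewrite (bigD1 (w i))//=; left; exact: wx.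
Qed.

Section contraction.
Variables (p q r l : nat).
Hypotheses (rp : (r <= p)%N) (rq : (r <= q)%N) (lr : (l <= r)%N).
Variables (f : p.-tuple T -> R) (g : q.-tuple T -> R) (A : set T) (M M' : R).
Hypotheses (fA : finite_sets nu A) (M0 : 0 <= M) (M'0 : 0 <= M').
Hypotheses (tf : tame A M f) (tg : tame A M' g).

Lemma tame_eval_seq m K (h : m.-tuple T -> R) (s : seq T) : 0 <= K -> tame A K h ->
  `|eval_seq h s| <= K * \prod_(y <- s) \1_A y.
Proof.
move=> K0 [_ hb]; rewrite /eval_seq; case: insubP => [t _ <-|_]; first exact: hb.
by rewrite normr0 mulr_ge0// prodr_ge0.
Qed.

Lemma star_integrand_le (z : l.-tuple T) (x : (p + q - r - l).-tuple T) :
  `|star_integrand r l f g z x| <= M * M' * (\prod_(y <- z) \1_A y * \prod_(y <- x) \1_A y).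
Proof.
rewrite /star_integrand normrM; have := tame_eval_seq (z ++ take (r - l) x ++ drop (p - l) x) M'0 tg.
have := tame_eval_seq (z ++ take (r - l) x ++ take (p - r) (drop (r - l) x)) M0 tf.
rewrite !big_cat/= => hf hg.
have -> : \prod_(y <- x) (\1_A y : R) = \prod_(y <- take (r - l) x) \1_A y *
    (\prod_(y <- take (p - r) (drop (r - l) x)) \1_A y * \prod_(y <- drop (p - l) x) \1_A y).
  rewrite -[in LHS](cat_take_drop (r - l) x) big_cat/=; congr (_ * _).
  rewrite -[in LHS](cat_take_drop (p - r) (drop (r - l) x)) big_cat/= drop_drop.
  by (rewrite (_ : (p - r + (r - l) = p - l)%N); last lia).
have ab0 (s : seq T) : 0 <= \prod_(y <- s) (\1_A y : R) by exact: prodr_ge0.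
have ab1 (s : seq T) : \prod_(y <- s) (\1_A y : R) <= 1 by exact: prod_indic_le1.
move: hf hg; set F := eval_seq f _; set G := eval_seq g _.
have := ab0 z; have := ab1 z; move: (\prod_(y <- z) _) => a a1 a0.
have := ab0 (take (r - l) x); have := ab1 (take (r - l) x); move: (\prod_(y <- take (r - l) x) _) => b b1 b0.
have := ab0 (take (p - r) (drop (r - l) x)); move: (\prod_(y <- take (p - r) _) _) => c c0.
have := ab0 (drop (p - l) x); move: (\prod_(y <- drop (p - l) x) _) => e e0 hf hg.
apply: (@le_trans _ _ ((M * (a * (b * c))) * (M' * (a * (b * e))))); first exact: ler_pM.
(* The integrated and the shared variables occur in both f and g; the second copy of their
   indicators is at most 1 and is dropped. *)
rewrite (_ : M * (a * (b * c)) * (M' * (a * (b * e))) = (M * M' * (a * (b * (c * e)))) * (a * b)); last ring.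
by rewrite ler_piMr ?mulr_ge0// mulr_ile1.
Qed.

Lemma tame_star_contraction : L2 (pm (p + q - r - l)) (star_contraction nu f g r l).
Proof.
have fL := tame_L2 fA tf; have gL := tame_L2 fA tg.
have mA : measurable_fun setT (\1_A : T -> R) by apply: measurable_indic; case: fA.
have nA y : `|\1_A y| <= \1_A y :> R by rewrite ger0_norm.
have iS := star_integrable mA fA nA rp rq lr fL gL; have mS := measurable_int _ iS.
have MM : 0 <= M * M' by exact: mulr_ge0.
(* The integrand is already supported in [A], so the weight phi = 1_A changes nothing;
   [star_integrable] and Fubini then give measurability of the contraction. *)
have zE (z : l.-tuple T) (x : (p + q - r - l).-tuple T) :
    star_integrand r l f g z x = star_integrand r l f g z x * \prod_(y <- x) \1_A y.
  have := star_integrand_le z x; rewrite !prod_indic_rect [\1_(rect _) x]indicE.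
  case: (x \in _); first by rewrite !mulr1.
  by rewrite !mulr0 normr_le0 => /eqP ->.
pose one z := \prod_(y <- z) \1_A y : R.
have one_L2 : L2 (pm l) one := L2_prod_indic l fA.
have i1 : (pm l).-integrable setT (EFin \o (fun z : l.-tuple T => one z)).
  rewrite (_ : _ \o _ = (fun z : l.-tuple T => (one z * one z)%:E)); first exact: L2_mul_integrable.
  apply/funext => z; rewrite /= /one !prod_indic_rect indicE.
  by case: (_ \in _); rewrite ?mulr1 ?mulr0.
have mz (x : (p + q - r - l).-tuple T) : measurable_fun [set: l.-tuple T] (fun z : l.-tuple T => star_integrand r l f g z x).
  have mpair : measurable_fun [set: l.-tuple T] (fun z : l.-tuple T => (z, x)).
    by apply: measurable_fun_pair; [exact: measurable_id|exact: measurable_cst].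
  have := measurableT_comp mS mpair => /measurable_EFinP.
  rewrite (_ : (fun z => _) = (fun z : l.-tuple T => star_integrand r l f g z x))//.
  by apply/funext => z /=; rewrite -zE.
have ile (x : (p + q - r - l).-tuple T) : (pm l).-integrable setT
    (EFin \o (fun z : l.-tuple T => (M * M' * \prod_(y <- x) \1_A y) * one z)).
  exact: (integrableZl measurableT _ i1).
have le (z : l.-tuple T) (x : (p + q - r - l).-tuple T) :
    `|star_integrand r l f g z x| <= (M * M' * \prod_(y <- x) \1_A y) * one z.
  apply: le_trans (star_integrand_le z x) _.
  by rewrite le_eqVlt; apply/orP; left; apply/eqP; rewrite /one; ring.
have ia (x : (p + q - r - l).-tuple T) :
    (pm l).-integrable setT (EFin \o (fun z : l.-tuple T => star_integrand r l f g z x)).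
  apply: (le_integrable measurableT _ _ (ile x)); first exact/measurable_EFinP.
  by move=> z _ /=; rewrite lee_fin; apply: le_trans (le z x) (ler_norm _).
apply: (@tame_L2 _ A (M * M' * \int[pm l]_z one z)) => //; split.
  rewrite (_ : star_contraction nu f g r l = fine \o fubini_G (pm l)
      (fun z : l.-tuple T * (p + q - r - l).-tuple T => (star_integrand r l f g z.1 z.2 * \prod_(y <- z.2) \1_A y)%:E)).
    by apply: measurableT_comp => //; exact: (measurable_fubini_G iS).
  apply/funext => x; rewrite /star_contraction /Rintegral /fubini_G /=; congr fine.
  by apply: eq_integral => z _; rewrite -zE.
move=> x; rewrite /star_contraction; apply: le_trans (le_normr_Rintegral measurableT (ia x)) _.
have -> : M * M' * \int[pm l]_z one z * \prod_(y <- x) \1_A y =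
    \int[pm l]_z ((M * M' * \prod_(y <- x) \1_A y) * one z).
  by rewrite RintegralZl//; ring.
apply: le_Rintegral => //; first exact: (integrable_abse (ia x)).
Qed.

End contraction.

End tame_functions.

Unset Implicit Arguments.

Theorem proposition6p2 (R : realType) (Z : ptopologicalType)
    (nu : {sigma_finite_measure set (borel Z) -> \bar R})
    (d : measure_display) (Omega : measurableType d) (P : probability Omega R)
    (N : set (borel Z) -> {RV P >-> R})
    (I : forall m : nat, (m.-tuple (borel Z) -> R) -> Omega -> R) :
  polish R Z -> nonatomic nu ->
  compensated_poisson nu N -> wiener_ito nu N I ->
  (forall (p q : nat) (f : p.-tuple (borel Z) -> R)
      (g : q.-tuple (borel Z) -> R),
    (0 < p)%N -> (0 < q)%N -> Es0 nu f -> Es0 nu g ->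
    product_formula nu P I f g) /\
  (forall (p q : nat) (f : p.-tuple (borel Z) -> R)
      (g : q.-tuple (borel Z) -> R),
    (0 < p)%N -> (0 < q)%N -> L2s nu f -> L2s nu g ->
    (forall r l : nat, (r <= minn p q)%N -> (l <= r)%N ->
      star_contraction nu f g r l \in
        Lfun (power_measure nu (p + q - r - l)) 2%:E) ->
    product_formula nu P I f g).
Proof.
move=> PZ nuZ HN HI.
have [W [fW sepW null1 genW covW]] := countable_generating_sets PZ nuZ.
split=> p q f g p0 q0; last by move=> fL gL fgL; exact: (chaos_product_formula fW sepW null1 genW covW HN HI).
move=> /tame_Es0[fL [A [M [fA M0 tf]]]] /tame_Es0[gL [A' [M' [fA' M'0 tg]]]].
apply: (chaos_product_formula fW sepW null1 genW covW HN HI) => // r l rpq lr.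
have [rp rq] : (r <= p)%N /\ (r <= q)%N by apply/andP; rewrite -leq_min.
(* One set of finite measure that supports both f and g. *)
have fAA : finite_sets nu (A `|` A').
  split; first by apply: measurableU; [case: fA|case: fA'].
  by apply: le_lt_trans (measureU2 _ fA.1 fA'.1) _; rewrite lte_add_pinfty//; [case: fA|case: fA'].
apply: (tame_star_contraction rp rq lr fAA M0 M'0).
  by apply: tame_le tf => //; exact: subsetUl.
by apply: tame_le tg => //; exact: subsetUr.
Qed.
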